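(* Given a $\mathcal{DL}_{\mathbf{D}}^{4,\times}$-knowledge base $\mathcal{KB}$ and a HO $\mathcal{DL}_{\mathbf{D}}^{4,\times}$-conjunctive query $Q$, the HOCQA problem for $Q$ w.r.t. $\mathcal{KB}$ is decidable. That is, the HO answer set of $Q$ w.r.t. $\mathcal{KB}$ can be computed effectively.
   Context: **Data type map.** A data type map $\mathbf{D}=(N_D,N_C,N_F,\cdot^{\mathbf{D}})$ consists of: - a finite set $N_D$ of data types; - sets of constants $N_C(d)$ and of facets $N_F(d)$ for each $d\in N_D$; - interpretations $d^{\mathbf{D}}$, $f^{\mathbf{D}}\subseteq d^{\mathbf{D}}$ for $f\in N_F(d)$, and $e_d^{\mathbf{D}}\in d^{\mathbf{D}}$ for $e_d\in N_C(d)$. The sets $d^{\mathbf{D}}$ are nonempty and pairwise disjoint. Data ranges are: - finite sets $\{e_{d_1},\dots,e_{d_n}\}$ of constants; - facet expressions $\psi_d$, i.e. Boolean combinations of facets of $d$, interpreted by the corresponding set operations inside $d^{\mathbf{D}}$; - negations $\neg dr$ of data ranges. **Names.** Let $\mathbf{R_A}$ (abstract role names, containing the universal role $U$), $\mathbf{R_D}$ (concrete role names), $\mathbf{C}$ (concept names) and $\mathbf{Ind}$ (individual names) be denumerable and pairwise disjoint. **Syntax of terms.** - Data type terms: $t\to dr\mid\neg t\mid t_1\sqcap t_2\mid t_1\sqcup t_2\mid\{e_d\}$. - Concept terms: $C\to A\mid\top\mid\bot\mid\neg C\mid C_1\sqcup C_2\mid C_1\sqcap C_2\mid\{a\}\mid\exists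 R.\mathit{Self}\mid\exists R.\{a\}\mid\exists P.\{e_d\}$. - Abstract role terms: $R\to S\mid U\mid R^-\mid\neg R\mid R_1\sqcup R_2\mid R_1\sqcap R_2\mid R_{C|}\mid R_{|C}\mid R_{C_1|C_2}\mid id(C)\mid C_1\times C_2$. - Concrete role terms: $P\to T\mid\neg P\mid P_1\sqcup P_2\mid P_1\sqcap P_2\mid P_{C|}\mid P_{|t}\mid P_{C|t}$. Here $A\in\mathbf{C}$, $S\in\mathbf{R_A}$, $T\in\mathbf{R_D}$, $a\in\mathbf{Ind}$ and $e_d\in N_C(d)$. **Knowledge bases.** A knowledge base is a triple $(\mathcal{R},\mathcal{T},\mathcal{A})$. - RBox $\mathcal{R}$: a set of statements $R_1\equiv R_2$, $R_1\sqsubseteq R_2$, $R_1\dots R_n\sqsubseteq R_{n+1}$, $\mathsf{Sym}(R)$, $\mathsf{Asym}(R)$, $\mathsf{Ref}(R)$, $\mathsf{Irref}(R)$, $\mathsf{Dis}(R_1,R_2)$, $\mathsf{Tra}(R)$, $\mathsf{Fun}(R)$, $R\equiv C_1\times C_2$, $P_1\equiv P_2$, $P_1\sqsubseteq P_2$, $\mathsf{Dis}(P_1,P_2)$, $\mathsf{Fun}(P)$. - TBox $\mathcal{T}$: a set of statements $C_1\equiv C_2$, $C_1\sqsubseteq C_2$, $C_1\sqsubseteq\forall R.C_2$, $\exists R.C_1\sqsubseteq C_2$, ${\geq_n}R.C_1\sqsubseteq C_2$, $C_1\sqsubseteq{\leq_n}R.C_2$, $t_1\equiv t_2$, $t_1\sqsubseteq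 t_2$, $C\sqsubseteq\forall P.t$, $\exists P.t\sqsubseteq C$, ${\geq_n}P.t\sqsubseteq C$, $C\sqsubseteq{\leq_n}P.t$. - ABox $\mathcal{A}$: a set of assertions $a:C$, $(a,b):R$, $a=b$, $a\neq b$, $e_d:t$, $(a,e_d):P$. **Semantics.** An interpretation $\mathbf{I}=(\Delta^{\mathbf{I}},\Delta_{\mathbf{D}},\cdot^{\mathbf{I}})$ has nonempty disjoint domains $\Delta^{\mathbf{I}}$ and $\Delta_{\mathbf{D}}\supseteq\bigcup_d d^{\mathbf{D}}$. It satisfies: - $A^{\mathbf{I}}\subseteq\Delta^{\mathbf{I}}$, $a^{\mathbf{I}}\in\Delta^{\mathbf{I}}$, $S^{\mathbf{I}}\subseteq\Delta^{\mathbf{I}}\times\Delta^{\mathbf{I}}$, $T^{\mathbf{I}}\subseteq\Delta^{\mathbf{I}}\times\Delta_{\mathbf{D}}$, $U^{\mathbf{I}}=\Delta^{\mathbf{I}}\times\Delta^{\mathbf{I}}$. - Data type terms, concepts and roles: $\neg$, $\sqcap$, $\sqcup$ are complement (w.r.t. $\Delta_{\mathbf{D}}$, $\Delta^{\mathbf{I}}$, $\Delta^{\mathbf{I}}\times\Delta^{\mathbf{I}}$, $\Delta^{\mathbf{I}}\times\Delta_{\mathbf{D}}$ respectively), intersection and union. Also $\top^{\mathbf{I}}=\Delta^{\mathbf{I}}$, $\bot^{\mathbf{I}}=\emptyset$, $\{a\}^{\mathbf{I}}=\{a^{\mathbf{I}}\}$, $\{e_d\}^{\mathbf{D}}=\{e_d^{\mathbf{D}}\}$.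 - $(\exists R.\mathit{Self})^{\mathbf{I}}=\{x:(x,x)\in R^{\mathbf{I}}\}$, $(\exists R.\{a\})^{\mathbf{I}}=\{x:(x,a^{\mathbf{I}})\in R^{\mathbf{I}}\}$, $(\exists P.\{e_d\})^{\mathbf{I}}=\{x:(x,e_d^{\mathbf{D}})\in P^{\mathbf{I}}\}$. - $(R^-)^{\mathbf{I}}$ is the inverse relation and $(C_1\times C_2)^{\mathbf{I}}=C_1^{\mathbf{I}}\times C_2^{\mathbf{I}}$. - $R_{C|}$, $R_{|C}$, $R_{C_1|C_2}$ restrict $R^{\mathbf{I}}$ to pairs whose first, second, or first and second components lie in $C$ (resp. $C_1$, $C_2$); similarly $P_{C|}$, $P_{|t}$, $P_{C|t}$. Also $id(C)^{\mathbf{I}}=\{(x,x):x\in C^{\mathbf{I}}\}$. - Axioms are read with their usual set-theoretic meaning: inclusions are subset, $\equiv$ is equality, and $R_1\dots R_n\sqsubseteq R$ means $R_1^{\mathbf{I}}\circ\dots\circ R_n^{\mathbf{I}}\subseteq R^{\mathbf{I}}$. $\mathsf{Sym},\mathsf{Asym},\mathsf{Tra},\mathsf{Ref},\mathsf{Irref},\mathsf{Fun},\mathsf{Dis}$ are symmetry, asymmetry, transitivity, reflexivity, irreflexivity, functionality and disjointness. - $\forall R.C$ is the set of $x$ all of whose $R$-successors are in $C$; $\exists R.C$ is the set of $x$ with some $R$-successor in $C$; ${\geq_n}R.C$ (resp. ${\leq_n}R.C$) is the set of $x$ with at least (resp. at most) $n$ $R$-successors in $C$; analogously for concrete roles with data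 type terms. - Assertions: $a:C$ iff $a^{\mathbf{I}}\in C^{\mathbf{I}}$; $(a,b):R$ iff $(a^{\mathbf{I}},b^{\mathbf{I}})\in R^{\mathbf{I}}$; $(a,e_d):P$ iff $(a^{\mathbf{I}},e_d^{\mathbf{D}})\in P^{\mathbf{I}}$; $e_d:t$ iff $e_d^{\mathbf{D}}\in t^{\mathbf{D}}$; $a=b$ and $a\neq b$ as usual. - $\mathbf{I}\models_{\mathbf{D}}\mathcal{KB}$ iff $\mathbf{I}$ satisfies every statement of $\mathcal{KB}$. **Queries.** Let $\mathsf{V_i},\mathsf{V_c},\mathsf{V_{ar}},\mathsf{V_{cr}}$ be pairwise disjoint denumerable sets of variables, disjoint from all names and constants. A HO atomic formula has one of the forms $R(w_1,w_2)$, $P(w_1,u_1)$, $C(w_1)$, $\mathsf{r}(w_1,w_2)$, $\mathsf{p}(w_1,u_1)$, $\mathsf{c}(w_1)$, $w_1=w_2$, $u_1=u_2$. Here: - $w_i\in\mathsf{V_i}\cup\mathbf{Ind}$ and $u_i\in\mathsf{V_i}\cup\bigcup_d N_C(d)$; - $R,P,C$ are abstract role, concrete role and concept terms; - $\mathsf{r}\in\mathsf{V_{ar}}$, $\mathsf{p}\in\mathsf{V_{cr}}$, $\mathsf{c}\in\mathsf{V_c}$. A HO conjunctive query is a conjunction of HO atomic formulae and their negations. **Answer sets.** A substitution maps: - variables in $\mathsf{V_i}$ to elements of $\mathbf{Ind}\cup\bigcup_d N_C(d)$; - variables in $\mathsf{V_c}$ to concept names in $\mathbf{C}$; - variables in $\mathsf{V_{ar}}$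 to names in $\mathbf{R_A}$; - variables in $\mathsf{V_{cr}}$ to names in $\mathbf{R_D}$. It acts on queries by replacement. A substitution $\sigma$ on exactly the variables of $Q$ is a solution for $Q$ w.r.t. $\mathcal{KB}$ if some interpretation $\mathbf{I}$ satisfies $\mathbf{I}\models_{\mathbf{D}}\mathcal{KB}$ and $\mathbf{I}\models_{\mathbf{D}}Q\sigma$. The set of solutions is the HO answer set of $Q$ w.r.t. $\mathcal{KB}$. The HOCQA problem is to compute this answer set.
   Formalization: Adds that satisfiability over D of finite conjunctions of constraints x:dr and x≠y is decidable (the claim fails for a non-recursive facet); knowledge bases are finite, constants and facets countable, and computing the answer set means uniformly deciding membership of a substitution. *)

(* Defs.v *)
From Stdlib Require List.
From mathcomp Require Import all_boot.

Set Implicit Arguments.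
Unset Strict Implicit.
Unset Printing Implicit Defensive.

(** * Computability *)

(* The (total) recursive functions: the least class containing zero, successor
   and projections, closed under composition, primitive recursion and regular
   minimisation. In [rec_mu] regularity is the existence of [h]. *)
Inductive recursive : forall n : nat, (n.-tuple nat -> nat) -> Prop :=
| rec_zero n : @recursive n (fun _ => 0)
| rec_succ : @recursive 1 (fun v => (thead v).+1)
| rec_proj n (i : 'I_n) : @recursive n (fun v => tnth v i)
| rec_comp m n (f : m.-tuple nat -> nat) (g : 'I_m -> n.-tuple nat -> nat) :
    recursive f -> (forall i, recursive (g i)) ->
    @recursive n (fun v => f [tuple g i v | i < m])
| rec_prim n (f : n.-tuple nat -> nat) (g : n.+2.-tuple nat -> nat)
    (h : n.+1.-tuple nat -> nat) :
    recursive f -> recursive g ->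
    (forall v : n.-tuple nat, h [tuple of 0 :: v] = f v) ->
    (forall y (v : n.-tuple nat),
       h [tuple of y.+1 :: v] = g [tuple of y :: h [tuple of y :: v] :: v]) ->
    recursive h
| rec_mu n (f : n.+1.-tuple nat -> nat) (h : n.-tuple nat -> nat) :
    recursive f ->
    (forall v : n.-tuple nat, f [tuple of h v :: v] = 0 /\
       forall y, y < h v -> f [tuple of y :: v] <> 0) ->
    recursive h.

(* [b] is the value at a given point of the characteristic function of [P]. *)
Definition decides (b : nat) (P : Prop) : Prop :=
  (P -> b = 1) /\ (~ P -> b = 0).

(* All syntax is coded by numbers through the bijection [code : seq nat -> nat]
   of the library. *)
Notation code := CodeSeq.code.

(** * Data type maps *)

(* [dint d] is the interpretation of [d]; the union of these pairwise disjoint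
   sets is the type [dval] of dependent pairs below. Constants and facets are
   finite or denumerable, and come with a coding by numbers. *)
Record datatype_map := DatatypeMap {
  N_D : finType;
  N_C : N_D -> countType;
  N_F : N_D -> countType;
  dint : N_D -> Type;
  dint_nonempty : forall d, inhabited (dint d);
  fint : forall d, N_F d -> dint d -> Prop;
  cint : forall d, N_C d -> dint d
}.

Definition const (D : datatype_map) := {d : N_D D & N_C d}.
Definition dval (D : datatype_map) := {d : N_D D & dint d}.

Definition cval D (e : const D) : dval D := existT _ (tag e) (cint (tagged e)).

(** * Syntax of terms *)

(* [FTop] and [FBot] are the empty conjunction and disjunction. *)
Inductive fexpr (D : datatype_map) (d : N_D D) :=
| FAtom of N_F d
| FTop
| FBot
| FNot of fexpr d
| FAnd of fexpr d & fexpr d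
| FOr of fexpr d & fexpr d.

Inductive drange (D : datatype_map) :=
| DRConsts of seq (const D)
| DRFacet (d : N_D D) of fexpr d
| DRNot of drange D.

Inductive dterm (D : datatype_map) :=
| TRange of drange D
| TNot of dterm D
| TAnd of dterm D & dterm D
| TOr of dterm D & dterm D
| TConst of const D.

(* Individual names, concept names and concrete role names are numbers; the
   position in the syntax keeps the sets of names apart. *)
Inductive arname := ARUniv | ARName of nat.

Inductive concept (D : datatype_map) :=
| CName of nat
| CTop
| CBot
| CNot of concept D
| COr of concept D & concept D
| CAnd of concept D & concept D
| CNominal of nat
| CExSelf of arole D
| CExInd of arole D & nat
| CExConst of crole D & const D
with arole (D : datatype_map) :=
| RName of arname
| RInv of arole D
| RNot of arole D
| ROr of arole D & arole D
| RAnd of arole D & arole D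
| RDom of arole D & concept D
| RRan of arole D & concept D
| RDomRan of arole D & concept D & concept D
| RId of concept D
| RProd of concept D & concept D
with crole (D : datatype_map) :=
| PName of nat
| PNot of crole D
| POr of crole D & crole D
| PAnd of crole D & crole D
| PDom of crole D & concept D
| PRan of crole D & dterm D
| PDomRan of crole D & concept D & dterm D.

Arguments FTop {D d}.
Arguments FBot {D d}.
Arguments CName {D}.
Arguments CTop {D}.
Arguments CBot {D}.
Arguments CNominal {D}.
Arguments RName {D}.
Arguments PName {D}.

(** * Knowledge bases *)

Inductive rbox_stmt (D : datatype_map) :=
| REquiv of arole D & arole D
| RIncl of arole D & arole D
| RChain of arole D & seq (arole D) & arole D (* R1 (R2 ... Rn) R(n+1) *)
| RSym of arole D
| RAsym of arole D
| RRef of arole D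
| RIrref of arole D
| RDis of arole D & arole D
| RTra of arole D
| RFun of arole D
| REquivProd of arole D & concept D & concept D
| PEquiv of crole D & crole D
| PIncl of crole D & crole D
| PDis of crole D & crole D
| PFun of crole D.

Inductive tbox_stmt (D : datatype_map) :=
| CEquiv of concept D & concept D
| CIncl of concept D & concept D
| CInclAll of concept D & arole D & concept D
| CExIncl of arole D & concept D & concept D
| CGeqIncl of nat & arole D & concept D & concept D
| CInclLeq of concept D & nat & arole D & concept D
| TEquiv of dterm D & dterm D
| TIncl of dterm D & dterm D
| CInclAllD of concept D & crole D & dterm D
| CExDIncl of crole D & dterm D & concept D
| CGeqDIncl of nat & crole D & dterm D & concept D
| CInclLeqD of concept D & nat & crole D & dterm D.

Inductive abox_stmt (D : datatype_map) :=
| AConcept of nat & concept D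
| ARole of nat & nat & arole D
| AEq of nat & nat
| ANeq of nat & nat
| AData of const D & dterm D
| ACRole of nat & const D & crole D.

Record kb (D : datatype_map) := KB {
  rbox : seq (rbox_stmt D);
  tbox : seq (tbox_stmt D);
  abox : seq (abox_stmt D)
}.

(** * Semantics *)

(* [demb] is the inclusion of the union of the data types into the data
   domain. The two domains are disjoint as they are distinct types. *)
Record interp (D : datatype_map) := Interp {
  Delta : Type;
  DeltaD : Type;
  Delta_nonempty : inhabited Delta;
  DeltaD_nonempty : inhabited DeltaD;
  demb : dval D -> DeltaD;
  demb_inj : injective demb;
  Iind : nat -> Delta;
  Iconcept : nat -> Delta -> Prop;
  Iarole : nat -> Delta -> Delta -> Prop;
  Icrole : nat -> Delta -> DeltaD -> Prop
}.

Definition at_least (n : nat) (T : Type) (X : T -> Prop) : Prop :=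
  exists2 f : 'I_n -> T, injective f & forall i, X (f i).

Definition at_most (n : nat) (T : Type) (X : T -> Prop) : Prop :=
  ~ at_least n.+1 X.

Fixpoint fexpr_sem D (d : N_D D) (psi : fexpr d) (x : dint d) : Prop :=
  match psi with
  | FAtom f => fint f x
  | FTop => True
  | FBot => False
  | FNot p => ~ fexpr_sem p x
  | FAnd p q => fexpr_sem p x /\ fexpr_sem q x
  | FOr p q => fexpr_sem p x \/ fexpr_sem q x
  end.

Fixpoint drange_sem D (T : Type) (emb : dval D -> T) (r : drange D) (v : T)
  : Prop :=
  match r with
  | DRConsts es => exists2 e, List.In e es & v = emb (cval e)
  | DRFacet d psi => exists2 x : dint d, v = emb (existT _ d x) & fexpr_sem psi x
  | DRNot r' => ~ drange_sem emb r' v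
  end.

Fixpoint dterm_sem D (I : interp D) (t : dterm D) (v : DeltaD I) : Prop :=
  match t with
  | TRange r => drange_sem (@demb D I) r v
  | TNot t' => ~ dterm_sem t' v
  | TAnd t1 t2 => dterm_sem t1 v /\ dterm_sem t2 v
  | TOr t1 t2 => dterm_sem t1 v \/ dterm_sem t2 v
  | TConst e => v = demb I (cval e)
  end.

Definition arname_sem D (I : interp D) (N : arname) (x y : Delta I) : Prop :=
  match N with
  | ARUniv => True
  | ARName n => Iarole n x y
  end.

Fixpoint concept_sem D (I : interp D) (C : concept D) (x : Delta I) : Prop :=
  match C with
  | CName A => Iconcept A x
  | CTop => True
  | CBot => False
  | CNot C' => ~ concept_sem C' x
  | COr C1 C2 => concept_sem C1 x \/ concept_sem C2 x
  | CAnd C1 C2 => concept_sem C1 x /\ concept_sem C2 x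
  | CNominal a => x = Iind I a
  | CExSelf R => arole_sem R x x
  | CExInd R a => arole_sem R x (Iind I a)
  | CExConst P e => crole_sem P x (demb I (cval e))
  end
with arole_sem D (I : interp D) (R : arole D) (x y : Delta I) : Prop :=
  match R with
  | RName N => arname_sem N x y
  | RInv R' => arole_sem R' y x
  | RNot R' => ~ arole_sem R' x y
  | ROr R1 R2 => arole_sem R1 x y \/ arole_sem R2 x y
  | RAnd R1 R2 => arole_sem R1 x y /\ arole_sem R2 x y
  | RDom R' C => arole_sem R' x y /\ concept_sem C x
  | RRan R' C => arole_sem R' x y /\ concept_sem C y
  | RDomRan R' C1 C2 =>
      [/\ arole_sem R' x y, concept_sem C1 x & concept_sem C2 y]
  | RId C => x = y /\ concept_sem C x
  | RProd C1 C2 => concept_sem C1 x /\ concept_sem C2 y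
  end
with crole_sem D (I : interp D) (P : crole D) (x : Delta I) (v : DeltaD I)
  : Prop :=
  match P with
  | PName T => Icrole T x v
  | PNot P' => ~ crole_sem P' x v
  | POr P1 P2 => crole_sem P1 x v \/ crole_sem P2 x v
  | PAnd P1 P2 => crole_sem P1 x v /\ crole_sem P2 x v
  | PDom P' C => crole_sem P' x v /\ concept_sem C x
  | PRan P' t => crole_sem P' x v /\ dterm_sem t v
  | PDomRan P' C t =>
      [/\ crole_sem P' x v, concept_sem C x & dterm_sem t v]
  end.

Fixpoint chain_sem D (I : interp D) (R : arole D) (Rs : seq (arole D))
  (x y : Delta I) : Prop :=
  match Rs with
  | [::] => arole_sem R x y
  | R' :: Rs' => exists2 z, arole_sem R x z & chain_sem R' Rs' z y
  end.

Definition rbox_sat D (I : interp D) (s : rbox_stmt D) : Prop :=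
  let r := @arole_sem D I in
  let p := @crole_sem D I in
  let c := @concept_sem D I in
  match s with
  | REquiv R1 R2 => forall x y, r R1 x y <-> r R2 x y
  | RIncl R1 R2 => forall x y, r R1 x y -> r R2 x y
  | RChain R1 Rs R => forall x y, @chain_sem D I R1 Rs x y -> r R x y
  | RSym R => forall x y, r R x y -> r R y x
  | RAsym R => forall x y, r R x y -> ~ r R y x
  | RRef R => forall x, r R x x
  | RIrref R => forall x, ~ r R x x
  | RDis R1 R2 => forall x y, ~ (r R1 x y /\ r R2 x y)
  | RTra R => forall x y z, r R x y -> r R y z -> r R x z
  | RFun R => forall x y z, r R x y -> r R x z -> y = z
  | REquivProd R C1 C2 => forall x y, r R x y <-> c C1 x /\ c C2 y
  | PEquiv P1 P2 => forall x v, p P1 x v <-> p P2 x v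
  | PIncl P1 P2 => forall x v, p P1 x v -> p P2 x v
  | PDis P1 P2 => forall x v, ~ (p P1 x v /\ p P2 x v)
  | PFun P => forall x v w, p P x v -> p P x w -> v = w
  end.

Definition tbox_sat D (I : interp D) (s : tbox_stmt D) : Prop :=
  let r := @arole_sem D I in
  let p := @crole_sem D I in
  let c := @concept_sem D I in
  let t := @dterm_sem D I in
  match s with
  | CEquiv C1 C2 => forall x, c C1 x <-> c C2 x
  | CIncl C1 C2 => forall x, c C1 x -> c C2 x
  | CInclAll C1 R C2 => forall x, c C1 x -> forall y, r R x y -> c C2 y
  | CExIncl R C1 C2 => forall x, (exists2 y, r R x y & c C1 y) -> c C2 x
  | CGeqIncl n R C1 C2 =>
      forall x, at_least n (fun y => r R x y /\ c C1 y) -> c C2 x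
  | CInclLeq C1 n R C2 =>
      forall x, c C1 x -> at_most n (fun y => r R x y /\ c C2 y)
  | TEquiv t1 t2 => forall v, t t1 v <-> t t2 v
  | TIncl t1 t2 => forall v, t t1 v -> t t2 v
  | CInclAllD C P t1 => forall x, c C x -> forall v, p P x v -> t t1 v
  | CExDIncl P t1 C => forall x, (exists2 v, p P x v & t t1 v) -> c C x
  | CGeqDIncl n P t1 C =>
      forall x, at_least n (fun v => p P x v /\ t t1 v) -> c C x
  | CInclLeqD C n P t1 =>
      forall x, c C x -> at_most n (fun v => p P x v /\ t t1 v)
  end.

Definition abox_sat D (I : interp D) (s : abox_stmt D) : Prop :=
  match s with
  | AConcept a C => concept_sem C (Iind I a)
  | ARole a b R => arole_sem R (Iind I a) (Iind I b)
  | AEq a b => Iind I a = Iind I b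
  | ANeq a b => Iind I a <> Iind I b
  | AData e t => dterm_sem t (demb I (cval e))
  | ACRole a e P => crole_sem P (Iind I a) (demb I (cval e))
  end.

Definition models D (I : interp D) (K : kb D) : Prop :=
  [/\ forall s, List.In s (rbox K) -> rbox_sat I s,
      forall s, List.In s (tbox K) -> tbox_sat I s
    & forall s, List.In s (abox K) -> abox_sat I s].

(** * Queries *)

(* Variables of each of the four sorts are numbers; [WVar] and [UVar] share
   the variables of V_i. *)
Inductive wterm := WVar of nat | WInd of nat.
Inductive uterm (D : datatype_map) := UVar of nat | UConst of const D.
Arguments UVar {D}.

Inductive qatom (D : datatype_map) :=
| QRole of arole D & wterm & wterm
| QCRole of crole D & wterm & uterm D
| QConcept of concept D & wterm
| QRoleVar of nat & wterm & wterm
| QCRoleVar of nat & wterm & uterm D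
| QConceptVar of nat & wterm
| QEqW of wterm & wterm
| QEqU of uterm D & uterm D.

(* A literal is an atom with its sign, [false] standing for negation. *)
Definition query (D : datatype_map) := seq (bool * qatom D).

(** ** Variables of a query *)

Definition wvars (w : wterm) : seq nat := if w is WVar x then [:: x] else [::].
Definition uvars D (u : uterm D) : seq nat :=
  if u is UVar x then [:: x] else [::].

Definition atom_ivars D (a : qatom D) : seq nat :=
  match a with
  | QRole _ w1 w2 | QRoleVar _ w1 w2 | QEqW w1 w2 => wvars w1 ++ wvars w2
  | QCRole _ w u | QCRoleVar _ w u => wvars w ++ uvars u
  | QConcept _ w | QConceptVar _ w => wvars w
  | QEqU u1 u2 => uvars u1 ++ uvars u2
  end.

Definition atom_cvars D (a : qatom D) : seq nat :=
  if a is QConceptVar c _ then [:: c] else [::].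
Definition atom_arvars D (a : qatom D) : seq nat :=
  if a is QRoleVar r _ _ then [:: r] else [::].
Definition atom_crvars D (a : qatom D) : seq nat :=
  if a is QCRoleVar p _ _ then [:: p] else [::].

Definition query_vars D (vs : qatom D -> seq nat) (Q : query D) : seq nat :=
  flatten [seq vs l.2 | l <- Q].

(** ** Substitutions *)

Inductive ground (D : datatype_map) := GInd of nat | GConst of const D.
Arguments GInd {D}.

Record subst (D : datatype_map) := Subst {
  s_i : seq (nat * ground D);
  s_c : seq (nat * nat);
  s_ar : seq (nat * arname);
  s_cr : seq (nat * nat)
}.

Definition has_domain (T : Type) (s : seq (nat * T)) (vs : seq nat) : Prop :=
  uniq (unzip1 s) /\ unzip1 s =i vs.

Definition subst_on D (sg : subst D) (Q : query D) : Prop :=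
  [/\ has_domain (s_i sg) (query_vars (@atom_ivars D) Q),
      has_domain (s_c sg) (query_vars (@atom_cvars D) Q),
      has_domain (s_ar sg) (query_vars (@atom_arvars D) Q)
    & has_domain (s_cr sg) (query_vars (@atom_crvars D) Q)].

Fixpoint lookup (T : Type) (s : seq (nat * T)) (x : nat) : option T :=
  if s is (y, v) :: s' then if x == y then Some v else lookup s' x else None.

Inductive gatom (D : datatype_map) :=
| GARole of arole D & nat & nat
| GACRole of crole D & nat & const D
| GAConcept of concept D & nat
| GAEqInd of nat & nat
| GAEqConst of const D & const D.

Section Substitution.
Variables (D : datatype_map) (sg : subst D).

Definition wsubst (w : wterm) : option (ground D) :=
  match w with
  | WVar x => lookup (s_i sg) x
  | WInd a => Some (GInd a)
  end.

Definition usubst (u : uterm D) : option (ground D) :=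
  match u with
  | UVar x => lookup (s_i sg) x
  | UConst e => Some (GConst e)
  end.

Definition mk_role (R : option (arole D)) (g1 g2 : option (ground D)) :=
  match R, g1, g2 with
  | Some R', Some (GInd a), Some (GInd b) => Some (GARole R' a b)
  | _, _, _ => None
  end.

Definition mk_crole (P : option (crole D)) (g1 g2 : option (ground D)) :=
  match P, g1, g2 with
  | Some P', Some (GInd a), Some (GConst e) => Some (GACRole P' a e)
  | _, _, _ => None
  end.

Definition mk_concept (C : option (concept D)) (g : option (ground D)) :=
  match C, g with
  | Some C', Some (GInd a) => Some (GAConcept C' a)
  | _, _ => None
  end.

Definition mk_eq (g1 g2 : option (ground D)) : option (gatom D) :=
  match g1, g2 with
  | Some (GInd a), Some (GInd b) => Some (GAEqInd D a b)
  | Some (GConst e1), Some (GConst e2) => Some (GAEqConst e1 e2)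
  | _, _ => None
  end.

(* The result is [None] when the replacement does not produce an atomic
   formula, e.g. when a constant takes the place of an individual. *)
Definition asubst (a : qatom D) : option (gatom D) :=
  match a with
  | QRole R w1 w2 => mk_role (Some R) (wsubst w1) (wsubst w2)
  | QCRole P w u => mk_crole (Some P) (wsubst w) (usubst u)
  | QConcept C w => mk_concept (Some C) (wsubst w)
  | QRoleVar r w1 w2 =>
      mk_role (omap RName (lookup (s_ar sg) r)) (wsubst w1) (wsubst w2)
  | QCRoleVar p w u =>
      mk_crole (omap PName (lookup (s_cr sg) p)) (wsubst w) (usubst u)
  | QConceptVar c w => mk_concept (omap CName (lookup (s_c sg) c)) (wsubst w)
  | QEqW w1 w2 => mk_eq (wsubst w1) (wsubst w2)
  | QEqU u1 u2 => mk_eq (usubst u1) (usubst u2)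
  end.

Fixpoint qsubst (Q : query D) : option (seq (bool * gatom D)) :=
  match Q with
  | [::] => Some [::]
  | (b, a) :: Q' =>
      match asubst a, qsubst Q' with
      | Some g, Some G => Some ((b, g) :: G)
      | _, _ => None
      end
  end.

End Substitution.

Definition gatom_sat D (I : interp D) (g : gatom D) : Prop :=
  match g with
  | GARole R a b => arole_sem R (Iind I a) (Iind I b)
  | GACRole P a e => crole_sem P (Iind I a) (demb I (cval e))
  | GAConcept C a => concept_sem C (Iind I a)
  | GAEqInd a b => Iind I a = Iind I b
  | GAEqConst e1 e2 => demb I (cval e1) = demb I (cval e2)
  end.

Definition gquery_sat D (I : interp D) (G : seq (bool * gatom D)) : Prop :=
  forall l, List.In l G ->
    if l.1 then gatom_sat I l.2 else ~ gatom_sat I l.2.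

Definition ho_answer_set D (K : kb D) (Q : query D) (sg : subst D) : Prop :=
  subst_on sg Q /\
  exists2 G, qsubst sg Q = Some G &
    exists2 I : interp D, models I K & gquery_sat I G.

(** * Coding of the syntax *)

Definition enc_seq (T : Type) (enc : T -> nat) (s : seq T) : nat :=
  code (map enc s).

Definition enc_const D (e : const D) : nat :=
  code [:: pickle (tag e); pickle (tagged e)].

Fixpoint enc_fexpr D (d : N_D D) (psi : fexpr d) : nat :=
  match psi with
  | FAtom f => code [:: 0; pickle f]
  | FTop => code [:: 1]
  | FBot => code [:: 2]
  | FNot p => code [:: 3; enc_fexpr p]
  | FAnd p q => code [:: 4; enc_fexpr p; enc_fexpr q]
  | FOr p q => code [:: 5; enc_fexpr p; enc_fexpr q]
  end.

Fixpoint enc_drange D (r : drange D) : nat :=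
  match r with
  | DRConsts es => code [:: 0; enc_seq (@enc_const D) es]
  | DRFacet d psi => code [:: 1; pickle d; enc_fexpr psi]
  | DRNot r' => code [:: 2; enc_drange r']
  end.

Fixpoint enc_dterm D (t : dterm D) : nat :=
  match t with
  | TRange r => code [:: 0; enc_drange r]
  | TNot t' => code [:: 1; enc_dterm t']
  | TAnd t1 t2 => code [:: 2; enc_dterm t1; enc_dterm t2]
  | TOr t1 t2 => code [:: 3; enc_dterm t1; enc_dterm t2]
  | TConst e => code [:: 4; enc_const e]
  end.

Definition enc_arname (N : arname) : nat := if N is ARName n then n.+1 else 0.

Fixpoint enc_concept D (C : concept D) : nat :=
  match C with
  | CName A => code [:: 0; A]
  | CTop => code [:: 1]
  | CBot => code [:: 2]
  | CNot C' => code [:: 3; enc_concept C']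
  | COr C1 C2 => code [:: 4; enc_concept C1; enc_concept C2]
  | CAnd C1 C2 => code [:: 5; enc_concept C1; enc_concept C2]
  | CNominal a => code [:: 6; a]
  | CExSelf R => code [:: 7; enc_arole R]
  | CExInd R a => code [:: 8; enc_arole R; a]
  | CExConst P e => code [:: 9; enc_crole P; enc_const e]
  end
with enc_arole D (R : arole D) : nat :=
  match R with
  | RName N => code [:: 0; enc_arname N]
  | RInv R' => code [:: 1; enc_arole R']
  | RNot R' => code [:: 2; enc_arole R']
  | ROr R1 R2 => code [:: 3; enc_arole R1; enc_arole R2]
  | RAnd R1 R2 => code [:: 4; enc_arole R1; enc_arole R2]
  | RDom R' C => code [:: 5; enc_arole R'; enc_concept C]
  | RRan R' C => code [:: 6; enc_arole R'; enc_concept C]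
  | RDomRan R' C1 C2 =>
      code [:: 7; enc_arole R'; enc_concept C1; enc_concept C2]
  | RId C => code [:: 8; enc_concept C]
  | RProd C1 C2 => code [:: 9; enc_concept C1; enc_concept C2]
  end
with enc_crole D (P : crole D) : nat :=
  match P with
  | PName T => code [:: 0; T]
  | PNot P' => code [:: 1; enc_crole P']
  | POr P1 P2 => code [:: 2; enc_crole P1; enc_crole P2]
  | PAnd P1 P2 => code [:: 3; enc_crole P1; enc_crole P2]
  | PDom P' C => code [:: 4; enc_crole P'; enc_concept C]
  | PRan P' t => code [:: 5; enc_crole P'; enc_dterm t]
  | PDomRan P' C t =>
      code [:: 6; enc_crole P'; enc_concept C; enc_dterm t]
  end.

Definition enc_rbox D (s : rbox_stmt D) : nat :=
  let r := @enc_arole D in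
  let p := @enc_crole D in
  let c := @enc_concept D in
  match s with
  | REquiv R1 R2 => code [:: 0; r R1; r R2]
  | RIncl R1 R2 => code [:: 1; r R1; r R2]
  | RChain R1 Rs R => code [:: 2; r R1; enc_seq r Rs; r R]
  | RSym R => code [:: 3; r R]
  | RAsym R => code [:: 4; r R]
  | RRef R => code [:: 5; r R]
  | RIrref R => code [:: 6; r R]
  | RDis R1 R2 => code [:: 7; r R1; r R2]
  | RTra R => code [:: 8; r R]
  | RFun R => code [:: 9; r R]
  | REquivProd R C1 C2 => code [:: 10; r R; c C1; c C2]
  | PEquiv P1 P2 => code [:: 11; p P1; p P2]
  | PIncl P1 P2 => code [:: 12; p P1; p P2]
  | PDis P1 P2 => code [:: 13; p P1; p P2]
  | PFun P => code [:: 14; p P]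
  end.

Definition enc_tbox D (s : tbox_stmt D) : nat :=
  let r := @enc_arole D in
  let p := @enc_crole D in
  let c := @enc_concept D in
  let t := @enc_dterm D in
  match s with
  | CEquiv C1 C2 => code [:: 0; c C1; c C2]
  | CIncl C1 C2 => code [:: 1; c C1; c C2]
  | CInclAll C1 R C2 => code [:: 2; c C1; r R; c C2]
  | CExIncl R C1 C2 => code [:: 3; r R; c C1; c C2]
  | CGeqIncl n R C1 C2 => code [:: 4; n; r R; c C1; c C2]
  | CInclLeq C1 n R C2 => code [:: 5; c C1; n; r R; c C2]
  | TEquiv t1 t2 => code [:: 6; t t1; t t2]
  | TIncl t1 t2 => code [:: 7; t t1; t t2]
  | CInclAllD C P t1 => code [:: 8; c C; p P; t t1]
  | CExDIncl P t1 C => code [:: 9; p P; t t1; c C]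
  | CGeqDIncl n P t1 C => code [:: 10; n; p P; t t1; c C]
  | CInclLeqD C n P t1 => code [:: 11; c C; n; p P; t t1]
  end.

Definition enc_abox D (s : abox_stmt D) : nat :=
  match s with
  | AConcept a C => code [:: 0; a; enc_concept C]
  | ARole a b R => code [:: 1; a; b; enc_arole R]
  | AEq a b => code [:: 2; a; b]
  | ANeq a b => code [:: 3; a; b]
  | AData e t => code [:: 4; enc_const e; enc_dterm t]
  | ACRole a e P => code [:: 5; a; enc_const e; enc_crole P]
  end.

Definition enc_kb D (K : kb D) : nat :=
  code [:: enc_seq (@enc_rbox D) (rbox K); enc_seq (@enc_tbox D) (tbox K);
           enc_seq (@enc_abox D) (abox K)].

Definition enc_wterm (w : wterm) : nat :=
  match w with
  | WVar x => code [:: 0; x]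
  | WInd a => code [:: 1; a]
  end.

Definition enc_uterm D (u : uterm D) : nat :=
  match u with
  | UVar x => code [:: 0; x]
  | UConst e => code [:: 1; enc_const e]
  end.

Definition enc_qatom D (a : qatom D) : nat :=
  let w := enc_wterm in
  let u := @enc_uterm D in
  match a with
  | QRole R w1 w2 => code [:: 0; enc_arole R; w w1; w w2]
  | QCRole P w1 u1 => code [:: 1; enc_crole P; w w1; u u1]
  | QConcept C w1 => code [:: 2; enc_concept C; w w1]
  | QRoleVar r w1 w2 => code [:: 3; r; w w1; w w2]
  | QCRoleVar p w1 u1 => code [:: 4; p; w w1; u u1]
  | QConceptVar c w1 => code [:: 5; c; w w1]
  | QEqW w1 w2 => code [:: 6; w w1; w w2]
  | QEqU u1 u2 => code [:: 7; u u1; u u2]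
  end.

Definition enc_query D (Q : query D) : nat :=
  enc_seq (fun l : bool * qatom D => code [:: l.1 : nat; enc_qatom l.2]) Q.

Definition enc_map (T : Type) (enc : T -> nat) (s : seq (nat * T)) : nat :=
  enc_seq (fun p : nat * T => code [:: p.1; enc p.2]) s.

Definition enc_ground D (g : ground D) : nat :=
  match g with
  | GInd a => code [:: 0; a]
  | GConst e => code [:: 1; enc_const e]
  end.

Definition enc_subst D (sg : subst D) : nat :=
  code [:: enc_map (@enc_ground D) (s_i sg); enc_map id (s_c sg);
           enc_map enc_arname (s_ar sg); enc_map id (s_cr sg)].

(** * Effective data type maps *)

(* Finite conjunctions of constraints [x : dr] and [x <> y] on variables
   ranging over the union of the data types. *)
Record dconj (D : datatype_map) := DConj {
  dc_range : seq (nat * drange D);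
  dc_neq : seq (nat * nat)
}.

Definition dconj_satisfiable D (c : dconj D) : Prop :=
  exists rho : nat -> dval D,
    (forall p, List.In p (dc_range c) -> drange_sem id p.2 (rho p.1)) /\
    (forall p, List.In p (dc_neq c) -> rho p.1 <> rho p.2).

Definition enc_dconj D (c : dconj D) : nat :=
  code [:: enc_map (@enc_drange D) (dc_range c); enc_map id (dc_neq c)].

(* Decidability of satisfiability in [D] itself, the usual admissibility
   condition on data type maps. Without it a knowledge base can ask whether
   a constant belongs to a facet of arbitrary complexity. *)
Definition effective D : Prop :=
  exists2 f : 1.-tuple nat -> nat, recursive f &
    forall c : dconj D, decides (f [tuple enc_dconj c]) (dconj_satisfiable c).

(** * The problem *)

(* The answer set is in general infinite, so computing it means deciding
   membership, by one algorithm taking knowledge base and query as inputs. *)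
Definition hocqa_decidable D : Prop :=
  exists2 f : 3.-tuple nat -> nat, recursive f &
    forall (K : kb D) (Q : query D) (sg : subst D),
      decides (f [tuple enc_kb K; enc_query Q; enc_subst sg])
              (ho_answer_set K Q sg).

(* Main.v *)
Require Import Defs.
From Stdlib Require List.
From mathcomp Require Import all_boot boolp zify.

Set Implicit Arguments.
Unset Strict Implicit.
Unset Printing Implicit Defensive.

(* All statements of a knowledge base are universal, so satisfiability together
   with ground literals can be tested on the substructure of named individuals.
   On the data side, finitely many values suffice: keep, for every type that the
   input can distinguish, up to [Z] values, where [Z] bounds all numbers of the
   input. Conversely, a value without a representative may copy the behaviour of
   a type with [Z] representatives, since no counting statement sees the
   difference; whether a value of a given kind without a representative exists
   is a question to the oracle of the data type map.

   The search for such a structure is expressed by a formula with bounded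
   quantifiers only, where finite sets are coded by the binary digits of
   numbers. No recursion on syntax is needed: the expressions occurring in the
   input form the least set of codes closed under subexpressions, and the truth
   values of all expressions are guessed and checked locally, in the manner of
   Hintikka sets. *)

(** * Recursive functions of an environment *)

(** Truth of a term at named individuals survives the removal of all other elements because terms
    quantify over nothing but names: quantified and counting restrictions appear only in statements,
    on the side where losing elements is harmless, and so do role chains. The data domain admits no
    such cut: the data types and their facets are prescribed, and statements about data type terms
    speak of all their values. The concrete roles remain to be guessed, so the type of a value
    records its behaviour towards each named individual, and the number of types is exponential in
    the square of [Z]. As a code exceeds its components, a number above the codes of the three
    inputs bounds every expression, name and cardinality in them. One case needs an oracle of its
    own: without data types there is no value to ask about, yet the data domain is nonempty; a
    single point then takes its place. *)

(* An environment [s : nat -> nat] gives the values of variables numbered by de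
   Bruijn indices, so that passing below a binder turns [s] into
   [fun i => s i.+1] and variables stay of the form [s i] up to beta. *)
Definition erec (f : (nat -> nat) -> nat) : Prop :=
  exists k (F : k.-tuple nat -> nat),
    recursive F /\ forall s, f s = F [tuple s i | i < k].

Definition edec (P : (nat -> nat) -> Prop) : Prop :=
  erec (fun s => `[< P s >] : nat).

Lemma eq_erec f g : f =1 g -> erec g -> erec f.
Proof. by move=> fg [k [F [rF Fg]]]; exists k, F; split=> // s; rewrite fg. Qed.

Lemma eq_edec P Q : (forall s, P s <-> Q s) -> edec Q -> edec P.
Proof. by move=> PQ; apply: eq_erec => s; rewrite (asbool_equiv_eq (PQ s)). Qed.

Lemma recursive_comp_tuple m n (F : m.-tuple nat -> nat)
    (g : 'I_m -> n.-tuple nat -> nat) (H : n.-tuple nat -> nat) :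
  recursive F -> (forall i, recursive (g i)) ->
  (forall v, H v = F [tuple g i v | i < m]) -> recursive H.
Proof. by move=> rF rg /funext ->; apply: rec_comp. Qed.

(** Ignoring extra variables gives several functions a common arity, as composition and recursion
    require. *)
Lemma erec_widen f : erec f -> exists k, forall K, k <= K ->
  exists F : K.-tuple nat -> nat,
    recursive F /\ forall s, f s = F [tuple s i | i < K].
Proof.
case=> k [F [rF Ff]]; exists k => K kK.
exists (fun v => F [tuple tnth v (widen_ord kK i) | i < k]); split.
  by apply: rec_comp => // i; apply: rec_proj.
by move=> s; rewrite Ff; congr F; apply: eq_from_tnth => i; rewrite !tnth_mktuple.
Qed.

Lemma erec_var i : erec (fun s => s i).
Proof.
exists i.+1, (fun v => tnth v ord_max); split; first exact: rec_proj.
by move=> s; rewrite tnth_mktuple.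
Qed.

(** Only finitely many of the [g i] are consulted, so the arities they need have a maximum. *)
Lemma erec_comp f g :
  erec f -> (forall i : nat, erec (g i)) -> erec (fun s => f (fun i => g i s)).
Proof.
case=> k [F [rF Ff]] rg.
have [a ha] := choice (fun i => erec_widen (rg i)).
pose K := \max_(i < k) a i.
have le (i : 'I_k) : a i <= K.
  by have := @leq_bigmax _ (fun i : 'I_k => a i) i.
have [G hG] := choice (fun i : 'I_k => ha i K (le i)).
exists K, (fun v => F [tuple G i v | i < k]); split.
  by apply: rec_comp => // i; case: (hG i).
move=> s; rewrite Ff; congr F; apply: eq_from_tnth => i; rewrite !tnth_mktuple.
by case: (hG i).
Qed.

Lemma edec_comp P g :
  edec P -> (forall i : nat, erec (g i)) -> edec (fun s => P (fun i => g i s)).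
Proof. exact: (@erec_comp (fun s => `[< P s >] : nat)). Qed.

Lemma erec_iteri n f (g : nat -> nat -> (nat -> nat) -> nat) :
  erec n -> erec f -> erec (fun s => g (s 0) (s 1) (fun i => s i.+2)) ->
  erec (fun s => iteri (n s) (fun i acc => g i acc s) (f s)).
Proof.
move=> rn /erec_widen[a ha] /erec_widen[b hb].
have [F [rF Ff]] := ha (a + b) (leq_addr _ _).
have [G [rG Gg]] := hb (a + b).+2 ltac:(lia).
set K := a + b in F rF Ff G rG Gg.
(* The counter is the first argument and the environment supplies the parameters, which is the shape
   required by [rec_prim]; [n] is substituted for the counter afterwards. *)
pose h (w : K.+1.-tuple nat) : nat :=
  iteri (thead w) (fun i acc => G [tuple of i :: acc :: [tuple of behead w]])
        (F [tuple of behead w]).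
have beE x (v : K.-tuple nat) : [tuple of behead [tuple of x :: v]] = v.
  exact/val_inj.
have rh : recursive h.
  apply: (rec_prim (f := F) (g := G)) => //.
    by move=> v; rewrite /h beE.
  by move=> y v; rewrite /h !beE !theadE.
have rg (i : nat) : erec (if i is j.+1 then fun s => s j else n).
  by case: i => // i; apply: erec_var.
have := @erec_comp (fun s => h [tuple s i | i < K.+1]) _ _ rg.
case=> [|k [H [rH Hh]]]; first by exists K.+1, h.
exists k, H; split=> // s; rewrite -Hh /h.
set w := [tuple _ | i < _].
have -> : thead w = n s by rewrite /thead tnth_mktuple.
have -> : [tuple of behead w] = [tuple s i | i < K].
  apply: eq_from_tnth => i; rewrite tnth_behead !tnth_mktuple.
  by rewrite inordK // ltnS.
rewrite Ff.
elim: (n s) => //= m IH; rewrite IH.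
set acc := iteri _ _ _.
have := Gg (fun i => match i with 0 => m | 1 => acc | j.+2 => s j end) => /= ->.
congr G; apply: eq_from_tnth => i; rewrite tnth_mktuple !(tnth_nth 0) /=.
case: i => [[|[|i]]] //= lti.
by rewrite (nth_map (Ordinal (lti : i < K))) ?size_enum_ord // nth_enum_ord.
Qed.

(** The value is the only zero of the negated characteristic function of the graph, so minimisation
    is regular and finds it. Functions on codes thus need only a description of their graph by
    bounded quantifiers, not an algorithm. *)
Lemma erec_graph h : edec (fun s => s 0 = h (fun i => s i.+1)) -> erec h.
Proof.
move=> rh.
have : erec (fun s => iteri `[< s 0 = h (fun i => s i.+1) >] (fun _ _ => 0) 1).
  apply: erec_iteri => //; last by exists 0, (fun=> 0); split; [exact: rec_zero|].
  exists 0, (fun v => (thead [tuple of [:: (fun=> 0) v]]).+1); split=> //.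
  apply: (recursive_comp_tuple (F := fun v => (thead v).+1)
           (g := fun (i : 'I_1) (v : 0.-tuple nat) => 0)).
  - exact: rec_succ.
  - by move=> i; apply: rec_zero.
  - by move=> v; rewrite /= !theadE /thead tnth_mktuple.
case/erec_widen=> k /(_ k.+1 (leqnSn _))[F [rF Ff]].
have Fh y (s : nat -> nat) : F [tuple of y :: [tuple s i | i < k]] = 0 <-> y = h s.
  have := Ff (fun i => if i is j.+1 then s j else y).
  rewrite (_ : [tuple _ | i < k.+1] = [tuple of y :: [tuple s i | i < k]]).
    by move=> /= <-; case: asboolP.
  apply: eq_from_tnth => i; rewrite tnth_mktuple !(tnth_nth 0) /=.
  case: i => [[|i]] //= lti.
  by rewrite (nth_map (Ordinal (lti : i < k))) ?size_enum_ord // nth_enum_ord.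
(* Padding by zeros is harmless: by [Fh], [h] depends on the first [k] variables only. *)
pose H (v : k.-tuple nat) := h (nth 0 v).
have vE (v : k.-tuple nat) : v = [tuple nth 0 v i | i < k].
  by apply: eq_from_tnth => i; rewrite tnth_mktuple (tnth_nth 0).
have Fv y (v : k.-tuple nat) : F [tuple of y :: v] = 0 <-> y = H v.
  rewrite -Fh; suff -> : [tuple of y :: v] = [tuple of y :: [tuple nth 0 v i | i < k]] by [].
  by apply/val_inj => /=; congr (_ :: _); apply: congr1 (vE v).
exists k, H; split; last by move=> s; apply/Fv/Fh.
apply: (rec_mu (f := F)) => // v; split; first exact/Fv.
by move=> y yh /Fv yE; rewrite yE ltnn in yh.
Qed.

(** * Closure under arithmetic, connectives and bounded quantifiers *)

Lemma erec_const c : erec (fun=> c).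
Proof.
elim: c => [|c [k [F [rF Fc]]]]; first by exists 0, (fun=> 0); split=> //; apply: rec_zero.
exists k, (fun v => (F v).+1); split; last by move=> s; rewrite -(Fc s).
apply: (recursive_comp_tuple (F := fun v => (thead v).+1) (g := fun (i : 'I_1) v => F v)) => //.
  exact: rec_succ.
by move=> v; rewrite /thead tnth_mktuple.
Qed.

Lemma erec_S f : erec f -> erec (fun s => (f s).+1).
Proof.
move=> rf; have rS : erec (fun s => (s 0).+1).
  exists 1, (fun v => (thead v).+1); split; first exact: rec_succ.
  by move=> s; rewrite /thead tnth_mktuple.
exact: (erec_comp (g := fun=> f) rS (fun=> rf)).
Qed.

Lemma erec_add f g : erec f -> erec g -> erec (fun s => f s + g s).
Proof.
move=> rf rg.
apply: (@eq_erec _ (fun s => iteri (g s) (fun _ acc => acc.+1) (f s))).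
  by move=> s; elim: (g s) => [|n IH] /=; rewrite ?addn0 // addnS IH.
by apply: erec_iteri => //; apply: erec_S; apply: erec_var.
Qed.

Lemma erec_weak f : erec f -> erec (fun s => f (fun i => s i.+1)).
Proof. by move=> rf; apply: (erec_comp (g := fun i s => s i.+1) rf) => i; apply: erec_var. Qed.

Lemma erec_mul f g : erec f -> erec g -> erec (fun s => f s * g s).
Proof.
move=> rf rg.
apply: (@eq_erec _ (fun s => iteri (g s) (fun _ acc => acc + f s) 0)).
  by move=> s; elim: (g s) => [|n IH] /=; rewrite ?muln0 // mulnS IH addnC.
apply: (erec_iteri (g := fun _ acc s => acc + f s)) => //; first exact: erec_const.
by apply: erec_add; [apply: erec_var|exact: erec_weak (erec_weak rf)].
Qed.

Lemma erec_pow2 f : erec f -> erec (fun s => 2 ^ f s).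
Proof.
move=> rf.
apply: (@eq_erec _ (fun s => iteri (f s) (fun _ acc => acc + acc) 1)).
  by move=> s; elim: (f s) => [|n IH] //=; rewrite expnS IH mul2n addnn.
by apply: erec_iteri => //; [exact: erec_const|apply: erec_add; apply: erec_var].
Qed.

Lemma erec_if P f g : edec P -> erec f -> erec g ->
  erec (fun s => if `[< P s >] then f s else g s).
Proof.
move=> rP rf rg.
apply: (@eq_erec _ (fun s => iteri `[< P s >] (fun _ _ => f s) (g s))).
  by move=> s; case: asboolP.
apply: (erec_iteri (g := fun _ _ s => f s)) => //.
exact: erec_weak (erec_weak rf).
Qed.

Lemma edec_True : edec (fun=> True).
Proof. exact: erec_const. Qed.

Lemma edec_not P : edec P -> edec (fun s => ~ P s).
Proof.
move=> rP; apply: eq_erec (erec_if rP (erec_const 0) (erec_const 1)) => s.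
by rewrite asbool_neg; case: asboolP.
Qed.

Lemma edec_and P Q : edec P -> edec Q -> edec (fun s => P s /\ Q s).
Proof.
move=> rP rQ; apply: eq_erec (erec_mul rP rQ) => s.
by rewrite mulnb; congr nat_of_bool; apply/asboolP/and_asboolP.
Qed.

Lemma edec_or P Q : edec P -> edec Q -> edec (fun s => P s \/ Q s).
Proof.
move=> rP rQ; apply: eq_edec (edec_not (edec_and (edec_not rP) (edec_not rQ))) => s.
by split; [tauto|move=> H; apply: contrapT; tauto].
Qed.

Lemma edec_imp P Q : edec P -> edec Q -> edec (fun s => P s -> Q s).
Proof.
move=> rP rQ; apply: eq_edec (edec_or (edec_not rP) rQ) => s.
by split; [move=> H; apply: contrapT|]; tauto.
Qed.

Lemma edec_iff P Q : edec P -> edec Q -> edec (fun s => P s <-> Q s).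
Proof. by move=> rP rQ; apply: edec_and; apply: edec_imp. Qed.

Lemma edec_all b (P : nat -> (nat -> nat) -> Prop) :
  erec b -> edec (fun s => P (s 0) (fun i => s i.+1)) ->
  edec (fun s => forall x, x < b s -> P x s).
Proof.
move=> rb rP.
apply: (@eq_erec _ (fun s => iteri (b s) (fun i acc => acc * `[< P i s >]) 1)).
  move=> s; elim: (b s) => [|n IH] /=; first by case: asboolP => // N; case: N.
  rewrite -IH mulnb; congr nat_of_bool; apply/asboolP/and_asboolP => [H|[H1 H2] x].
    by split=> [x xn|]; apply: H => //; apply: leqW.
  by rewrite ltnS leq_eqVlt => /predU1P[->//|]; apply: H1.
apply: (erec_iteri (g := fun i acc s => acc * `[< P i s >])) => //; first exact: erec_const.
apply: erec_mul; first exact: erec_var.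
by apply: (edec_comp (g := fun i s => if i is j.+1 then s j.+2 else s 0) rP) => -[|i];
   apply: erec_var.
Qed.

Lemma edec_ex b (P : nat -> (nat -> nat) -> Prop) :
  erec b -> edec (fun s => P (s 0) (fun i => s i.+1)) ->
  edec (fun s => exists x, x < b s /\ P x s).
Proof.
move=> rb rP.
apply: eq_edec (edec_not (edec_all (P := fun x s => ~ P x s) rb (edec_not rP))) => s /=.
split=> [[x [xb Px]] H|H]; first exact: (H x).
by apply: contrapT => N; apply: H => x xb Px; apply: N; exists x.
Qed.

Lemma edec_all_seq (T : eqType) (l : seq T) (P : T -> (nat -> nat) -> Prop) :
  (forall x, edec (P x)) -> edec (fun s => forall x, x \in l -> P x s).
Proof.
move=> rP; elim: l => [|x l IH]; first by apply: eq_edec edec_True.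
apply: eq_edec (edec_and (rP x) IH) => s; split=> [H|[Hx H] y].
  by split=> [|y yl]; apply: H; rewrite inE ?eqxx ?yl ?orbT.
by rewrite inE => /predU1P[->//|]; apply: H.
Qed.

Lemma edec_ex_seq (T : eqType) (l : seq T) (P : T -> (nat -> nat) -> Prop) :
  (forall x, edec (P x)) -> edec (fun s => exists x, x \in l /\ P x s).
Proof.
move=> rP; apply: eq_edec (edec_not (edec_all_seq l (fun x => edec_not (rP x)))) => s /=.
split=> [[x [xb Px]] H|H]; first exact: (H x).
by apply: contrapT => N; apply: H => x xb Px; apply: N; exists x.
Qed.

Lemma edec_eq f g : erec f -> erec g -> edec (fun s => f s = g s).
Proof.
have pred0 f' : erec f' -> edec (fun s => f' s = 0).
  move=> rf'; apply: (@eq_erec _ (fun s => iteri (f' s) (fun _ _ => 0) 1)).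
    by move=> s; case: asboolP => [->|N] //; case: (f' s) N.
  by apply: erec_iteri => //; apply: erec_const.
have rpred f' : erec f' -> erec (fun s => (f' s).-1).
  move=> rf'; apply: (@eq_erec _ (fun s => iteri (f' s) (fun i _ => i) 0)).
    by move=> s; case: (f' s).
  by apply: erec_iteri => //; [apply: erec_const|apply: erec_var].
have rsub f' g' : erec f' -> erec g' -> erec (fun s => f' s - g' s).
  move=> rf' rg'; apply: (@eq_erec _ (fun s => iteri (g' s) (fun _ a => a.-1) (f' s))).
    by move=> s; elim: (g' s) => [|n IH] /=; rewrite ?subn0 // subnS IH.
  by apply: erec_iteri => //; apply: rpred; apply: erec_var.
move=> rf rg; apply: eq_edec (pred0 _ (erec_add (rsub _ _ rf rg) (rsub _ _ rg rf))) => s.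
by split; lia.
Qed.

Lemma edec_leq f g : erec f -> erec g -> edec (fun s => f s <= g s).
Proof.
move=> rf rg.
apply: (@eq_edec _ (fun s => exists x, x < (g s).+1 /\ x = f s)).
  by move=> s; split=> [fg|[x [xg <-]]] //; exists (f s).
apply: (edec_ex (P := fun x s => x = f s)) => //; first exact: erec_S.
by apply: edec_eq; [apply: erec_var|exact: erec_weak rf].
Qed.

Definition cnt (n : nat) (P : nat -> Prop) : nat := \sum_(i < n) `[< P i >].

Lemma erec_cnt n (P : nat -> (nat -> nat) -> Prop) :
  erec n -> edec (fun s => P (s 0) (fun i => s i.+1)) ->
  erec (fun s => cnt (n s) (fun x => P x s)).
Proof.
move=> rn rP.
apply: (@eq_erec _ (fun s => iteri (n s) (fun i acc => acc + `[< P i s >]) 0)).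
  by rewrite /cnt => s; elim: (n s) => [|k IH] /=; rewrite ?big_ord0 // big_ord_recr /= IH.
apply: (erec_iteri (g := fun i acc s => acc + `[< P i s >])) => //; first exact: erec_const.
apply: erec_add; first exact: erec_var.
by apply: (edec_comp (g := fun i s => if i is j.+1 then s j.+2 else s 0) rP) => -[|i];
   apply: erec_var.
Qed.

(** The way back from environments to functions of fixed arity: variables beyond the inputs are set
    to zero. *)
Lemma edec_recursive k (P : (nat -> nat) -> Prop) :
  edec P ->
  exists2 f : k.-tuple nat -> nat, recursive f &
    forall v : k.-tuple nat, decides (f v) (P (nth 0 v)).
Proof.
case/erec_widen=> K /(_ (K + k) (leq_addr _ _))[F [rF FP]].
exists (fun v => `[< P (nth 0 v) >] : nat); last first.
  by move=> v; split; case: asboolP.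
have rg (i : 'I_(K + k)) : recursive (fun v : k.-tuple nat => nth 0 v i).
  have [ik|ki] := ltnP i k.
    have := rec_proj (Ordinal ik); congr (recursive _); apply/funext => v.
    by rewrite (tnth_nth 0).
  have := @rec_zero k; congr (recursive _); apply/funext => v.
  by rewrite nth_default // size_tuple.
by apply: (recursive_comp_tuple rF rg) => v; rewrite FP.
Qed.

Lemma edec_comp1 (P : nat -> Prop) f : edec (fun s => P (s 0)) -> erec f ->
  edec (fun s => P (f s)).
Proof. by move=> rP rf; apply: (edec_comp (g := fun=> f) rP). Qed.

Lemma erec_comp1 (h : nat -> nat) f : erec (fun s => h (s 0)) -> erec f ->
  erec (fun s => h (f s)).
Proof. by move=> rh rf; apply: (erec_comp (g := fun=> f) rh). Qed.

Lemma erec_nth (l : seq ((nat -> nat) -> nat)) i :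
  List.Forall erec l -> erec (nth (fun=> 0) l i).
Proof.
move=> rl; elim: l rl i => [_ i|f l IH rl [|i]] /=.
- by rewrite nth_nil; apply: erec_const.
- by inversion rl.
- by apply: IH; inversion rl.
Qed.

Lemma edec_comp2 (P : nat -> nat -> Prop) f1 f2 :
  edec (fun s => P (s 0) (s 1)) -> erec f1 -> erec f2 ->
  edec (fun s => P (f1 s) (f2 s)).
Proof.
move=> rP r1 r2; apply: (edec_comp (g := nth (fun=> 0) [:: f1; f2]) rP) => i.
by apply: erec_nth; do !constructor.
Qed.

Lemma erec_comp2 (h : nat -> nat -> nat) f1 f2 :
  erec (fun s => h (s 0) (s 1)) -> erec f1 -> erec f2 ->
  erec (fun s => h (f1 s) (f2 s)).
Proof.
move=> rP r1 r2; apply: (erec_comp (g := nth (fun=> 0) [:: f1; f2]) rP) => i.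
by apply: erec_nth; do !constructor.
Qed.

Lemma edec_comp5 (P : nat -> nat -> nat -> nat -> nat -> Prop) f1 f2 f3 f4 f5 :
  edec (fun s => P (s 0) (s 1) (s 2) (s 3) (s 4)) ->
  erec f1 -> erec f2 -> erec f3 -> erec f4 -> erec f5 ->
  edec (fun s => P (f1 s) (f2 s) (f3 s) (f4 s) (f5 s)).
Proof.
move=> rP *; apply: (edec_comp (g := nth (fun=> 0) [:: f1; f2; f3; f4; f5]) rP) => i.
by apply: erec_nth; do !constructor.
Qed.

(** * Numbers as finite sets and as lists *)

Definition bit (m i : nat) : Prop := odd (m %/ 2 ^ i).

(** Writing [m] as [(2q + 1) 2^i + r] with [r < 2^i] replaces division and parity by bounded
    quantifiers over operations already known to be recursive. *)
Lemma bit_ex m i :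
  bit m i <-> exists q, q < m.+1 /\ exists r, r < 2 ^ i /\ m = q.*2.+1 * 2 ^ i + r.
Proof.
rewrite /bit; have p0 : 0 < 2 ^ i by rewrite expn_gt0.
split=> [o|[q [_ [r [ri ->]]]]]; last first.
  by rewrite divnMDl // divn_small // addn0 /= odd_double.
exists (m %/ 2 ^ i)./2; split.
  rewrite ltnS; apply: leq_trans (leq_div m (2 ^ i)).
  by have := odd_double_half (m %/ 2 ^ i); rewrite -addnn; set h := _./2; lia.
exists (m %% 2 ^ i); split; first exact: ltn_pmod.
rewrite {1}(divn_eq m (2 ^ i)); congr (_ * _ + _).
by rewrite -[LHS]odd_double_half o.
Qed.

Lemma edec_bit f g : erec f -> erec g -> edec (fun s => bit (f s) (g s)).
Proof.
apply: edec_comp2; apply: eq_edec (fun s => bit_ex (s 0) (s 1)) _.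
have rv := erec_var; do 2!
  [apply: edec_ex; [by do ?[apply: erec_S | apply: erec_pow2 | exact: rv]|]].
apply: edec_eq => //; apply: erec_add => //; apply: erec_mul; last exact: erec_pow2.
apply: erec_S; apply: eq_erec (erec_add (rv 1) (rv 1)) => s; exact: esym (addnn _).
Qed.

(** Comprehension: any predicate, decidable or not, becomes a number once restricted to an initial
    segment; adding [2 ^ n] switches on the next digit. This is how semantic truth enters the
    bounded searches. *)
Lemma bits_of_pred n (P : nat -> Prop) :
  exists m, m < 2 ^ n /\ forall i, i < n -> (bit m i <-> P i).
Proof.
elim: n => [|n [m [mn mP]]]; first by exists 0.
have pE : 2 ^ n.+1 = 2 ^ n + 2 ^ n by rewrite expnS mul2n addnn.
have [Pn|nPn] := pselect (P n).
- exists (2 ^ n + m); split; first lia.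
  move=> i; rewrite ltnS leq_eqVlt => /predU1P[->|lin].
    by rewrite /bit divnDl // divnn expn_gt0 /= divn_small.
  rewrite -mP // /bit; have -> : 2 ^ n = 2 ^ (n - i) * 2 ^ i.
    by rewrite -expnD subnK // ltnW.
  rewrite divnMDl ?expn_gt0 // oddD oddX.
  by have -> : n - i == 0 = false by lia.
- exists m; split; first lia.
  move=> i; rewrite ltnS leq_eqVlt => /predU1P[->|/mP//].
  by rewrite /bit divn_small.
Qed.

Notation decode := CodeSeq.decode.

Lemma code_inj : injective code.
Proof. exact: can_inj CodeSeq.codeK. Qed.

Lemma code_lt x l : x \in l -> x < code l.
Proof. by move=> xl; have /allP/(_ x xl) := CodeSeq.ltn_code l. Qed.

(** List construction on codes. As the empty list has code 0, every positive number is [ccons h t]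
    for exactly one pair. *)
Definition ccons (h t : nat) : nat := 2 ^ h * t.*2.+1.

Lemma code_cons h l : code (h :: l) = ccons h (code l).
Proof. by []. Qed.

Lemma ccons_decode h t : ccons h t = code (h :: decode t).
Proof. by rewrite code_cons CodeSeq.decodeK. Qed.

Lemma decode_ccons h t : decode (ccons h t) = h :: decode t.
Proof. by rewrite ccons_decode CodeSeq.codeK. Qed.

Lemma ccons_inj h t h' t' : ccons h t = ccons h' t' -> h = h' /\ t = t'.
Proof.
rewrite !ccons_decode => /code_inj[-> e]; split=> //.
exact: (can_inj CodeSeq.decodeK).
Qed.

Lemma ltn_ccons_r h t t' : t < t' -> ccons h t < ccons h t'.
Proof. by move=> tt'; rewrite /ccons ltn_pmul2l ?expn_gt0 // ltnS ltn_double. Qed.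

Lemma ltn_ccons2 h t : t < ccons h t.
Proof. by rewrite /ccons; have := expn_gt0 2 h; nia. Qed.

Lemma ltn_ccons1 h t : h < ccons h t.
Proof. by rewrite ccons_decode; apply: code_lt; rewrite mem_head. Qed.

Lemma codeP c : c = 0 \/ exists h t, c = ccons h t.
Proof.
case e : (decode c) => [|h l].
  by left; rewrite -(CodeSeq.decodeK c) e.
by right; exists h, (code l); rewrite -code_cons -e CodeSeq.decodeK.
Qed.

Lemma erec_ccons f g : erec f -> erec g -> erec (fun s => ccons (f s) (g s)).
Proof.
move=> rf rg; apply: erec_mul; first exact: erec_pow2.
by apply: erec_S; apply: eq_erec (erec_add rg rg) => s; rewrite addnn.
Qed.

Lemma erec_code_cons f (l : (nat -> nat) -> seq nat) :
  erec f -> erec (fun s => code (l s)) -> erec (fun s => code (f s :: l s)).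
Proof. exact: erec_ccons. Qed.

Definition nthc (c i : nat) : nat := nth 0 (decode c) i.

Lemma nthc_code l i : nthc (code l) i = nth 0 l i.
Proof. by rewrite /nthc CodeSeq.codeK. Qed.

Lemma nthc_le c i : nthc c i <= c.
Proof.
rewrite /nthc; have [ic|ic] := ltnP i (size (decode c)); last by rewrite nth_default.
by rewrite -{2}(CodeSeq.decodeK c) ltnW // code_lt // mem_nth.
Qed.

Definition tlc (c : nat) : nat := code (behead (decode c)).

Lemma erec_tlc : erec (fun s => tlc (s 0)).
Proof.
apply: erec_graph.
apply: (@eq_edec _ (fun s => (s 1 = 0 /\ s 0 = 0) \/
          exists h, h < (s 1).+1 /\ s 1 = ccons h (s 0))).
  move=> s; case: (codeP (s 1)) => [->|[h [t ->]]].
    split=> [->|[[]//|[h [_ e]]]]; first by left.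
    by have := ltn_ccons1 h (s 0); rewrite -e.
  have lt := ltn_ccons1 h t; rewrite {1}/tlc decode_ccons /= CodeSeq.decodeK.
  split=> [->|[[e _]|[h' [_ /ccons_inj[]]]]] //; last by rewrite e in lt.
  by right; exists h; split=> //; apply: leqW.
have rv := erec_var.
apply: edec_or; first by apply: edec_and; apply: edec_eq; [apply: rv|apply: erec_const|
  apply: rv|apply: erec_const].
apply: edec_ex; first by apply: erec_S; apply: rv.
by apply: edec_eq; [apply: rv|apply: erec_ccons; apply: rv].
Qed.

Lemma iter_tlc c i : decode (iter i tlc c) = drop i (decode c).
Proof.
elim: i => [|i IH] /=; first by rewrite drop0.
by rewrite /tlc CodeSeq.codeK IH -drop1 drop_drop add1n.
Qed.

Lemma erec_iter_tlc : erec (fun s => iter (s 0) tlc (s 1)).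
Proof.
apply: (@eq_erec _ (fun s => iteri (s 0) (fun _ a => tlc a) (s 1))).
  by move=> s; elim: (s 0) => //= n ->.
apply: (erec_iteri (g := fun _ a _ => tlc a)); [exact: erec_var..|].
exact: erec_comp1 erec_tlc (erec_var 1).
Qed.

(** The first alternative is the default value: beyond the end of the list the iterated tail is 0,
    and so is the entry. *)
Lemma nthc_ex y c i : y = nthc c i <->
  (iter i tlc c = 0 /\ y = 0) \/
  (exists t, t < c.+1 /\ iter i tlc c = ccons y t).
Proof.
have nE : nthc c i = head 0 (decode (iter i tlc c)).
  by rewrite iter_tlc /nthc -nth0 nth_drop addn0.
have le : iter i tlc c <= c.
  elim: i {nE} => //= i IH; apply: leq_trans IH; rewrite {1}/tlc.
  case: (codeP (iter i tlc c)) => [->|[h [t ->]]] //.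
  by rewrite decode_ccons /= CodeSeq.decodeK ltnW // ltn_ccons2.
rewrite {}nE; case: (codeP (iter i tlc c)) le => [->|[h [t ->]]] le.
  split=> [->|[[]//|[t [_ e]]]]; first by left.
  by have := ltn_ccons1 y t; rewrite -e.
rewrite decode_ccons /=; split=> [->|[[e]|[t' [_ /ccons_inj[]]]]] //.
  by right; exists t; split=> //; have := ltn_ccons2 h t; lia.
by have := ltn_ccons1 h t; rewrite e.
Qed.

Lemma erec_nthc f g : erec f -> erec g -> erec (fun s => nthc (f s) (g s)).
Proof.
apply: erec_comp2; apply: erec_graph.
apply: (eq_edec (fun s => nthc_ex (s 0) (s 1) (s 2))).
have rv := erec_var.
have ri j k : erec (fun s => iter (s j) tlc (s k)).
  exact: (erec_comp2 (h := fun a b => iter a tlc b)) erec_iter_tlc (rv j) (rv k).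
apply: edec_or.
  apply: edec_and; apply: edec_eq => //; exact: erec_const.
apply: edec_ex; first by apply: erec_S; apply: rv.
by apply: edec_eq => //; apply: erec_ccons; apply: rv.
Qed.

Definition memc (x c : nat) : Prop := x \in decode c.

Lemma memc_ex x c : memc x c <->
  exists i, i < c.+1 /\ exists t, t < c.+1 /\ iter i tlc c = ccons x t.
Proof.
rewrite /memc; split=> [xc|[i [_ [t [_ e]]]]]; last first.
  by apply: (@mem_drop i); rewrite -iter_tlc e decode_ccons mem_head.
have sz l : size l <= code l.
  by elim: l => //= h l IH; apply: leq_ltn_trans IH (ltn_ccons2 _ _).
have ic : index x (decode c) < size (decode c) by rewrite index_mem.
exists (index x (decode c)); split.
  by rewrite ltnS ltnW // (leq_trans ic) // -{2}(CodeSeq.decodeK c) sz.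
have := nthc_ex x c (index x (decode c)); rewrite /nthc nth_index // => -[] /(_ erefl) [[e _]|//].
by have := iter_tlc c (index x (decode c)); rewrite e (drop_nth 0).
Qed.

Lemma edec_memc f g : erec f -> erec g -> edec (fun s => memc (f s) (g s)).
Proof.
apply: edec_comp2; apply: (eq_edec (fun s => memc_ex (s 0) (s 1))).
have rv := erec_var.
do 2![apply: edec_ex; first by apply: erec_S; apply: rv].
apply: edec_eq; last by apply: erec_ccons; apply: rv.
exact: (erec_comp2 (h := fun a b => iter a tlc b)) erec_iter_tlc (rv 1) (rv 3).
Qed.

Lemma edec_comp7 (P : nat -> nat -> nat -> nat -> nat -> nat -> nat -> Prop)
    f1 f2 f3 f4 f5 f6 f7 :
  edec (fun s => P (s 0) (s 1) (s 2) (s 3) (s 4) (s 5) (s 6)) ->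
  erec f1 -> erec f2 -> erec f3 -> erec f4 -> erec f5 -> erec f6 -> erec f7 ->
  edec (fun s => P (f1 s) (f2 s) (f3 s) (f4 s) (f5 s) (f6 s) (f7 s)).
Proof.
move=> rP *.
apply: (edec_comp (g := nth (fun=> 0) [:: f1; f2; f3; f4; f5; f6; f7]) rP) => i.
by apply: erec_nth; do !constructor.
Qed.

Lemma edec_cst (P : Prop) : edec (fun=> P).
Proof. exact: erec_const. Qed.

(* [usr] is tried on the atoms which are not handled by the general rules. *)
Ltac erec_solve usr :=
  lazymatch goal with
  | |- edec (fun _ => _ /\ _) => apply edec_and; erec_solve usr
  | |- edec (fun _ => _ \/ _) => apply edec_or; erec_solve usr
  | |- edec (fun _ => _ <-> _) => apply edec_iff; erec_solve usr
  | |- edec (fun _ => ~ _) => apply edec_not; erec_solve usr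
  | |- edec (fun _ => _ = _) => apply edec_eq; erec_solve usr
  | |- edec (fun s => is_true (leq _ _)) => apply edec_leq; erec_solve usr
  | |- edec (fun _ => exists x : nat, is_true (leq _ _) /\ _) => apply edec_ex; erec_solve usr
  | |- edec (fun _ => forall x : nat, is_true (leq (S x) _) -> _) =>
      apply edec_all; erec_solve usr
  | |- edec (fun _ => bit _ _) => apply edec_bit; erec_solve usr
  | |- edec (fun _ => memc _ _) => apply edec_memc; erec_solve usr
  | |- edec (fun _ => forall x, is_true (x \in _) -> _) =>
      apply edec_all_seq; let x := fresh "x" in intro x; erec_solve usr
  | |- edec (fun _ => exists x, is_true (x \in _) /\ _) =>
      apply edec_ex_seq; let x := fresh "x" in intro x; erec_solve usr
  | |- erec (fun s => s _) => apply erec_var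
  | |- erec (fun s => iteri _ _ _) => apply erec_iteri; erec_solve usr
  | |- erec (fun s => if asbool _ then _ else _) => apply erec_if; erec_solve usr
  | |- erec (fun s => ccons _ _) => apply erec_ccons; erec_solve usr
  | |- erec (fun s => CodeSeq.code (_ :: _)) => apply erec_code_cons; erec_solve usr
  | |- erec (fun s => nthc _ _) => apply erec_nthc; erec_solve usr
  | |- erec (fun s => cnt _ _) => apply erec_cnt; erec_solve usr
  | |- erec (fun s => expn 2 _) => apply erec_pow2; erec_solve usr
  | |- erec (fun s => addn _ _) => apply erec_add; erec_solve usr
  | |- erec (fun s => muln _ _) => apply erec_mul; erec_solve usr
  | |- erec (fun s => S _) => first [exact (erec_const _) | apply erec_S; erec_solve usr]
  | |- edec (fun s => _ -> _) => apply edec_imp; erec_solve usr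
  | |- _ => first [exact (erec_const _) | exact (edec_cst _) | usr; erec_solve usr]
  end.

(** * The decision formula *)

(* Sorts of codes: 0, 1, 2 lists of RBox, TBox, ABox statements; 3, 4, 5 the
   statements themselves; 6 concepts; 7 abstract roles; 8 concrete roles; 9 data
   type terms; 10 data ranges; 11 constants; 12 lists of abstract roles; 13
   queries; 14 literals; 15 atoms; 16 terms of data sort; 17 substitutions of
   individual variables; 18 their entries; 19 ground terms; 31 other arguments. *)
Definition elt_sorts : seq (nat * nat) :=
  [:: (0, 3); (1, 4); (2, 5); (12, 7); (13, 14); (17, 18)].

(** Rows are indexed by sorts, their entries by tags, and each entry lists the sorts of the
    arguments. What is missing from the table gets sort 31 by default and is not followed further,
    such as names, numbers and variables. *)
Definition arg_sorts : seq (seq (seq nat)) :=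
  [:: [::]; [::]; [::];
  [:: [:: 7; 7]; [:: 7; 7]; [:: 7; 12; 7]; [:: 7]; [:: 7]; [:: 7]; [:: 7];
      [:: 7; 7]; [:: 7]; [:: 7]; [:: 7; 6; 6]; [:: 8; 8]; [:: 8; 8]; [:: 8; 8];
      [:: 8]];
  [:: [:: 6; 6]; [:: 6; 6]; [:: 6; 7; 6]; [:: 7; 6; 6]; [:: 31; 7; 6; 6];
      [:: 6; 31; 7; 6]; [:: 9; 9]; [:: 9; 9]; [:: 6; 8; 9]; [:: 8; 9; 6];
      [:: 31; 8; 9; 6]; [:: 6; 31; 8; 9]];
  [:: [:: 31; 6]; [:: 31; 31; 7]; [::]; [::]; [:: 11; 9]; [:: 31; 11; 8]];
  [:: [::]; [::]; [::]; [:: 6]; [:: 6; 6]; [:: 6; 6]; [::]; [:: 7]; [:: 7];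
      [:: 8; 11]];
  [:: [::]; [:: 7]; [:: 7]; [:: 7; 7]; [:: 7; 7]; [:: 7; 6]; [:: 7; 6];
      [:: 7; 6; 6]; [:: 6]; [:: 6; 6]];
  [:: [::]; [:: 8]; [:: 8; 8]; [:: 8; 8]; [:: 8; 6]; [:: 8; 9]; [:: 8; 6; 9]];
  [:: [:: 10]; [:: 9]; [:: 9; 9]; [:: 9; 9]; [:: 11]];
  [::]; [::]; [::]; [::];
  [:: [:: 15]; [:: 15]];
  [:: [:: 7]; [:: 8; 31; 16]; [:: 6]; [::]; [:: 31; 31; 16]; [::]; [::];
      [:: 16; 16]];
  [:: [::]; [:: 11]];
  [::]; [::];
  [:: [::]; [:: 11]]].

Definition arg_sort (so tag i : nat) : nat :=
  nth 31 (nth [::] (nth [::] arg_sorts so) tag) i.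

(** A role chain keeps its first role apart from the list of the others; a clause of its own joins
    them, because chains are evaluated as whole lists. Of the substitution only the individual part
    is followed, as it alone can bring in constants. The bounds 15 and 4 are the largest numbers of
    tags and of arguments in the syntax. *)
Definition closed_codes (Z kk qq ss : nat) (M : nat -> nat -> Prop) : Prop :=
  (M 0 (nthc kk 0) /\ M 1 (nthc kk 1) /\ M 2 (nthc kk 2) /\ M 13 qq /\
   M 17 (nthc ss 0)) /\
  (forall p, p \in elt_sorts -> forall h, h < Z -> forall t, t < Z ->
     M p.1 (ccons h t) -> M p.2 h /\ M p.1 t) /\
  (forall x, x < Z -> forall c, c < Z -> M 18 (ccons x c) -> M 19 (nthc c 0)) /\
  (forall R, R < Z -> forall l, l < Z -> forall R', R' < Z ->
     M 3 (code [:: 2; R; l; R']) -> M 12 (ccons R l)) /\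
  (forall so, so \in iota 0 20 -> forall tag, tag \in iota 0 15 ->
   forall i, i \in iota 0 4 -> arg_sort so tag i != 31 ->
   forall c, c < Z -> M so (ccons tag c) -> M (arg_sort so tag i) (nthc c i)).

(* The least closed set of codes, as the intersection of all closed sets. *)
Definition occ (Z kk qq ss so c : nat) : Prop :=
  c < Z /\ forall m, m < 2 ^ (Z * 32) ->
    closed_codes Z kk qq ss (fun so' c' => bit m (c' * 32 + so')) ->
    bit m (c * 32 + so).

(** A type is a set of triples of a sort below 16, a code below [Z] and an individual below [Z], so
    there are [2 ^ (16 * Z * Z)] of them; up to [Z] representatives are kept for each. *)
Definition dbound (Z : nat) : nat := 2 ^ (16 * Z * Z) * Z.

(** The arguments are the digits of a bit position in mixed radix. Declaring facts false outside the
    ranges keeps different arguments from sharing a bit. *)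
Definition fact (Z m k c x y : nat) : Prop :=
  (k < 16 /\ c < Z /\ x < Z /\ y < dbound Z) /\
  bit m (((k * Z + c) * Z + x) * dbound Z + y).

(* [V so c x y] is the truth value of the expression of sort [so] and code [c]
   at [x] and [y], where [x] (and [y] in sorts 7 and 12) is an element of the
   abstract domain {0, ..., k - 1} and [y] in sorts 8 to 11 is one of the [L]
   representatives of data values; [V 13 a x 0] says that [a] denotes [x]. *)
Section Rules.
Variables (Z k L : nat) (W : nat -> nat -> Prop).
Variable V : nat -> nat -> nat -> nat -> Prop.

(** There is no rule for concept names: the values guessed for their codes are their interpretation.
    The same holds of role names, the universal role excepted. *)
Definition concept_rules : Prop :=
  (W 6 (code [:: 1]) -> forall x, x < k -> V 6 (code [:: 1]) x 0) /\
  (W 6 (code [:: 2]) -> forall x, x < k -> ~ V 6 (code [:: 2]) x 0) /\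
  (forall c, c < Z -> W 6 (code [:: 3; c]) -> forall x, x < k ->
     (V 6 (code [:: 3; c]) x 0 <-> ~ V 6 c x 0)) /\
  (forall c, c < Z -> forall d, d < Z -> W 6 (code [:: 4; c; d]) ->
     forall x, x < k -> (V 6 (code [:: 4; c; d]) x 0 <-> V 6 c x 0 \/ V 6 d x 0)) /\
  (forall c, c < Z -> forall d, d < Z -> W 6 (code [:: 5; c; d]) ->
     forall x, x < k -> (V 6 (code [:: 5; c; d]) x 0 <-> V 6 c x 0 /\ V 6 d x 0)) /\
  (forall a, a < Z -> W 6 (code [:: 6; a]) -> forall x, x < k ->
     (V 6 (code [:: 6; a]) x 0 <-> V 13 a x 0)) /\
  (forall r, r < Z -> W 6 (code [:: 7; r]) -> forall x, x < k ->
     (V 6 (code [:: 7; r]) x 0 <-> V 7 r x x)) /\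
  (forall r, r < Z -> forall a, a < Z -> W 6 (code [:: 8; r; a]) ->
     forall x, x < k -> (V 6 (code [:: 8; r; a]) x 0 <->
       exists y, y < k /\ (V 13 a y 0 /\ V 7 r x y))) /\
  (forall p, p < Z -> forall e, e < Z -> W 6 (code [:: 9; p; e]) ->
     forall x, x < k -> (V 6 (code [:: 9; p; e]) x 0 <->
       exists j, j < L /\ (V 11 e 0 j /\ V 8 p x j))).

Definition arole_rules : Prop :=
  (W 7 (code [:: 0; 0]) -> forall x, x < k -> forall y, y < k ->
     V 7 (code [:: 0; 0]) x y) /\
  (forall r, r < Z -> W 7 (code [:: 1; r]) -> forall x, x < k ->
     forall y, y < k -> (V 7 (code [:: 1; r]) x y <-> V 7 r y x)) /\
  (forall r, r < Z -> W 7 (code [:: 2; r]) -> forall x, x < k ->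
     forall y, y < k -> (V 7 (code [:: 2; r]) x y <-> ~ V 7 r x y)) /\
  (forall r, r < Z -> forall r', r' < Z -> W 7 (code [:: 3; r; r']) ->
     forall x, x < k -> forall y, y < k ->
     (V 7 (code [:: 3; r; r']) x y <-> V 7 r x y \/ V 7 r' x y)) /\
  (forall r, r < Z -> forall r', r' < Z -> W 7 (code [:: 4; r; r']) ->
     forall x, x < k -> forall y, y < k ->
     (V 7 (code [:: 4; r; r']) x y <-> V 7 r x y /\ V 7 r' x y)) /\
  (forall r, r < Z -> forall c, c < Z -> W 7 (code [:: 5; r; c]) ->
     forall x, x < k -> forall y, y < k ->
     (V 7 (code [:: 5; r; c]) x y <-> V 7 r x y /\ V 6 c x 0)) /\
  (forall r, r < Z -> forall c, c < Z -> W 7 (code [:: 6; r; c]) ->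
     forall x, x < k -> forall y, y < k ->
     (V 7 (code [:: 6; r; c]) x y <-> V 7 r x y /\ V 6 c y 0)) /\
  (forall r, r < Z -> forall c, c < Z -> forall d, d < Z ->
     W 7 (code [:: 7; r; c; d]) -> forall x, x < k -> forall y, y < k ->
     (V 7 (code [:: 7; r; c; d]) x y <->
      V 7 r x y /\ (V 6 c x 0 /\ V 6 d y 0))) /\
  (forall c, c < Z -> W 7 (code [:: 8; c]) ->
     forall x, x < k -> forall y, y < k ->
     (V 7 (code [:: 8; c]) x y <-> x = y /\ V 6 c x 0)) /\
  (forall c, c < Z -> forall d, d < Z -> W 7 (code [:: 9; c; d]) ->
     forall x, x < k -> forall y, y < k ->
     (V 7 (code [:: 9; c; d]) x y <-> V 6 c x 0 /\ V 6 d y 0)).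

Definition crole_rules : Prop :=
  (forall p, p < Z -> W 8 (code [:: 1; p]) -> forall x, x < k ->
     forall j, j < L -> (V 8 (code [:: 1; p]) x j <-> ~ V 8 p x j)) /\
  (forall p, p < Z -> forall p', p' < Z -> W 8 (code [:: 2; p; p']) ->
     forall x, x < k -> forall j, j < L ->
     (V 8 (code [:: 2; p; p']) x j <-> V 8 p x j \/ V 8 p' x j)) /\
  (forall p, p < Z -> forall p', p' < Z -> W 8 (code [:: 3; p; p']) ->
     forall x, x < k -> forall j, j < L ->
     (V 8 (code [:: 3; p; p']) x j <-> V 8 p x j /\ V 8 p' x j)) /\
  (forall p, p < Z -> forall c, c < Z -> W 8 (code [:: 4; p; c]) ->
     forall x, x < k -> forall j, j < L ->
     (V 8 (code [:: 4; p; c]) x j <-> V 8 p x j /\ V 6 c x 0)) /\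
  (forall p, p < Z -> forall t, t < Z -> W 8 (code [:: 5; p; t]) ->
     forall x, x < k -> forall j, j < L ->
     (V 8 (code [:: 5; p; t]) x j <-> V 8 p x j /\ V 9 t 0 j)) /\
  (forall p, p < Z -> forall c, c < Z -> forall t, t < Z ->
     W 8 (code [:: 6; p; c; t]) -> forall x, x < k -> forall j, j < L ->
     (V 8 (code [:: 6; p; c; t]) x j <->
      V 8 p x j /\ (V 6 c x 0 /\ V 9 t 0 j))).

Definition dterm_rules : Prop :=
  (forall r, r < Z -> W 9 (code [:: 0; r]) -> forall j, j < L ->
     (V 9 (code [:: 0; r]) 0 j <-> V 10 r 0 j)) /\
  (forall t, t < Z -> W 9 (code [:: 1; t]) -> forall j, j < L ->
     (V 9 (code [:: 1; t]) 0 j <-> ~ V 9 t 0 j)) /\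
  (forall t, t < Z -> forall u, u < Z -> W 9 (code [:: 2; t; u]) ->
     forall j, j < L -> (V 9 (code [:: 2; t; u]) 0 j <-> V 9 t 0 j /\ V 9 u 0 j)) /\
  (forall t, t < Z -> forall u, u < Z -> W 9 (code [:: 3; t; u]) ->
     forall j, j < L -> (V 9 (code [:: 3; t; u]) 0 j <-> V 9 t 0 j \/ V 9 u 0 j)) /\
  (forall e, e < Z -> W 9 (code [:: 4; e]) -> forall j, j < L ->
     (V 9 (code [:: 4; e]) 0 j <-> V 11 e 0 j)).

Definition chain_rules : Prop :=
  (forall r, r < Z -> W 12 (ccons r 0) -> forall x, x < k -> forall y, y < k ->
     (V 12 (ccons r 0) x y <-> V 7 r x y)) /\
  (forall r, r < Z -> forall r', r' < Z -> forall t, t < Z ->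
     W 12 (ccons r (ccons r' t)) -> forall x, x < k -> forall y, y < k ->
     (V 12 (ccons r (ccons r' t)) x y <->
      exists z, z < k /\ (V 7 r x z /\ V 12 (ccons r' t) z y))).

Definition ind_rules : Prop :=
  forall a, a < Z -> exists x, x < k /\ (V 13 a x 0 /\
    forall y, y < k -> V 13 a y 0 -> y = x).

(** Functionality of a concrete role is stated by counting, so that the argument for number
    restrictions covers it too: one index may stand for many values. *)
Definition rbox_rules : Prop :=
  (forall r, r < Z -> forall r', r' < Z -> W 3 (code [:: 0; r; r']) ->
     forall x, x < k -> forall y, y < k -> (V 7 r x y <-> V 7 r' x y)) /\
  (forall r, r < Z -> forall r', r' < Z -> W 3 (code [:: 1; r; r']) ->
     forall x, x < k -> forall y, y < k -> V 7 r x y -> V 7 r' x y) /\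
  (forall r, r < Z -> forall l, l < Z -> forall r', r' < Z ->
     W 3 (code [:: 2; r; l; r']) -> forall x, x < k -> forall y, y < k ->
     V 12 (ccons r l) x y -> V 7 r' x y) /\
  (forall r, r < Z -> W 3 (code [:: 3; r]) -> forall x, x < k ->
     forall y, y < k -> V 7 r x y -> V 7 r y x) /\
  (forall r, r < Z -> W 3 (code [:: 4; r]) -> forall x, x < k ->
     forall y, y < k -> V 7 r x y -> ~ V 7 r y x) /\
  (forall r, r < Z -> W 3 (code [:: 5; r]) -> forall x, x < k -> V 7 r x x) /\
  (forall r, r < Z -> W 3 (code [:: 6; r]) -> forall x, x < k -> ~ V 7 r x x) /\
  (forall r, r < Z -> forall r', r' < Z -> W 3 (code [:: 7; r; r']) ->
     forall x, x < k -> forall y, y < k -> ~ (V 7 r x y /\ V 7 r' x y)) /\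
  (forall r, r < Z -> W 3 (code [:: 8; r]) -> forall x, x < k ->
     forall y, y < k -> forall z, z < k -> V 7 r x y -> V 7 r y z -> V 7 r x z) /\
  (forall r, r < Z -> W 3 (code [:: 9; r]) -> forall x, x < k ->
     forall y, y < k -> forall z, z < k -> V 7 r x y -> V 7 r x z -> y = z) /\
  (forall r, r < Z -> forall c, c < Z -> forall d, d < Z ->
     W 3 (code [:: 10; r; c; d]) -> forall x, x < k -> forall y, y < k ->
     (V 7 r x y <-> V 6 c x 0 /\ V 6 d y 0)) /\
  (forall p, p < Z -> forall p', p' < Z -> W 3 (code [:: 11; p; p']) ->
     forall x, x < k -> forall j, j < L -> (V 8 p x j <-> V 8 p' x j)) /\
  (forall p, p < Z -> forall p', p' < Z -> W 3 (code [:: 12; p; p']) ->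
     forall x, x < k -> forall j, j < L -> V 8 p x j -> V 8 p' x j) /\
  (forall p, p < Z -> forall p', p' < Z -> W 3 (code [:: 13; p; p']) ->
     forall x, x < k -> forall j, j < L -> ~ (V 8 p x j /\ V 8 p' x j)) /\
  (forall p, p < Z -> W 3 (code [:: 14; p]) -> forall x, x < k ->
     ~ 2 <= cnt L (fun j => V 8 p x j)).

Definition tbox_rules : Prop :=
  (forall c, c < Z -> forall d, d < Z -> W 4 (code [:: 0; c; d]) ->
     forall x, x < k -> (V 6 c x 0 <-> V 6 d x 0)) /\
  (forall c, c < Z -> forall d, d < Z -> W 4 (code [:: 1; c; d]) ->
     forall x, x < k -> V 6 c x 0 -> V 6 d x 0) /\
  (forall c, c < Z -> forall r, r < Z -> forall d, d < Z ->
     W 4 (code [:: 2; c; r; d]) -> forall x, x < k -> V 6 c x 0 ->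
     forall y, y < k -> V 7 r x y -> V 6 d y 0) /\
  (forall r, r < Z -> forall c, c < Z -> forall d, d < Z ->
     W 4 (code [:: 3; r; c; d]) -> forall x, x < k ->
     (exists y, y < k /\ (V 7 r x y /\ V 6 c y 0)) -> V 6 d x 0) /\
  (forall n, n < Z -> forall r, r < Z -> forall c, c < Z -> forall d, d < Z ->
     W 4 (code [:: 4; n; r; c; d]) -> forall x, x < k ->
     n <= cnt k (fun y => V 7 r x y /\ V 6 c y 0) -> V 6 d x 0) /\
  (forall c, c < Z -> forall n, n < Z -> forall r, r < Z -> forall d, d < Z ->
     W 4 (code [:: 5; c; n; r; d]) -> forall x, x < k -> V 6 c x 0 ->
     ~ n.+1 <= cnt k (fun y => V 7 r x y /\ V 6 d y 0)) /\
  (forall t, t < Z -> forall u, u < Z -> W 4 (code [:: 6; t; u]) ->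
     forall j, j < L -> (V 9 t 0 j <-> V 9 u 0 j)) /\
  (forall t, t < Z -> forall u, u < Z -> W 4 (code [:: 7; t; u]) ->
     forall j, j < L -> V 9 t 0 j -> V 9 u 0 j) /\
  (forall c, c < Z -> forall p, p < Z -> forall t, t < Z ->
     W 4 (code [:: 8; c; p; t]) -> forall x, x < k -> V 6 c x 0 ->
     forall j, j < L -> V 8 p x j -> V 9 t 0 j) /\
  (forall p, p < Z -> forall t, t < Z -> forall c, c < Z ->
     W 4 (code [:: 9; p; t; c]) -> forall x, x < k ->
     (exists j, j < L /\ (V 8 p x j /\ V 9 t 0 j)) -> V 6 c x 0) /\
  (forall n, n < Z -> forall p, p < Z -> forall t, t < Z -> forall c, c < Z ->
     W 4 (code [:: 10; n; p; t; c]) -> forall x, x < k ->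
     n <= cnt L (fun j => V 8 p x j /\ V 9 t 0 j) -> V 6 c x 0) /\
  (forall c, c < Z -> forall n, n < Z -> forall p, p < Z -> forall t, t < Z ->
     W 4 (code [:: 11; c; n; p; t]) -> forall x, x < k -> V 6 c x 0 ->
     ~ n.+1 <= cnt L (fun j => V 8 p x j /\ V 9 t 0 j)).

Definition abox_rules : Prop :=
  (forall a, a < Z -> forall c, c < Z -> W 5 (code [:: 0; a; c]) ->
     forall x, x < k -> V 13 a x 0 -> V 6 c x 0) /\
  (forall a, a < Z -> forall b, b < Z -> forall r, r < Z ->
     W 5 (code [:: 1; a; b; r]) -> forall x, x < k -> forall y, y < k ->
     V 13 a x 0 -> V 13 b y 0 -> V 7 r x y) /\
  (forall a, a < Z -> forall b, b < Z -> W 5 (code [:: 2; a; b]) ->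
     forall x, x < k -> forall y, y < k -> V 13 a x 0 -> V 13 b y 0 -> x = y) /\
  (forall a, a < Z -> forall b, b < Z -> W 5 (code [:: 3; a; b]) ->
     forall x, x < k -> forall y, y < k -> V 13 a x 0 -> V 13 b y 0 -> ~ x = y) /\
  (forall e, e < Z -> forall t, t < Z -> W 5 (code [:: 4; e; t]) ->
     forall j, j < L -> V 11 e 0 j -> V 9 t 0 j) /\
  (forall a, a < Z -> forall e, e < Z -> forall p, p < Z ->
     W 5 (code [:: 5; a; e; p]) -> forall x, x < k -> forall j, j < L ->
     V 13 a x 0 -> V 11 e 0 j -> V 8 p x j).

(* [wval si w g]: the term of code [w] becomes the ground term of code [g] under
   the substitution of code [si]. Individuals carry the tag 1 in the terms of
   queries but 0 in ground terms. *)
Definition wval (si w g : nat) : Prop :=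
  (exists x, x < Z /\ (w = code [:: 0; x] /\ memc (code [:: x; g]) si)) \/
  (exists a, a < Z /\ (w = code [:: 1; a] /\ g = code [:: 0; a])).

Definition uval (si u g : nat) : Prop :=
  (exists x, x < Z /\ (u = code [:: 0; x] /\ memc (code [:: x; g]) si)) \/
  (exists e, e < Z /\ (u = code [:: 1; e] /\ g = code [:: 1; e])).

(** The existential witnesses also certify that the replacement yields an atomic formula. The
    universal role, whose code as a name is 0, is singled out under a role variable because the term
    for it need not occur in the input, and then no rule fixes its truth value. Equations have two
    cases since variables may denote individuals or constants. *)
Definition query_rules (qq ss : nat) : Prop :=
  forall b, b < Z -> forall a, a < Z -> memc (code [:: b; a]) qq ->
  (forall r, r < Z -> forall w, w < Z -> forall w', w' < Z ->
     a = code [:: 0; r; w; w'] ->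
     exists x, x < k /\ exists y, y < k /\ exists i, i < Z /\ exists j, j < Z /\
       (wval (nthc ss 0) w (code [:: 0; i]) /\
        wval (nthc ss 0) w' (code [:: 0; j]) /\
        V 13 i x 0 /\ V 13 j y 0 /\ (V 7 r x y <-> b = 1))) /\
  (forall p, p < Z -> forall w, w < Z -> forall u, u < Z ->
     a = code [:: 1; p; w; u] ->
     exists x, x < k /\ exists j, j < L /\ exists i, i < Z /\ exists e, e < Z /\
       (wval (nthc ss 0) w (code [:: 0; i]) /\
        uval (nthc ss 0) u (code [:: 1; e]) /\
        V 13 i x 0 /\ V 11 e 0 j /\ (V 8 p x j <-> b = 1))) /\
  (forall c, c < Z -> forall w, w < Z -> a = code [:: 2; c; w] ->
     exists x, x < k /\ exists i, i < Z /\
       (wval (nthc ss 0) w (code [:: 0; i]) /\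
        V 13 i x 0 /\ (V 6 c x 0 <-> b = 1))) /\
  (forall v, v < Z -> forall w, w < Z -> forall w', w' < Z ->
     a = code [:: 3; v; w; w'] ->
     exists x, x < k /\ exists y, y < k /\ exists i, i < Z /\ exists j, j < Z /\
     exists N, N < Z /\
       (memc (code [:: v; N]) (nthc ss 2) /\
        wval (nthc ss 0) w (code [:: 0; i]) /\
        wval (nthc ss 0) w' (code [:: 0; j]) /\
        V 13 i x 0 /\ V 13 j y 0 /\
        ((N = 0 \/ V 7 (code [:: 0; N]) x y) <-> b = 1))) /\
  (forall v, v < Z -> forall w, w < Z -> forall u, u < Z ->
     a = code [:: 4; v; w; u] ->
     exists x, x < k /\ exists j, j < L /\ exists i, i < Z /\ exists e, e < Z /\
     exists N, N < Z /\
       (memc (code [:: v; N]) (nthc ss 3) /\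
        wval (nthc ss 0) w (code [:: 0; i]) /\
        uval (nthc ss 0) u (code [:: 1; e]) /\
        V 13 i x 0 /\ V 11 e 0 j /\ (V 8 (code [:: 0; N]) x j <-> b = 1))) /\
  (forall v, v < Z -> forall w, w < Z -> a = code [:: 5; v; w] ->
     exists x, x < k /\ exists i, i < Z /\ exists N, N < Z /\
       (memc (code [:: v; N]) (nthc ss 1) /\
        wval (nthc ss 0) w (code [:: 0; i]) /\
        V 13 i x 0 /\ (V 6 (code [:: 0; N]) x 0 <-> b = 1))) /\
  (forall w, w < Z -> forall w', w' < Z -> a = code [:: 6; w; w'] ->
     (exists x, x < k /\ exists y, y < k /\ exists i, i < Z /\ exists j, j < Z /\
       (wval (nthc ss 0) w (code [:: 0; i]) /\
        wval (nthc ss 0) w' (code [:: 0; j]) /\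
        V 13 i x 0 /\ V 13 j y 0 /\ (x = y <-> b = 1))) \/
     (exists x, x < L /\ exists y, y < L /\ exists e, e < Z /\ exists f, f < Z /\
       (wval (nthc ss 0) w (code [:: 1; e]) /\
        wval (nthc ss 0) w' (code [:: 1; f]) /\
        V 11 e 0 x /\ V 11 f 0 y /\ (x = y <-> b = 1)))) /\
  (forall w, w < Z -> forall w', w' < Z -> a = code [:: 7; w; w'] ->
     (exists x, x < k /\ exists y, y < k /\ exists i, i < Z /\ exists j, j < Z /\
       (uval (nthc ss 0) w (code [:: 0; i]) /\
        uval (nthc ss 0) w' (code [:: 0; j]) /\
        V 13 i x 0 /\ V 13 j y 0 /\ (x = y <-> b = 1))) \/
     (exists x, x < L /\ exists y, y < L /\ exists e, e < Z /\ exists f, f < Z /\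
       (uval (nthc ss 0) w (code [:: 1; e]) /\
        uval (nthc ss 0) w' (code [:: 1; f]) /\
        V 11 e 0 x /\ V 11 f 0 y /\ (x = y <-> b = 1)))).

(* The code of the constraint expressing that [n] distinct values satisfy
   exactly the data ranges and constants prescribed by [A] and [B]. *)
Definition config (n : nat) (A B : nat -> nat -> Prop) : nat :=
  code [:: iteri n (fun j acc =>
             iteri Z (fun r acc =>
               if `[< W 10 r >] then
                 ccons (code [:: j; if `[< A r j >] then r else code [:: 2; r]]) acc
               else acc)
             (iteri Z (fun e acc =>
               if `[< W 11 e >] then
                 ccons (code [:: j; if `[< B e j >] then code [:: 0; code [:: e]]
                               else code [:: 2; code [:: 0; code [:: e]]]]) acc
               else acc) acc)) 0;
           iteri n (fun j acc =>
             iteri j (fun i acc => ccons (code [:: i; j]) acc) acc) 0].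

Definition same_type (i j : nat) : Prop :=
  forall so, so \in [:: 8; 9; 10; 11] -> forall c, c < Z ->
  forall x, x < Z -> (V so c x i <-> V so c x j).

(* Either the new value (of the type given by [u] and [v]) does not exist or it
   can imitate a representative whose type has [Z] representatives. *)
Definition data_rules (orac : nat -> Prop) : Prop :=
  orac (config L (fun r j => V 10 r 0 j) (fun e j => V 11 e 0 j)) /\
  forall u, u < 2 ^ Z -> forall v, v < 2 ^ Z ->
    (exists i, i < L /\
       ((forall r, r < Z -> W 10 r -> (V 10 r 0 i <-> bit u r)) /\
        (forall e, e < Z -> W 11 e -> (V 11 e 0 i <-> bit v e)) /\
        Z <= cnt L (fun j => same_type i j))) \/
    ~ orac (config L.+1
              (fun r j => (j < L /\ V 10 r 0 j) \/ (j = L /\ bit u r))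
              (fun e j => (j < L /\ V 11 e 0 j) \/ (j = L /\ bit v e))).

Definition model_rules (orac : nat -> Prop) (qq ss : nat) : Prop :=
  (concept_rules /\ arole_rules /\ crole_rules /\ dterm_rules /\ chain_rules) /\
  (ind_rules /\ rbox_rules /\ tbox_rules /\ abox_rules) /\
  query_rules qq ss /\ data_rules orac.

End Rules.

(* Tags of the atoms with the positions of their individual terms. *)
Definition term_positions : seq (nat * nat) :=
  [:: (0, 1); (0, 2); (1, 1); (1, 2); (2, 1); (3, 1); (3, 2); (4, 1); (4, 2);
      (5, 1); (6, 0); (6, 1); (7, 0); (7, 1)].

Definition ivar (Z qq x : nat) : Prop :=
  exists b, b < Z /\ exists a, a < Z /\ (memc (code [:: b; a]) qq /\
    exists p, p \in term_positions /\
      exists c, c < Z /\ (a = ccons p.1 c /\ nthc c p.2 = code [:: 0; x])).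

Definition hvar (tag Z qq x : nat) : Prop :=
  exists b, b < Z /\ exists a, a < Z /\ (memc (code [:: b; a]) qq /\
    exists c, c < Z /\ (a = ccons tag c /\ nthc c 0 = x)).

Definition dom_rule (Z sm : nat) (P : nat -> Prop) : Prop :=
  (forall i, i < Z -> forall j, j < Z -> forall x, x < Z ->
   forall a, a < Z -> forall b, b < Z ->
     nthc sm i = code [:: x; a] -> nthc sm j = code [:: x; b] -> i = j) /\
  (forall x, x < Z -> ((exists a, a < Z /\ memc (code [:: x; a]) sm) <-> P x)).

Definition subst_rules (Z qq ss : nat) : Prop :=
  dom_rule Z (nthc ss 0) (ivar Z qq) /\
  dom_rule Z (nthc ss 1) (hvar 5 Z qq) /\
  dom_rule Z (nthc ss 2) (hvar 3 Z qq) /\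
  dom_rule Z (nthc ss 3) (hvar 4 Z qq).

Definition coded_model (orac : nat -> Prop) (Z k L m kk qq ss : nat) : Prop :=
  model_rules Z k L (occ Z kk qq ss) (fact Z m) orac qq ss.

(** The bounds allow one individual for each name below [Z], [Z] representatives for each type, and
    one bit for each possible fact. *)
Definition answer_bounded (orac : nat -> Prop) (Z kk qq ss : nat) : Prop :=
  subst_rules Z qq ss /\
  exists k, k < Z.+1 /\ (0 < k /\ exists L, L < (dbound Z).+1 /\
    exists m, m < 2 ^ (16 * Z * Z * dbound Z) /\
      coded_model orac Z k L m kk qq ss).

Definition answer (orac : nat -> Prop) (kk qq ss : nat) : Prop :=
  answer_bounded orac (kk + qq + ss).+1 kk qq ss.

(** * Recursiveness of the decision formula *)

Lemma edec_occ so f1 f2 f3 f4 f5 :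
  erec f1 -> erec f2 -> erec f3 -> erec f4 -> erec f5 ->
  edec (fun s => occ (f1 s) (f2 s) (f3 s) (f4 s) so (f5 s)).
Proof.
apply: (edec_comp5 (P := fun a b c d e => occ a b c d so e)).
rewrite /occ /closed_codes; erec_solve fail.
Qed.

Lemma erec_dbound f : erec f -> erec (fun s => dbound (f s)).
Proof. by apply: erec_comp1; rewrite /dbound; erec_solve fail. Qed.

Lemma edec_fact k f1 f2 f3 f4 f5 :
  erec f1 -> erec f2 -> erec f3 -> erec f4 -> erec f5 ->
  edec (fun s => fact (f1 s) (f2 s) k (f3 s) (f4 s) (f5 s)).
Proof.
apply: (edec_comp5 (P := fun a b c d e => fact a b k c d e)).
by rewrite /fact; erec_solve ltac:(apply erec_dbound).
Qed.

Ltac atoms := idtac; first [apply edec_occ | apply edec_fact | apply erec_dbound].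

Lemma edec_coded_model orac f1 f2 f3 f4 f5 f6 f7 : edec (fun s => orac (s 0)) ->
  erec f1 -> erec f2 -> erec f3 -> erec f4 -> erec f5 -> erec f6 -> erec f7 ->
  edec (fun s => coded_model orac (f1 s) (f2 s) (f3 s) (f4 s) (f5 s) (f6 s) (f7 s)).
Proof.
move=> ro; apply: (edec_comp7 (P := coded_model orac)).
rewrite /coded_model /model_rules /data_rules.
repeat lazymatch goal with |- edec (fun _ => _ /\ _) => apply edec_and end.
- by rewrite /concept_rules; erec_solve atoms.
- by rewrite /arole_rules; erec_solve atoms.
- by rewrite /crole_rules; erec_solve atoms.
- by rewrite /dterm_rules; erec_solve atoms.
- by rewrite /chain_rules; erec_solve atoms.
- by rewrite /ind_rules; erec_solve atoms.
- by rewrite /rbox_rules; erec_solve atoms.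
- by rewrite /tbox_rules; erec_solve atoms.
- by rewrite /abox_rules; erec_solve atoms.
- by rewrite /query_rules /wval /uval; erec_solve atoms.
- rewrite /config.
  by apply: (edec_comp1 ro); erec_solve atoms.
- by rewrite /config /same_type; erec_solve ltac:(first [apply (edec_comp1 ro) | atoms]).
Qed.

Lemma edec_answer orac : edec (fun s => orac (s 0)) ->
  edec (fun s => answer orac (s 0) (s 1) (s 2)).
Proof.
move=> ro; apply: (@edec_comp5 (fun a b c d _ => answer_bounded orac a b c d)
  (fun s => (s 0 + s 1 + s 2).+1) (fun s => s 0) (fun s => s 1) (fun s => s 2)
  (fun s => s 0)); [|by erec_solve fail..].
rewrite /answer_bounded /subst_rules /dom_rule /ivar /hvar.
by erec_solve ltac:(first [apply (edec_coded_model ro) | apply erec_dbound]).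
Qed.

Arguments CodeSeq.code : simpl never.

(** * Injectivity of the coding *)

Lemma enc_seq_inj T (enc : T -> nat) : injective enc -> injective (enc_seq enc).
Proof. by move=> ei l l' /code_inj/(inj_map ei). Qed.

Lemma enc_const_inj D : injective (@enc_const D).
Proof.
move=> [d e] [d' e'] /code_inj[/(pcan_inj pickleK) /= dd].
by case: _ / dd e' => e' /(pcan_inj pickleK) ->.
Qed.

Ltac code_inj_cases :=
  match goal with
  | H : CodeSeq.code _ = CodeSeq.code _ |- _ =>
      apply code_inj in H; first [discriminate H | injection H; clear H; intros | clear H]
  end.

Lemma enc_fexpr_inj D (d : N_D D) : injective (@enc_fexpr D d).
Proof.
elim=> [f|||p IHp|p IHp q IHq|p IHp q IHq] [f'|||p'|p' q'|p' q'] /= H;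
  code_inj_cases => //; f_equal; auto; exact: (pcan_inj pickleK).
Qed.

Lemma enc_drange_inj D : injective (@enc_drange D).
Proof.
elim=> [es|d psi|r IHr] [es'|d' psi'|r'] /= H; code_inj_cases => //.
- by f_equal; apply: (enc_seq_inj (@enc_const_inj D)).
- move: H H0 => eqpsi /(pcan_inj pickleK) dd; case: _ / dd psi' eqpsi => psi'.
  by move/enc_fexpr_inj->.
- by f_equal; auto.
Qed.

Lemma enc_dterm_inj D : injective (@enc_dterm D).
Proof.
elim=> [r|t IHt|t IHt u IHu|t IHt u IHu|e] [r'|t'|t' u'|t' u'|e'] /= H;
  code_inj_cases => //; f_equal; auto; first exact: enc_drange_inj.
exact: enc_const_inj.
Qed.

Scheme concept_mut := Induction for concept Sort Prop
with arole_mut := Induction for arole Sort Prop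
with crole_mut := Induction for crole Sort Prop.
Combined Scheme concept_arole_crole_ind from concept_mut, arole_mut, crole_mut.

Lemma enc_arname_inj : injective enc_arname.
Proof. by case=> [|n] [|n'] //= [->]. Qed.

Lemma enc_term_inj D :
  (forall C C' : concept D, enc_concept C = enc_concept C' -> C = C') /\
  (forall R R' : arole D, enc_arole R = enc_arole R' -> R = R') /\
  (forall P P' : crole D, enc_crole P = enc_crole P' -> P = P').
Proof.
apply: (@concept_arole_crole_ind D
  (fun C => forall C', enc_concept C = enc_concept C' -> C = C')
  (fun R => forall R', enc_arole R = enc_arole R' -> R = R')
  (fun P => forall P', enc_crole P = enc_crole P' -> P = P')); intros;
  (lazymatch goal with
   | |- _ = ?X => destruct X
   end); simpl in *; code_inj_cases => //; f_equal;
  auto; by [apply: enc_const_inj | apply: enc_dterm_inj | apply: enc_arname_inj].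
Qed.

Lemma enc_concept_inj D : injective (@enc_concept D).
Proof. by case: (enc_term_inj D). Qed.

Lemma enc_arole_inj D : injective (@enc_arole D).
Proof. by case: (enc_term_inj D) => _ []. Qed.

Lemma enc_crole_inj D : injective (@enc_crole D).
Proof. by case: (enc_term_inj D) => _ []. Qed.

(** * The codes occurring in the input *)

Lemma bit_lt m n (P : nat -> Prop) : m < 2 ^ n ->
  (forall i, i < n -> (bit m i <-> P i)) -> forall i, bit m i <-> i < n /\ P i.
Proof.
move=> mn mP i; have [lin|nli] := ltnP i n; first by rewrite mP //; split=> [|[]].
split=> [|[]//]; rewrite /bit divn_small //.
by apply: leq_trans mn _; rewrite leq_exp2l.
Qed.

Lemma enc_seq_cons T (enc : T -> nat) x l :
  enc_seq enc (x :: l) = ccons (enc x) (enc_seq enc l).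
Proof. by []. Qed.

Lemma enc_seq_eq_cons T (enc : T -> nat) l h t : enc_seq enc l = ccons h t ->
  exists x l', [/\ l = x :: l', h = enc x & t = enc_seq enc l'].
Proof.
case: l => [|x l]; last by rewrite enc_seq_cons => /ccons_inj[<- <-]; exists x, l.
by move=> e; have := ltn_ccons1 h t; rewrite -e.
Qed.

(** The invariant of the closure process: a code of each sort comes from genuine syntax. For
    statements, membership in [K] is recorded as well, because a given model has to satisfy them. *)
Definition valid (D : datatype_map) (K : kb D) (so c : nat) : Prop :=
  match so with
  | 0 => exists l, enc_seq (@enc_rbox D) l = c /\
           forall s, List.In s l -> List.In s (rbox K)
  | 1 => exists l, enc_seq (@enc_tbox D) l = c /\
           forall s, List.In s l -> List.In s (tbox K)
  | 2 => exists l, enc_seq (@enc_abox D) l = c /\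
           forall s, List.In s l -> List.In s (abox K)
  | 3 => exists s, enc_rbox s = c /\ List.In s (rbox K)
  | 4 => exists s, enc_tbox s = c /\ List.In s (tbox K)
  | 5 => exists s, enc_abox s = c /\ List.In s (abox K)
  | 6 => exists C, @enc_concept D C = c
  | 7 => exists R, @enc_arole D R = c
  | 8 => exists P, @enc_crole D P = c
  | 9 => exists t, @enc_dterm D t = c
  | 10 => exists r, @enc_drange D r = c
  | 11 => exists e, @enc_const D e = c
  | 12 => exists l, enc_seq (@enc_arole D) l = c
  | 13 => exists Q, @enc_query D Q = c
  | 14 => exists l : bool * qatom D, code [:: l.1 : nat; enc_qatom l.2] = c
  | 15 => exists a, @enc_qatom D a = c
  | 16 => exists u, @enc_uterm D u = c
  | 17 => exists l, enc_map (@enc_ground D) l = c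
  | 18 => exists p : nat * ground D, code [:: p.1; enc_ground p.2] = c
  | 19 => exists g, @enc_ground D g = c
  | _ => True
  end.

Lemma elt_sorts_lt p : p \in elt_sorts -> p.1 < 32 /\ p.2 < 32.
Proof. by rewrite !inE; do 5?[case/orP]; move/eqP->. Qed.

Lemma arg_sort_lt so tag i : arg_sort so tag i < 32.
Proof.
have nth_ok T (P : pred T) x l j : P x -> all P l -> P (nth x l j).
  move=> Px Pl; have [jl|lj] := ltnP j (size l); last by rewrite nth_default.
  exact: (all_nthP x Pl).
pose ok := fun x : nat => x < 32.
apply: (nth_ok _ ok) => //.
apply: (nth_ok _ (all ok)) => //.
exact: (nth_ok _ (all (all ok))).
Qed.

Lemma valid_elt D (K : kb D) p h t : p \in elt_sorts -> valid K p.1 (ccons h t) ->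
  valid K p.2 h /\ valid K p.1 t.
Proof.
rewrite !inE; do 5?[case/orP]; move/eqP-> => /= -[l].
1-3: by move=> [/enc_seq_eq_cons[x [l' [-> -> ->]]] H]; split;
  [exists x | exists l'] => //; split=> // *; apply: H; [left|right].
all: by move=> /enc_seq_eq_cons[x [l' [_ -> ->]]]; split; [exists x | exists l'].
Qed.

Lemma valid_arg D (K : kb D) so tag c i : so \in iota 0 20 -> valid K so (ccons tag c) ->
  valid K (arg_sort so tag i) (nthc c i).
Proof.
have codeE l : code l = ccons tag c -> l = tag :: decode c.
  by rewrite ccons_decode => /code_inj.
rewrite /nthc.
do 19?[rewrite inE => /orP[/eqP->|]]; last rewrite inE => /eqP->.
all: rewrite /arg_sort /= ?nth_nil //=.
all: case=> x; try case=> + _.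
all: try (case: x => > /=).
all: try match goal with b : bool |- _ => destruct b end.
all: by move=> /codeE[<- <-] /=; do 4?[case: i => [|i] /=]; rewrite ?nth_nil /=; eauto.
Qed.

Lemma ltn_chain_code R l R' : ccons R l < code [:: 2; R; l; R'].
Proof.
rewrite !code_cons; apply: ltn_trans (ltn_ccons2 2 _).
by apply: ltn_ccons_r; apply: ltn_ccons1.
Qed.

Section Occurrences.
Variables (D : datatype_map) (K : kb D) (Q : query D) (sg : subst D).

Let kk := enc_kb K.
Let qq := enc_query Q.
Let ss := enc_subst sg.
Let Z := (kk + qq + ss).+1.
Let W := occ Z kk qq ss.

Lemma nthc_kb0 : nthc kk 0 = enc_seq (@enc_rbox D) (rbox K).
Proof. exact: nthc_code. Qed.
Lemma nthc_kb1 : nthc kk 1 = enc_seq (@enc_tbox D) (tbox K).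
Proof. exact: nthc_code. Qed.
Lemma nthc_kb2 : nthc kk 2 = enc_seq (@enc_abox D) (abox K).
Proof. exact: nthc_code. Qed.
Lemma nthc_subst0 : nthc ss 0 = enc_map (@enc_ground D) (s_i sg).
Proof. exact: nthc_code. Qed.
Lemma nthc_subst1 : nthc ss 1 = enc_map id (s_c sg).
Proof. exact: nthc_code. Qed.
Lemma nthc_subst2 : nthc ss 2 = enc_map enc_arname (s_ar sg).
Proof. exact: nthc_code. Qed.
Lemma nthc_subst3 : nthc ss 3 = enc_map id (s_cr sg).
Proof. exact: nthc_code. Qed.

Lemma nthc_kb_lt i : nthc kk i < Z.
Proof. by rewrite /Z ltnS (leq_trans (nthc_le _ _)) //; lia. Qed.

Lemma nthc_subst_lt i : nthc ss i < Z.
Proof. by rewrite /Z ltnS (leq_trans (nthc_le _ _)) //; lia. Qed.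

Lemma enc_query_lt : qq < Z.
Proof. by rewrite /Z; lia. Qed.

Lemma occ_lt so c : W so c -> c < Z.
Proof. by case. Qed.

(** The valid codes below [Z] form a closed set, which [bits_of_pred] turns into a number; the least
    closed set is therefore contained in it. *)
Lemma occ_valid so c : so < 32 -> W so c -> valid K so c.
Proof.
move=> so32 [cZ H].
have [m [mZ mP]] := bits_of_pred (Z * 32) (fun i => valid K (i %% 32) (i %/ 32)).
have {}mP := bit_lt mZ mP.
have MP so' c' : so' < 32 -> (bit m (c' * 32 + so') <-> c' < Z /\ valid K so' c').
  move=> lt; rewrite mP divnMDl // modnMDl modn_small // divn_small // addn0.
  by split=> -[? ?]; split=> //; lia.
have {H} := H m mZ; rewrite MP // => -[] // {so so32 c cZ}.
split; first split.
- rewrite MP // nthc_kb_lt nthc_kb0; split=> //; by exists (rbox K).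
- rewrite !MP // !nthc_kb_lt nthc_subst_lt enc_query_lt nthc_kb1 nthc_kb2 nthc_subst0.
  by repeat split; eexists; eauto.
- split.
    move=> p pE h hZ t tZ; have [l1 l2] := elt_sorts_lt pE.
    by rewrite !MP // => -[_ /(valid_elt pE)[]].
  split.
    move=> x xZ c cZ; rewrite !MP // => -[_ /= [[y g]]].
    rewrite ccons_decode => /code_inj[_ cE].
    rewrite (leq_ltn_trans (nthc_le _ _)) //; split=> //.
    by exists g; rewrite /nthc -cE.
  split.
    move=> R RZ l lZ R' R'Z; rewrite !MP // => -[lt [s [+ _]]].
    case: s => > H; have {H} H := code_inj H; try discriminate H; case: H => eR el _; split.
      exact: ltn_trans (ltn_chain_code _ _ _) lt.
    by rewrite -eR -el -enc_seq_cons; eexists.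
  move=> so soE tag _ i _ _ c cZ.
  have so32 : so < 32 by move: soE; rewrite mem_iota; lia.
  rewrite !MP // ?arg_sort_lt // => -[_ /(valid_arg i soE)]; split=> //.
  exact: leq_ltn_trans (nthc_le _ _) cZ.
Qed.

(** Closedness passes to intersections; only the bound by [Z] needs an argument, namely that
    components do not exceed the code. *)
Lemma occ_closed : closed_codes Z kk qq ss W.
Proof.
split; [split; [|split; [|split; [|split]]]|split; [|split; [|split]]].
- by split=> [|m _ [[]]//]; exact: nthc_kb_lt.
- by split=> [|m _ [[_ []]]//]; exact: nthc_kb_lt.
- by split=> [|m _ [[_ [_ []]]]//]; exact: nthc_kb_lt.
- by split=> [|m _ [[_ [_ [_ []]]]]//]; exact: enc_query_lt.
- by split=> [|m _ [[_ [_ [_ []]]]]//]; exact: nthc_subst_lt.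
- move=> p pE h hZ t tZ [lt H]; split; split=> // m mZ cl;
    by have [_ [/(_ p pE h hZ t tZ (H m mZ cl))[]]] := cl.
- move=> x xZ c cZ [lt H]; split=> [|m mZ cl]; first exact: leq_ltn_trans (nthc_le _ _) cZ.
  by have [_ [_ [/(_ x xZ c cZ (H m mZ cl))]]] := cl.
- move=> R RZ l lZ R' R'Z [lt H]; split=> [|m mZ cl].
    exact: ltn_trans (ltn_chain_code _ _ _) lt.
  by have [_ [_ [_ [/(_ R RZ l lZ R' R'Z (H m mZ cl))]]]] := cl.
- move=> so soE tag tE i iE ne c cZ [lt H]; split=> [|m mZ cl].
    exact: leq_ltn_trans (nthc_le _ _) cZ.
  by have [_ [_ [_ [_ /(_ so soE tag tE i iE ne c cZ (H m mZ cl))]]]] := cl.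
Qed.

Lemma occ_elt p h t : p \in elt_sorts -> W p.1 (ccons h t) -> W p.2 h /\ W p.1 t.
Proof.
move=> pE H; have lt := occ_lt H; have [_ [+ _]] := occ_closed; apply=> //.
  by apply: leq_trans lt; apply: ltnW; apply: ltn_ccons1.
by apply: leq_trans lt; apply: ltnW; apply: ltn_ccons2.
Qed.

Lemma occ_arg so tag l i : W so (code (tag :: l)) -> so \in iota 0 20 ->
  tag \in iota 0 15 -> i \in iota 0 4 -> arg_sort so tag i != 31 ->
  W (arg_sort so tag i) (nth 0 l i).
Proof.
move=> H soE tE iE ne; have [_ [_ [_ [_ +]]]] := occ_closed.
rewrite -nthc_code; apply=> //; apply: leq_ltn_trans (occ_lt H).
by rewrite code_cons ltnW // ltn_ccons2.
Qed.

Lemma occ_chain R l R' : W 3 (code [:: 2; R; l; R']) -> W 12 (ccons R l).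
Proof.
move=> H; have lt := occ_lt H; have [_ [_ [_ [+ _]]]] := occ_closed.
have args x : x \in [:: 2; R; l; R'] -> x < Z.
  by move=> xl; apply: ltn_trans lt; apply: code_lt.
by apply; last exact: H; apply: args; rewrite !inE eqxx ?orbT.
Qed.

Lemma occ_list so so' T (enc : T -> nat) l x : (so, so') \in elt_sorts ->
  W so (enc_seq enc l) -> List.In x l -> W so' (enc x).
Proof.
move=> soE; elim: l => // y l IH; rewrite enc_seq_cons.
by case/(occ_elt soE) => Hy Hl [<-//|]; apply: IH.
Qed.

Lemma occ_rbox s : List.In s (rbox K) -> W 3 (enc_rbox s).
Proof.
have [[+ _] _] := occ_closed; rewrite nthc_kb0; exact: occ_list.
Qed.

Lemma occ_tbox s : List.In s (tbox K) -> W 4 (enc_tbox s).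
Proof.
have [[_ [+ _]] _] := occ_closed; rewrite nthc_kb1; exact: occ_list.
Qed.

Lemma occ_abox s : List.In s (abox K) -> W 5 (enc_abox s).
Proof.
have [[_ [_ [+ _]]] _] := occ_closed; rewrite nthc_kb2; exact: occ_list.
Qed.

Lemma occ_qatom l : List.In l Q -> W 15 (enc_qatom l.2).
Proof.
have [[_ [_ [_ [+ _]]]] _] := occ_closed => HQ lQ.
have := occ_list (so := 13) (so' := 14)
  (enc := fun l : bool * qatom D => code [:: l.1 : nat; enc_qatom l.2])
  isT HQ lQ.
by case: l {lQ} => -[] a H; have := occ_arg (i := 0) H isT isT isT isT.
Qed.

(** A constant may enter the query through the substitution alone; it still has to be among those
    about which the oracle is asked. *)
Lemma occ_subst_const x e : List.In (x, GConst e) (s_i sg) -> W 11 (enc_const e).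
Proof.
have [[_ [_ [_ [_]]]]] := occ_closed; rewrite nthc_subst0 => H [_ [Hx _]] xs.
have lt := occ_lt (occ_list (so := 17) (so' := 18) isT H xs).
have := Hx x _ (code [:: enc_ground (GConst e)]) _
  (occ_list (so := 17) (so' := 18) isT H xs).
rewrite nthc_code => H1.
have {H1} /H1 : x < Z by apply: ltn_trans lt; apply: code_lt; rewrite mem_head.
have l2 : code [:: enc_ground (GConst e)] < Z.
  by apply: ltn_trans lt; apply: ltn_ccons2.
move=> /(_ l2) H2.
by have := occ_arg (so := 19) (tag := 1) (l := [:: _]) (i := 0) H2 isT isT isT isT.
Qed.

End Occurrences.

(** * The constraints passed to the data type map *)

(** Order and multiplicity of the inserted elements are left open, since only membership matters for
    the meaning of a conjunction. This makes the nested iterations in [config] compositional. *)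
Definition adds T (enc : T -> nat) (f : nat -> nat) (S : T -> Prop) : Prop :=
  forall l0, exists l, f (enc_seq enc l0) = enc_seq enc l /\
    forall x, List.In x l <-> List.In x l0 \/ S x.

Lemma eq_adds T (enc : T -> nat) f (S S' : T -> Prop) :
  (forall x, S x <-> S' x) -> adds enc f S -> adds enc f S'.
Proof.
move=> SS H l0; have [l [e lP]] := H l0; exists l; split=> // x.
by rewrite lP SS.
Qed.

Lemma adds_cons T (enc : T -> nat) y x :
  y = enc x -> adds enc (ccons y) (fun z => x = z).
Proof.
move=> -> l0; exists (x :: l0); split=> // z; rewrite /=.
by split=> -[]; auto.
Qed.

Lemma adds_if T (enc : T -> nat) (P : Prop) f S : (P -> adds enc f S) ->
  adds enc (fun acc => if `[< P >] then f acc else acc) (fun x => P /\ S x).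
Proof.
move=> H l0; case: asboolP => [p|np].
  by have [l [e lP]] := H p l0; exists l; split=> // x; rewrite lP; tauto.
by exists l0; split=> // x; tauto.
Qed.

Lemma adds_comp T (enc : T -> nat) f g (S S' : T -> Prop) :
  adds enc f S -> adds enc g S' -> adds enc (fun a => f (g a)) (fun x => S' x \/ S x).
Proof.
move=> Hf Hg l0; have [l [e lP]] := Hg l0; have [l' [e' lP']] := Hf l.
by exists l'; split=> [|x]; rewrite ?e // lP' lP; tauto.
Qed.

Lemma adds_iteri T (enc : T -> nat) n (f : nat -> nat -> nat) (S : nat -> T -> Prop) :
  (forall i, i < n -> adds enc (f i) (S i)) ->
  adds enc (iteri n f) (fun x => exists i, i < n /\ S i x).
Proof.
elim: n => [_ l0|n IH H].
  by exists l0; split=> // x; split; [left|case=> // -[i []]].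
have {}IH := IH (fun i li => H i (leqW li)).
apply: eq_adds (adds_comp (H n (leqnn _)) IH) => x; split.
  by case=> [[i [li Si]]|Sn]; [exists i; split=> //; apply: leqW|exists n].
case=> i [+ Si]; rewrite ltnS leq_eqVlt => /predU1P[<-|li]; first by right.
by left; exists i.
Qed.

Section Config.
Variables (D : datatype_map) (X : Type) (emb : dval D -> X) (orac : nat -> Prop).

(** The data domain is a parameter so that a single point can serve when there are no data types;
    for [X = dval D] and the identity this is [dconj_satisfiable]. *)
Definition satisfiable_in (c : dconj D) : Prop :=
  exists rho : nat -> X,
    (forall p, List.In p (dc_range c) -> drange_sem emb p.2 (rho p.1)) /\
    (forall p, List.In p (dc_neq c) -> rho p.1 <> rho p.2).

Hypothesis oracP : forall c, orac (enc_dconj c) <-> satisfiable_in c.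

Variables (Z : nat) (W : nat -> nat -> Prop).
Hypothesis W10 : forall r, W 10 r -> exists r', @enc_drange D r' = r.
Hypothesis W11 : forall e, W 11 e -> exists e', @enc_const D e' = e.
Hypothesis W_lt : forall so c, W so c -> c < Z.

Lemma config_enc n A B : exists c : dconj D,
  [/\ config Z W n A B = enc_dconj c,
      forall p, List.In p (dc_range c) <-> p.1 < n /\
        ((exists r, W 10 (enc_drange r) /\
            (A (enc_drange r) p.1 /\ p.2 = r \/
             ~ A (enc_drange r) p.1 /\ p.2 = DRNot r)) \/
         (exists e, W 11 (enc_const e) /\
            (B (enc_const e) p.1 /\ p.2 = DRConsts [:: e] \/
             ~ B (enc_const e) p.1 /\ p.2 = DRNot (DRConsts [:: e]))))
    & forall p, List.In p (dc_neq c) <-> p.1 < p.2 < n].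
Proof.
pose enc1 := fun p : nat * drange D => code [:: p.1; enc_drange p.2].
pose enc2 := fun p : nat * nat => code [:: p.1; p.2].
have Ha j : adds enc1 (fun acc =>
    iteri Z (fun r acc =>
      if `[< W 10 r >] then
        ccons (code [:: j; if `[< A r j >] then r else code [:: 2; r]]) acc
      else acc) acc)
    (fun p => p.1 = j /\ exists r, W 10 (enc_drange r) /\
            (A (enc_drange r) p.1 /\ p.2 = r \/
             ~ A (enc_drange r) p.1 /\ p.2 = DRNot r)).
  apply: (@eq_adds _ _ _ (fun p => exists r, r < Z /\ (W 10 r /\
      enc1 p = code [:: j; if `[< A r j >] then r else code [:: 2; r]]))).
    case=> i q; split=> /=.
      case=> r [_ [Wr /code_inj[-> e]]]; split=> //.
      have [r' er] := W10 Wr; subst r; exists r'; split=> //.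
      move: e; case: asboolP => a e; [left|right]; split=> //.
        exact: enc_drange_inj.
      exact: (enc_drange_inj (x2 := DRNot r')).
    case=> -> [r [Wr H]]; exists (enc_drange r); split; first exact: W_lt Wr.
    split=> //; rewrite /enc1 /=.
    by case: H => -[a ->]; case: asboolP.
  apply: adds_iteri => r _; apply: adds_if => Wr.
  have [r' er] := W10 Wr.
  pose q := (j, if `[< A r j >] then r' else DRNot r').
  have eq : code [:: j; if `[< A r j >] then r else code [:: 2; r]] = enc1 q.
    by rewrite /q /enc1 /=; case: asboolP; rewrite -er.
  apply: eq_adds (adds_cons eq) => p; rewrite eq; split=> [->//|].
  by case: p => i p /code_inj[e1 /enc_drange_inj e2]; rewrite (surjective_pairing q) e1 e2.
have Hb j : adds enc1 (fun acc =>
    iteri Z (fun e acc =>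
      if `[< W 11 e >] then
        ccons (code [:: j; if `[< B e j >] then code [:: 0; code [:: e]]
                               else code [:: 2; code [:: 0; code [:: e]]]]) acc
      else acc) acc)
    (fun p => p.1 = j /\ exists e, W 11 (enc_const e) /\
            (B (enc_const e) p.1 /\ p.2 = DRConsts [:: e] \/
             ~ B (enc_const e) p.1 /\ p.2 = DRNot (DRConsts [:: e]))).
  apply: (@eq_adds _ _ _ (fun p => exists e, e < Z /\ (W 11 e /\
      enc1 p = code [:: j; if `[< B e j >] then code [:: 0; code [:: e]]
                               else code [:: 2; code [:: 0; code [:: e]]]]))).
    case=> i q; split=> /=.
      case=> r [_ [Wr /code_inj[-> e]]]; split=> //.
      have [r' er] := W11 Wr; subst r; exists r'; split=> //.
      move: e; case: asboolP => a e; [left|right]; split=> //.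
        exact: (enc_drange_inj (x2 := DRConsts [:: r'])).
      exact: (enc_drange_inj (x2 := DRNot (DRConsts [:: r']))).
    case=> -> [r [Wr H]]; exists (enc_const r); split; first exact: W_lt Wr.
    split=> //; rewrite /enc1 /=.
    by case: H => -[a ->]; case: asboolP.
  apply: adds_iteri => r _; apply: adds_if => Wr.
  have [r' er] := W11 Wr.
  pose q := (j, if `[< B r j >] then DRConsts [:: r'] else DRNot (DRConsts [:: r'])).
  have eq : code [:: j; if `[< B r j >] then code [:: 0; code [:: r]]
                               else code [:: 2; code [:: 0; code [:: r]]]] = enc1 q.
    by rewrite /q /enc1 /=; case: asboolP; rewrite -er.
  apply: eq_adds (adds_cons eq) => p; rewrite eq; split=> [->//|].
  by case: p => i p /code_inj[e1 /enc_drange_inj e2]; rewrite (surjective_pairing q) e1 e2.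
have [l [el lP]] := adds_iteri (fun j (_ : j < n) => adds_comp (Ha j) (Hb j)) [::].
have Hn j : adds enc2 (fun acc => iteri j (fun i acc => ccons (code [:: i; j]) acc) acc)
    (fun p => p.1 < p.2 /\ p.2 = j).
  have H i (_ : i < j) : adds enc2 (fun acc => ccons (code [:: i; j]) acc) (fun p => (i, j) = p).
    exact: adds_cons.
  apply: eq_adds (adds_iteri H) => -[a b]; split=> [[i [li [<- <-]]]//|[/= lt <-]].
  by exists a.
have [l' [el' lP']] := adds_iteri (fun j (_ : j < n) => Hn j) [::].
exists (DConj l l'); split.
- by rewrite /config el el'.
- case=> i p; rewrite /= lP; split.
    by case=> // -[j [lj [] [/= ij H]]]; subst j; split=> //; [right|left].
  by case=> li [] H; right; exists i; split=> //; [right|left].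
- case=> i j; rewrite /= lP'; split.
    by case=> // -[j' [lj [/= lt jj]]]; subst j'; rewrite lt.
  by case/andP=> lt lj; right; exists j.
Qed.

Lemma drange_sem_consts1 e (x : X) :
  drange_sem emb (DRConsts [:: e]) x <-> x = emb (cval e).
Proof. by split=> [[e' [<-|//]]|-> /=]; [|exists e; [left|]]. Qed.

(** Every occurring range and constant is either asserted or denied at each index, which turns a
    mere conjunction of constraints into an exact prescription. *)
Lemma config_spec n A B : orac (config Z W n A B) <->
  exists rho : nat -> X,
    (forall j, j < n -> forall r, W 10 (enc_drange r) ->
       (drange_sem emb r (rho j) <-> A (enc_drange r) j)) /\
    (forall j, j < n -> forall e, W 11 (enc_const e) ->
       (rho j = emb (cval e) <-> B (enc_const e) j)) /\
    (forall i j, i < j -> j < n -> rho i <> rho j).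
Proof.
have [c [-> cr cn]] := config_enc n A B; rewrite oracP; split.
  case=> rho [Hr Hn]; exists rho; split; [|split].
  - move=> j jn r Wr; have [a|na] := pselect (A (enc_drange r) j).
      have /Hr : List.In (j, r) (dc_range c) by apply/cr; split=> //; left; exists r; auto.
      by [].
    have /Hr : List.In (j, DRNot r) (dc_range c).
      by apply/cr; split=> //; left; exists r; auto.
    by [].
  - move=> j jn e We; rewrite -drange_sem_consts1.
    have [a|na] := pselect (B (enc_const e) j).
      have /Hr // : List.In (j, DRConsts [:: e]) (dc_range c).
      by apply/cr; split=> //; right; exists e; auto.
    have /Hr // : List.In (j, DRNot (DRConsts [:: e])) (dc_range c).
    by apply/cr; split=> //; right; exists e; auto.
  - by move=> i j ij jn; apply: (Hn (i, j)); apply/cn; rewrite /= ij.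
case=> rho [Hr [He Hn]]; exists rho; split; last first.
  by case=> i j /cn /andP[ij jn]; apply: Hn.
case=> j p /cr[/= jn []] [r [Wr]].
- by case=> -[a ->]; [|move=> /=]; rewrite Hr.
- rewrite -He // -drange_sem_consts1.
  by case=> -[a ->].
Qed.

End Config.

(** * Counting *)

Lemma cnt_card n (P : nat -> Prop) : cnt n P = #|[set i : 'I_n | `[< P i >]]|.
Proof. by rewrite -sum1_card big_mkcond; apply: eq_bigr => i _; rewrite inE; case: asboolP. Qed.

Lemma cnt_sub n (P P' : nat -> Prop) :
  (forall i, i < n -> P i -> P' i) -> cnt n P <= cnt n P'.
Proof.
move=> PP; rewrite !cnt_card; apply/subset_leq_card/subsetP => i.
by rewrite !inE => /asboolP Pi; apply/asboolP/PP.
Qed.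

Lemma at_least_cnt n T (A : T -> Prop) (tau : T -> nat) L (P : nat -> Prop) :
  (forall t, A t -> tau t < L /\ P (tau t)) ->
  (forall t t', A t -> A t' -> tau t = tau t' -> t = t') ->
  at_least n A -> n <= cnt L P.
Proof.
move=> AP tinj [f finj fA]; rewrite cnt_card.
have tl i : tau (f i) < L by case: (AP _ (fA i)).
pose g i := Ordinal (tl i).
have ginj : injective g by move=> i j [/(tinj _ _ (fA i) (fA j))/finj].
rewrite -[X in X <= _](card_ord n) -(card_imset _ ginj).
apply/subset_leq_card/subsetP => _ /imsetP[i _ ->].
by rewrite inE; apply/asboolP; case: (AP _ (fA i)).
Qed.

Lemma cnt_at_least n L (P : nat -> Prop) :
  n <= cnt L P -> at_least n (fun i : 'I_L => P i).
Proof.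
rewrite cnt_card => le; exists (fun i => enum_val (widen_ord le i)).
  by move=> i j /enum_val_inj[]/val_inj.
by move=> i; have := enum_valP (widen_ord le i); rewrite inE => /asboolP.
Qed.

Lemma at_least_map n T U (A : T -> Prop) (B : U -> Prop) (f : T -> U) :
  injective f -> (forall t, A t -> B (f t)) -> at_least n A -> at_least n B.
Proof. by move=> fi AB [g gi gA]; exists (f \o g) => [|i]; [apply: inj_comp|apply: AB]. Qed.

Lemma at_least2 T (A : T -> Prop) x y : A x -> A y -> x <> y -> at_least 2 A.
Proof.
move=> Ax Ay xy; exists (fun i : 'I_2 => if i == ord0 then x else y).
  move=> i j; case: (i =P ord0) => [->|/eqP i0]; case: (j =P ord0) => [->|/eqP j0] // e.
    by case: xy.
  by apply/val_inj; move: i j i0 j0 {e} => [[|[]]] // ? [[|[]]].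
by move=> i; case: ifP.
Qed.

(** * Lookup in coded substitutions *)

Lemma memc_map T (enc : T -> nat) (s : seq (nat * T)) x c :
  memc (code [:: x; c]) (enc_map enc s) <-> exists v, List.In (x, v) s /\ enc v = c.
Proof.
rewrite /memc CodeSeq.codeK; elim: s => [|[y v] s IH] /=; first by split=> // -[v []].
rewrite inE; split.
  case/orP=> [/eqP/code_inj[-> ->]|/IH[v' []]]; first by exists v; split=> //; left.
  by exists v'; split=> //; right.
case=> v' [[[-> ->]|H] ev]; first by rewrite ev eqxx.
by apply/orP; right; apply/IH; exists v'.
Qed.

Lemma memc_lt x c : memc x c -> x < c.
Proof. by rewrite -{2}(CodeSeq.decodeK c); apply: code_lt. Qed.

Lemma lookupP T (s : seq (nat * T)) x v : uniq (unzip1 s) ->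
  lookup s x = Some v <-> List.In (x, v) s.
Proof.
elim: s => //= -[y w] s IH /= /andP[ys us]; case: eqVneq => [->|xy].
  split=> [[->]|[[->]//|ins]]; first by left.
  suff : y \in unzip1 s by rewrite (negPf ys).
  elim: s ins {IH ys us} => //= -[z w'] s IH [[-> _]|/IH]; rewrite inE ?eqxx //.
  by move=> ->; rewrite orbT.
rewrite IH //; split; first by right.
by case=> // -[e _]; rewrite e eqxx in xy.
Qed.

Section SubstValues.
Variables (D : datatype_map) (sg : subst D) (Z : nat).
Hypothesis usg : uniq (unzip1 (s_i sg)).

Let si := enc_map (@enc_ground D) (s_i sg).

Lemma wval_subst w c : wval Z si (enc_wterm w) c ->
  exists g, wsubst sg w = Some g /\ enc_ground g = c.
Proof.
case: w => [x|a] [] [y [_ [/code_inj // [<-]]]].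
  by case/memc_map=> g [/lookupP-/(_ usg) e <-]; exists g.
by move=> ->; exists (GInd a).
Qed.

Lemma uval_subst u c : uval Z si (enc_uterm u) c ->
  exists g, usubst sg u = Some g /\ enc_ground g = c.
Proof.
case: u => [x|a] [] [y [_ [/code_inj // [<-]]]].
  by case/memc_map=> g [/lookupP-/(_ usg) e <-]; exists g.
by move=> ->; exists (GConst a).
Qed.

Lemma subst_wval w g : (enc_wterm w < Z) -> wsubst sg w = Some g ->
  wval Z si (enc_wterm w) (enc_ground g).
Proof.
case: w => [x|a] /= lt.
  move/(lookupP _ _ usg) => xg; left; exists x; split.
    by apply: ltn_trans lt; apply: code_lt; rewrite !inE eqxx orbT.
  by split=> //; apply/memc_map; exists g.
case=> <-; right; exists a; split=> //.
by apply: ltn_trans lt; apply: code_lt; rewrite !inE eqxx orbT.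
Qed.

Lemma subst_uval u g : (enc_uterm u < Z) -> usubst sg u = Some g ->
  uval Z si (enc_uterm u) (enc_ground g).
Proof.
case: u => [x|a] /= lt.
  move/(lookupP _ _ usg) => xg; left; exists x; split.
    by apply: ltn_trans lt; apply: code_lt; rewrite !inE eqxx orbT.
  by split=> //; apply/memc_map; exists g.
case=> <-; right; exists (enc_const a); split=> //.
by apply: ltn_trans lt; apply: code_lt; rewrite !inE eqxx orbT.
Qed.

Lemma enc_ground_ind (g : ground D) i : enc_ground g = code [:: 0; i] -> g = GInd i.
Proof. by case: g => [a|e] /code_inj // [->]. Qed.

Lemma enc_ground_const (g : ground D) c : enc_ground g = code [:: 1; c] ->
  exists e, g = GConst e /\ c = enc_const e.
Proof. by case: g => [a|e] /code_inj // [<-]; exists e. Qed.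

End SubstValues.

(** Definedness of the replacement and truth of the literal are required together, literal by
    literal, as [query_rules] checks them. *)
Definition query_sat D (I : interp D) (Q : query D) (sg : subst D) : Prop :=
  forall l, List.In l Q -> exists g, asubst sg l.2 = Some g /\
    (gatom_sat I g <-> l.1).

(** * From coded models to interpretations *)

Section Soundness.
Variables (D : datatype_map) (X : Type) (x0 : X) (emb : dval D -> X).
Hypothesis emb_inj : injective emb.
Variable orac : nat -> Prop.
Hypothesis oracP : forall c, orac (enc_dconj c) <-> satisfiable_in emb c.
Variables (K : kb D) (Q : query D) (sg : subst D).
Hypothesis usg : [/\ uniq (unzip1 (s_i sg)), uniq (unzip1 (s_c sg)),
  uniq (unzip1 (s_ar sg)) & uniq (unzip1 (s_cr sg))].

Let kk := enc_kb K.
Let qq := enc_query Q.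
Let ss := enc_subst sg.
Let Z := (kk + qq + ss).+1.
Let W := occ Z kk qq ss.

Variables (k' L : nat) (V : nat -> nat -> nat -> nat -> Prop).
Let k := k'.+1.
Hypothesis kZ : k <= Z.
Hypothesis rules : model_rules Z k L W V orac qq ss.

Lemma occ_arg_lt so l x : W so (code l) -> x \in l -> x < Z.
Proof. by move=> H xl; apply: ltn_trans (occ_lt H); apply: code_lt. Qed.

Lemma occ_drange_valid r : W 10 r -> exists r', @enc_drange D r' = r.
Proof. exact: (@occ_valid D K Q sg 10). Qed.

Lemma occ_const_valid e : W 11 e -> exists e', @enc_const D e' = e.
Proof. exact: (@occ_valid D K Q sg 11). Qed.

(** [rho] is the solution granted by the oracle for the [L] representatives, and [tau] sends a value
    to the index whose behaviour it copies. A value outside the range of [rho] extends [rho] to a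
    solution of the larger configuration; this refutes the second alternative of [data_rules], and
    the first provides an index whose type has [Z] representatives. *)
Lemma representatives : exists (rho : nat -> X) (tau : X -> nat),
  [/\ forall v, tau v < L,
      forall v r, W 10 (enc_drange r) ->
        (drange_sem emb r v <-> V 10 (enc_drange r) 0 (tau v)),
      forall v e, W 11 (enc_const e) ->
        (v = emb (cval e) <-> V 11 (enc_const e) 0 (tau v)),
      forall j e, j < L -> W 11 (enc_const e) ->
        (V 11 (enc_const e) 0 j <-> rho j = emb (cval e))
    & (forall i j, i < L -> j < L -> rho i = rho j -> i = j) /\
      forall v, v = rho (tau v) \/ Z <= cnt L (same_type Z V (tau v))].
Proof.
have [_ [_ [_ [Hc Hs]]]] := rules.
have cspec := config_spec oracP occ_drange_valid occ_const_valid (@occ_lt D K Q sg).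
have [rho [Hr [He Hn]]] := (cspec _ _ _).1 Hc.
have rinj i j : i < L -> j < L -> rho i = rho j -> i = j.
  by move=> iL jL e; case: (ltngtP i j) => // /Hn; [move/(_ jL)|move/(_ iL)]; case.
have tauP v : exists j, j < L /\
  [/\ forall r, W 10 (enc_drange r) -> (drange_sem emb r v <-> V 10 (enc_drange r) 0 j),
      forall e, W 11 (enc_const e) -> (v = emb (cval e) <-> V 11 (enc_const e) 0 j)
    & v = rho j \/ Z <= cnt L (same_type Z V j)].
  have [[j [jL vE]]|nv] := pselect (exists j, j < L /\ v = rho j).
    by exists j; split=> //; split=> [r Wr|e We|]; [rewrite vE Hr|rewrite vE He|left].
  (* The sets of data ranges and of constants true at [v] select the instance of the data rule. *)
  have [u [uZ uP]] := bits_of_pred Z (fun c => exists r, enc_drange r = c /\ drange_sem emb r v).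
  have [w [wZ wP]] := bits_of_pred Z (fun c => exists e, enc_const e = c /\ v = emb (cval e)).
  have uE r : W 10 (enc_drange r) -> (bit u (enc_drange r) <-> drange_sem emb r v).
    move=> Wr; rewrite uP ?(occ_lt Wr) //.
    by split=> [[r' [/enc_drange_inj->]]|] //; exists r.
  have wE e : W 11 (enc_const e) -> (bit w (enc_const e) <-> v = emb (cval e)).
    move=> We; rewrite wP ?(occ_lt We) //.
    by split=> [[e' [/enc_const_inj->]]|] //; exists e.
  case: (Hs u uZ w wZ) => [[j [jL [Hu [Hw sat]]]]|[]].
    exists j; split=> //; split=> [r Wr|e We|]; last by right.
    - by rewrite -uE // Hu // (occ_lt Wr).
    - by rewrite -wE // Hw // (occ_lt We).
  (* The forbidden solution: [rho] with [v] at the new index [L]. *)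
  apply/cspec; exists (fun j => if j == L then v else rho j); split; [|split].
  - move=> j; rewrite ltnS => jL r Wr; case: eqP => [->|/eqP neq].
      by rewrite -uE //; split; [right|case=> [[]|[]//]; rewrite ltnn].
    have {}jL : j < L by rewrite ltn_neqAle neq.
    by rewrite Hr //; split; [left|case=> [[]//|[e]]; rewrite e ltnn in jL].
  - move=> j; rewrite ltnS => jL r Wr; case: eqP => [->|/eqP neq].
      by rewrite -wE //; split; [right|case=> [[]|[]//]; rewrite ltnn].
    have {}jL : j < L by rewrite ltn_neqAle neq.
    by rewrite He //; split; [left|case=> [[]//|[e]]; rewrite e ltnn in jL].
  - move=> i j ij; rewrite ltnS => jL; have iL := leq_trans ij jL.
    rewrite (ltn_eqF iL); case: eqP => [_ e|/eqP neq]; first by apply: nv; exists i.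
    by apply: Hn => //; rewrite ltn_neqAle neq.
have [tau {}tauP] := choice tauP; exists rho, tau; split=> //.
- by move=> v; case: (tauP v).
- by move=> v r Wr; case: (tauP v) => _ [H _ _]; apply: H.
- by move=> v e We; case: (tauP v) => _ [_ H _]; apply: H.
- by move=> j e jL We; rewrite He.
- by split=> // v; case: (tauP v) => _ [].
Qed.

(** * The interpretation defined by a coded model *)

Section Model.
Variables (rho : nat -> X) (tau : X -> nat).
Hypothesis tau_lt : forall v, tau v < L.
Hypothesis tau_drange : forall v r, W 10 (enc_drange r) ->
  (drange_sem emb r v <-> V 10 (enc_drange r) 0 (tau v)).
Hypothesis tau_const : forall v e, W 11 (enc_const e) ->
  (v = emb (cval e) <-> V 11 (enc_const e) 0 (tau v)).
Hypothesis rho_const : forall j e, j < L -> W 11 (enc_const e) ->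
  (V 11 (enc_const e) 0 j <-> rho j = emb (cval e)).
Hypothesis rho_inj : forall i j, i < L -> j < L -> rho i = rho j -> i = j.
Hypothesis tau_sat :
  forall v, v = rho (tau v) \/ Z <= cnt L (same_type Z V (tau v)).

(** The rules are silent about names from [Z] on; for those any value will do, such as the
    default. *)
Definition ind_of (a : nat) : 'I_k := odflt ord0 [pick x : 'I_k | `[< V 13 a x 0 >]].

(** Concrete roles are read through [tau], so a value inherits the behaviour of its representative,
    while the data types keep their true interpretation. Role names are shifted by one because 0
    codes the universal role. *)
Definition the_model : interp D :=
  @Interp D 'I_k X (inhabits ord0) (inhabits x0) emb emb_inj ind_of
    (fun A x => V 6 (code [:: 0; A]) x 0)
    (fun n x y => V 7 (code [:: 0; n.+1]) x y)
    (fun T x v => V 8 (code [:: 0; T]) x (tau v)).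

Lemma ind_ofP a (x : nat) : a < Z -> x < k -> (V 13 a x 0 <-> x = ind_of a).
Proof.
move=> aZ xk; have [_ [[/(_ a aZ)[y [yk [Vy uy]]] _] _]] := rules.
rewrite /ind_of; case: pickP => [z /asboolP Vz|/(_ (Ordinal yk))/asboolP//] /=.
split=> [Vx|->//].
by rewrite (uy x xk Vx) (uy z (ltn_ord z) Vz).
Qed.

Lemma ind_of_V a : a < Z -> V 13 a (ind_of a) 0.
Proof. by move=> aZ; apply/ind_ofP => //; apply: ltn_ord. Qed.

(** The value of a constant is never represented by imitation: its index under [tau] satisfies the
    constant, so [rho] takes that very value there, and [rho] is injective. *)
Lemma const_rep j e : j < L -> W 11 (enc_const e) ->
  (V 11 (enc_const e) 0 j <-> j = tau (emb (cval e))).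
Proof.
move=> jL We; have Ve := (tau_const (emb (cval e)) We).1 erefl.
split=> [/(rho_const jL We) e1|->//]; apply: rho_inj => //.
by rewrite e1; move/(rho_const (tau_lt _) We): Ve.
Qed.

Ltac bounds H := repeat match goal with
  | |- is_true (leq (S (nat_of_ord _)) _) => apply ltn_ord
  | |- is_true (leq (S (tau _)) _) => apply tau_lt
  | |- is_true (leq _ Z) => apply (occ_arg_lt H); rewrite !inE !eqxx ?orbT; reflexivity
  | |- W _ _ => exact H
  end.

Lemma dterm_semE t v : W 9 (enc_dterm t) ->
  (dterm_sem (I := the_model) t v <-> V 9 (enc_dterm t) 0 (tau v)).
Proof.
have [[_ [_ [_ [[r0 [r1 [r2 [r3 r4]]]] _]]]] _] := rules.
elim: t => [r|t IH|t IHt u IHu|t IHt u IHu|e] /= H.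
- have Wr : W 10 (enc_drange r) := occ_arg (i := 0) H isT isT isT isT.
  by rewrite r0; bounds H; apply: tau_drange.
- have Wt : W 9 (enc_dterm t) := occ_arg (i := 0) H isT isT isT isT.
  by rewrite r1; bounds H; rewrite IH.
- have Wt : W 9 (enc_dterm t) := occ_arg (i := 0) H isT isT isT isT.
  have Wu : W 9 (enc_dterm u) := occ_arg (i := 1) H isT isT isT isT.
  by rewrite r2; bounds H; rewrite IHt // IHu.
- have Wt : W 9 (enc_dterm t) := occ_arg (i := 0) H isT isT isT isT.
  have Wu : W 9 (enc_dterm u) := occ_arg (i := 1) H isT isT isT isT.
  by rewrite r3; bounds H; rewrite IHt // IHu.
- have We : W 11 (enc_const e) := occ_arg (i := 0) H isT isT isT isT.
  by rewrite r4; bounds H; apply: tau_const.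
Qed.

(** The truth lemma for Hintikka sets. Occurrence in the input passes to subterms, so the local
    rules are available all along the mutual induction. *)
Lemma term_semE :
  (forall C, W 6 (enc_concept C) -> forall x : 'I_k,
     (concept_sem (I := the_model) C x <-> V 6 (enc_concept C) x 0)) /\
  (forall R, W 7 (enc_arole R) -> forall x y : 'I_k,
     (arole_sem (I := the_model) R x y <-> V 7 (enc_arole R) x y)) /\
  (forall P, W 8 (enc_crole P) -> forall (x : 'I_k) v,
     (crole_sem (I := the_model) P x v <-> V 8 (enc_crole P) x (tau v))).
Proof.
have [[[c1 [c2 [c3 [c4 [c5 [c6 [c7 [c8 c9]]]]]]]]
  [[a0 [a1 [a2 [a3 [a4 [a5 [a6 [a7 [a8 a9]]]]]]]]]
  [[p1 [p2 [p3 [p4 [p5 p6]]]]] _]]] _] := rules.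
apply: concept_arole_crole_ind => /=.
- by [].
- by move=> H x; split=> // _; apply: c1; bounds H.
- by move=> H x; split=> // Vx; case: (c2 H x (ltn_ord x)).
- move=> C IH H x.
  have WC : W 6 (enc_concept C) := occ_arg (i := 0) H isT isT isT isT.
  by rewrite c3; bounds H; rewrite IH.
- move=> C IHC C' IHC' H x.
  have WC : W 6 (enc_concept C) := occ_arg (i := 0) H isT isT isT isT.
  have WC' : W 6 (enc_concept C') := occ_arg (i := 1) H isT isT isT isT.
  by rewrite c4; bounds H; rewrite IHC // IHC'.
- move=> C IHC C' IHC' H x.
  have WC : W 6 (enc_concept C) := occ_arg (i := 0) H isT isT isT isT.
  have WC' : W 6 (enc_concept C') := occ_arg (i := 1) H isT isT isT isT.
  by rewrite c5; bounds H; rewrite IHC // IHC'.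
- move=> a H x; have aZ : a < Z by bounds H.
  by rewrite c6; bounds H; rewrite ind_ofP; bounds H; split=> [->//|/val_inj].
- move=> R IH H x.
  have WR : W 7 (enc_arole R) := occ_arg (i := 0) H isT isT isT isT.
  by rewrite c7; bounds H; rewrite IH.
- move=> R IH a H x; have aZ : a < Z by bounds H.
  have WR : W 7 (enc_arole R) := occ_arg (i := 0) H isT isT isT isT.
  rewrite c8; bounds H; rewrite IH //; split.
    by move=> Vx; exists (ind_of a); split=> //; split=> //; apply: ind_of_V.
  by case=> y [yk [/(ind_ofP aZ yk) ->]].
- move=> P IH e H x.
  have WP : W 8 (enc_crole P) := occ_arg (i := 0) H isT isT isT isT.
  have We : W 11 (enc_const e) := occ_arg (i := 1) H isT isT isT isT.
  rewrite c9; bounds H; rewrite IH //; split.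
    move=> Vx; exists (tau (emb (cval e))); split; first exact: tau_lt.
    by split=> //; apply/const_rep => //; apply: tau_lt.
  by case=> j [jL [/(const_rep jL We) ->]].
- case=> [|n] H x y /=; last by [].
  by split=> // _; apply: a0; bounds H.
- move=> R IH H x y.
  have WR : W 7 (enc_arole R) := occ_arg (i := 0) H isT isT isT isT.
  by rewrite a1; bounds H; rewrite IH.
- move=> R IH H x y.
  have WR : W 7 (enc_arole R) := occ_arg (i := 0) H isT isT isT isT.
  by rewrite a2; bounds H; rewrite IH.
- move=> R IHR R' IHR' H x y.
  have WR : W 7 (enc_arole R) := occ_arg (i := 0) H isT isT isT isT.
  have WR' : W 7 (enc_arole R') := occ_arg (i := 1) H isT isT isT isT.
  by rewrite a3; bounds H; rewrite IHR // IHR'.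
- move=> R IHR R' IHR' H x y.
  have WR : W 7 (enc_arole R) := occ_arg (i := 0) H isT isT isT isT.
  have WR' : W 7 (enc_arole R') := occ_arg (i := 1) H isT isT isT isT.
  by rewrite a4; bounds H; rewrite IHR // IHR'.
- move=> R IHR C IHC H x y.
  have WR : W 7 (enc_arole R) := occ_arg (i := 0) H isT isT isT isT.
  have WC : W 6 (enc_concept C) := occ_arg (i := 1) H isT isT isT isT.
  by rewrite a5; bounds H; rewrite IHR // IHC.
- move=> R IHR C IHC H x y.
  have WR : W 7 (enc_arole R) := occ_arg (i := 0) H isT isT isT isT.
  have WC : W 6 (enc_concept C) := occ_arg (i := 1) H isT isT isT isT.
  by rewrite a6; bounds H; rewrite IHR // IHC.
- move=> R IHR C IHC C' IHC' H x y.
  have WR : W 7 (enc_arole R) := occ_arg (i := 0) H isT isT isT isT.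
  have WC : W 6 (enc_concept C) := occ_arg (i := 1) H isT isT isT isT.
  have WC' : W 6 (enc_concept C') := occ_arg (i := 2) H isT isT isT isT.
  rewrite a7; bounds H; rewrite -IHR // -IHC // -IHC' //.
  by split=> [[]|[? []]].
- move=> C IHC H x y.
  have WC : W 6 (enc_concept C) := occ_arg (i := 0) H isT isT isT isT.
  rewrite a8; bounds H; rewrite IHC //.
  by split=> -[e Cx]; split=> //; [rewrite e|apply: val_inj].
- move=> C IHC C' IHC' H x y.
  have WC : W 6 (enc_concept C) := occ_arg (i := 0) H isT isT isT isT.
  have WC' : W 6 (enc_concept C') := occ_arg (i := 1) H isT isT isT isT.
  by rewrite a9; bounds H; rewrite IHC // IHC'.
- by [].
- move=> P IH H x v.
  have WP : W 8 (enc_crole P) := occ_arg (i := 0) H isT isT isT isT.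
  by rewrite p1; bounds H; rewrite IH.
- move=> P IHP P' IHP' H x v.
  have WP : W 8 (enc_crole P) := occ_arg (i := 0) H isT isT isT isT.
  have WP' : W 8 (enc_crole P') := occ_arg (i := 1) H isT isT isT isT.
  by rewrite p2; bounds H; rewrite IHP // IHP'.
- move=> P IHP P' IHP' H x v.
  have WP : W 8 (enc_crole P) := occ_arg (i := 0) H isT isT isT isT.
  have WP' : W 8 (enc_crole P') := occ_arg (i := 1) H isT isT isT isT.
  by rewrite p3; bounds H; rewrite IHP // IHP'.
- move=> P IHP C IHC H x v.
  have WP : W 8 (enc_crole P) := occ_arg (i := 0) H isT isT isT isT.
  have WC : W 6 (enc_concept C) := occ_arg (i := 1) H isT isT isT isT.
  by rewrite p4; bounds H; rewrite IHP // IHC.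
- move=> P IHP t H x v.
  have WP : W 8 (enc_crole P) := occ_arg (i := 0) H isT isT isT isT.
  have Wt : W 9 (enc_dterm t) := occ_arg (i := 1) H isT isT isT isT.
  by rewrite p5; bounds H; rewrite IHP // dterm_semE.
- move=> P IHP C IHC t H x v.
  have WP : W 8 (enc_crole P) := occ_arg (i := 0) H isT isT isT isT.
  have WC : W 6 (enc_concept C) := occ_arg (i := 1) H isT isT isT isT.
  have Wt : W 9 (enc_dterm t) := occ_arg (i := 2) H isT isT isT isT.
  rewrite p6; bounds H; rewrite -IHP // -IHC // -dterm_semE //.
  by split=> [[]|[? []]].
Qed.

Lemma chain_semE R l : W 12 (enc_seq (@enc_arole D) (R :: l)) -> forall x y : 'I_k,
  (chain_sem (I := the_model) R l x y <-> V 12 (enc_seq (@enc_arole D) (R :: l)) x y).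
Proof.
have [[_ [_ [_ [_ [r0 r1]]]]] _] := rules; have [_ [semR _]] := term_semE.
elim: l R => [|R' l IH] R H x y /=.
  have [WR _] : W 7 (enc_arole R) /\ W 12 0 := occ_elt (p := (12, 7)) isT H.
  by rewrite [enc_seq _ _](_ : _ = ccons (enc_arole R) 0) // r0; bounds H; rewrite ?semR //;
     exact: (occ_lt WR).
have [WR Wl] := occ_elt (p := (12, 7)) isT H.
have [/= WR' Wl'] := occ_elt (p := (12, 7)) isT Wl.
rewrite !enc_seq_cons r1; try apply: ltn_ord; try exact: occ_lt WR; try exact: occ_lt WR';
  try exact: occ_lt Wl'; last exact: H.
split.
  case=> z; rewrite semR // IH // => Rz Hl.
  by exists (val z); split; [apply: ltn_ord|split].
case=> z [zk [Rz Hl]]; exists (Ordinal zk); first by rewrite semR.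
by rewrite IH.
Qed.

(** If some member of [A] merely imitates its representative, the type of that representative has
    [Z] indices, all of them in [P], and [n] is at most [Z]. Otherwise all members of [A] represent
    themselves and [tau] is injective on [A]. *)
Lemma at_least_data n (A : X -> Prop) (P : nat -> Prop) : n <= Z ->
  (forall v, A v -> P (tau v)) ->
  (forall i j, j < L -> P i -> same_type Z V i j -> P j) ->
  at_least n A -> n <= cnt L P.
Proof.
move=> nZ AP Psame al.
have [[v [Av nv]]|H] := pselect (exists v, A v /\ v <> rho (tau v)).
  case: (tau_sat v) => // sat; apply: leq_trans nZ (leq_trans sat _).
  by apply: cnt_sub => j jL; apply: Psame => //; apply: AP.
apply: at_least_cnt al => [v Av|v v' Av Av' e]; first by split; [apply: tau_lt|apply: AP].
have repr u : A u -> u = rho (tau u).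
  by move=> Au; apply: contrapT => nu; apply: H; exists u.
by rewrite (repr v Av) e -repr.
Qed.

Lemma same_type_crole P t (x : 'I_k) i j : W 8 P -> W 9 t ->
  V 8 P x i /\ V 9 t 0 i -> same_type Z V i j -> V 8 P x j /\ V 9 t 0 j.
Proof.
move=> WP Wt [VP Vt] st; have xZ : x < Z := leq_trans (ltn_ord x) kZ.
by split; [apply/(st 8 isT P (occ_lt WP) x xZ)|apply/(st 9 isT t (occ_lt Wt) 0)].
Qed.

Lemma at_least_ord n (A : 'I_k -> Prop) (P : nat -> Prop) :
  (forall y, A y -> P (val y)) -> at_least n A -> n <= cnt k P.
Proof.
move=> AP; apply: (at_least_cnt (tau := val)) => [y Ay|y y' _ _ /val_inj//].
by split; [apply: ltn_ord|apply: AP].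
Qed.

Ltac arg H j nm := pose proof (occ_arg (i := j) H isT isT isT isT) as nm; simpl in nm.

Lemma rbox_sound s : W 3 (enc_rbox s) -> rbox_sat the_model s.
Proof.
have [semC [semR semP]] := term_semE.
have [_ [[_ [[r0 [r1 [r2 [r3 [r4 [r5 [r6 [r7 [r8 [r9 [r10 [r11 [r12 [r13 r14]]]]]]]]]]]]]]
  _]] _]] := rules.
case: s => /=.
- move=> R R' H x y; arg H 0 W1; arg H 1 W2; rewrite !semR //.
  by apply: r0; bounds H.
- move=> R R' H x y; arg H 0 W1; arg H 1 W2; rewrite !semR //.
  by apply: r1; bounds H.
- move=> R Rs R' H x y; arg H 0 W1; arg H 2 W2.
  rewrite chain_semE; last exact: (occ_chain H).
  by rewrite semR // enc_seq_cons; apply: r2; bounds H.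
- move=> R H x y; arg H 0 W1; rewrite !semR //; apply: r3; bounds H.
- move=> R H x y; arg H 0 W1; rewrite !semR //; apply: r4; bounds H.
- move=> R H x; arg H 0 W1; rewrite !semR //; apply: r5; bounds H.
- move=> R H x; arg H 0 W1; rewrite !semR //; apply: r6; bounds H.
- move=> R R' H x y; arg H 0 W1; arg H 1 W2; rewrite !semR //; apply: r7; bounds H.
- move=> R H x y z; arg H 0 W1; rewrite !semR //; apply: r8; bounds H.
- move=> R H x y z; arg H 0 W1; rewrite !semR // => Vy Vz; apply: val_inj.
  by apply: (r9 (enc_arole R) _ _ x _ _ _ _ _ Vy Vz); bounds H.
- move=> R C C' H x y; arg H 0 W1; arg H 1 W2; arg H 2 W3.
  by rewrite semR // !semC //; apply: r10; bounds H.
- move=> P P' H x v; arg H 0 W1; arg H 1 W2; rewrite !semP //; apply: r11; bounds H.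
- move=> P P' H x v; arg H 0 W1; arg H 1 W2; rewrite !semP //; apply: r12; bounds H.
- move=> P P' H x v; arg H 0 W1; arg H 1 W2; rewrite !semP //; apply: r13; bounds H.
- move=> P H x v w; arg H 0 W1 => Pv Pw; apply: contrapT => vw.
  case: (r14 (enc_crole P) _ H x (ltn_ord x)); first by bounds H.
  have xZ : x < Z := leq_trans (ltn_ord x) kZ.
  apply: (at_least_data (A := fun v => V 8 (enc_crole P) x (tau v))) => //.
  (* The bound 2 is at most [Z] because the tag 14 of the statement is a component of its code. *)
  - by have : 14 < Z by [bounds H]; apply: leq_trans.
  - by move=> i j jL Vi st; apply/(st 8 isT _ (occ_lt W1) x xZ).
  - by apply: at_least2 vw; rewrite -semP.
Qed.

Lemma tbox_sound s : W 4 (enc_tbox s) -> tbox_sat the_model s.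
Proof.
have [semC [semR semP]] := term_semE.
have [_ [[_ [_ [[r0 [r1 [r2 [r3 [r4 [r5 [r6 [r7 [r8 [r9 [r10 r11]]]]]]]]]]]
  _]]] _]] := rules.
case: s => /=.
- move=> C C' H x; arg H 0 W1; arg H 1 W2; rewrite !semC //; apply: r0; bounds H.
- move=> C C' H x; arg H 0 W1; arg H 1 W2; rewrite !semC //; apply: r1; bounds H.
- move=> C R C' H x; arg H 0 W1; arg H 1 W2; arg H 2 W3 => + y.
  by rewrite !semC // semR // => Cx; apply: (r2 _ _ _ _ _ _ H x _ Cx); bounds H.
- move=> R C C' H x; arg H 0 W1; arg H 1 W2; arg H 2 W3 => -[y].
  rewrite !semC // semR // => Ry Cy; apply: (r3 _ _ _ _ _ _ H x); bounds H.
  by exists (val y); split=> //; apply: ltn_ord.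
- move=> n R C C' H x; arg H 1 W1; arg H 2 W2; arg H 3 W3 => al.
  rewrite semC //; apply: (r4 _ _ _ _ _ _ _ _ H x); bounds H.
  by apply: at_least_ord al => y; rewrite semC // semR.
- move=> C n R C' H x; arg H 0 W1; arg H 2 W2; arg H 3 W3.
  rewrite semC // => Cx al; apply: (r5 _ _ _ _ _ _ _ _ H x _ Cx); bounds H.
  by apply: at_least_ord al => y; rewrite semC // semR.
- move=> t t' H v; arg H 0 W1; arg H 1 W2; rewrite !dterm_semE //; apply: r6; bounds H.
- move=> t t' H v; arg H 0 W1; arg H 1 W2; rewrite !dterm_semE //; apply: r7; bounds H.
- move=> C P t H x; arg H 0 W1; arg H 1 W2; arg H 2 W3 => + v.
  rewrite semC // semP // dterm_semE // => Cx.
  by apply: (r8 _ _ _ _ _ _ H x _ Cx); bounds H.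
- move=> P t C H x; arg H 0 W1; arg H 1 W2; arg H 2 W3 => -[v].
  rewrite semC // semP // dterm_semE // => Pv tv; apply: (r9 _ _ _ _ _ _ H x); bounds H.
  by exists (tau v); split=> //; apply: tau_lt.
- move=> n P t C H x; arg H 1 W1; arg H 2 W2; arg H 3 W3 => al.
  rewrite semC //; apply: (r10 _ _ _ _ _ _ _ _ H x); bounds H.
  have nZ : n < Z by bounds H.
  apply: at_least_data al; first exact: ltnW.
    by move=> v; rewrite semP // dterm_semE.
  by move=> i j jL; apply: same_type_crole.
- move=> C n P t H x; arg H 0 W1; arg H 2 W2; arg H 3 W3.
  rewrite semC // => Cx al; apply: (r11 _ _ _ _ _ _ _ _ H x _ Cx); bounds H.
  apply: at_least_data al; first by bounds H.
    by move=> v; rewrite semP // dterm_semE.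
  by move=> i j jL; apply: same_type_crole.
Qed.

Lemma abox_sound s : W 5 (enc_abox s) -> abox_sat the_model s.
Proof.
have [semC [semR semP]] := term_semE.
have [_ [[_ [_ [_ [r0 [r1 [r2 [r3 [r4 r5]]]]]]]] _]] := rules.
case: s => /=.
- move=> a C H; arg H 1 W1; rewrite semC //; apply: (r0 _ _ _ _ H); bounds H.
  by apply: ind_of_V; bounds H.
- move=> a b R H; arg H 2 W1; rewrite semR //; apply: (r1 _ _ _ _ _ _ H); bounds H;
  by apply: ind_of_V; bounds H.
- move=> a b H; apply: ord_inj; apply: (r2 _ _ _ _ H); bounds H;
  by apply: ind_of_V; bounds H.
- move=> a b H e; case: (r3 a _ b _ H (ind_of a) _ (ind_of b)); bounds H;
    try (by apply: ind_of_V; bounds H).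
  by rewrite e.
- move=> e t H; arg H 0 W1; arg H 1 W2; rewrite dterm_semE //.
  by apply: (r4 _ _ _ _ H); bounds H; apply/tau_const.
- move=> a e P H; arg H 1 W1; arg H 2 W2; rewrite semP //.
  apply: (r5 _ _ _ _ _ _ H); bounds H; first by apply: ind_of_V; bounds H.
  exact/tau_const.
Qed.

Lemma lookup_const x e : lookup (s_i sg) x = Some (GConst e) -> W 11 (enc_const e).
Proof.
by case: usg => us _ _ _ /(lookupP _ _ us); apply: occ_subst_const.
Qed.

Lemma wsubst_const w e : wsubst sg w = Some (GConst e) -> W 11 (enc_const e).
Proof. by case: w => // x; apply: lookup_const. Qed.

Lemma usubst_const u e : W 16 (enc_uterm u) -> usubst sg u = Some (GConst e) ->
  W 11 (enc_const e).
Proof.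
case: u => [x _|e' H [<-]]; first exact: lookup_const.
exact: (occ_arg (so := 16) (tag := 1) (l := [:: _]) (i := 0) H).
Qed.

Lemma query_sound : query_sat the_model Q sg.
Proof.
have [semC [semR semP]] := term_semE; have [us uc ur up] := usg.
have [_ [_ [rq _]]] := rules.
case=> b a lQ; have Wa : W 15 (enc_qatom a) := occ_qatom K sg lQ.
have mq : memc (code [:: b : nat; enc_qatom a]) qq.
  rewrite /memc CodeSeq.codeK; elim: (Q) lQ => //= l Q' IH [->|/IH H]; rewrite inE ?eqxx //.
  by rewrite H orbT.
have bZ : b < Z.
  apply: ltn_trans (enc_query_lt K Q sg); apply: ltn_trans (memc_lt mq).
  by apply: code_lt; rewrite mem_head.
have [q0 [q1 [q2 [q3 [q4 [q5 [q6 q7]]]]]]] := rq b bZ _ (occ_lt Wa) mq.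
have bE (P : Prop) : (P <-> (b : nat) = 1) -> (P <-> b).
  by case: (b) => -[H1 H2]; split=> [/H1|] // _; apply: H2.
rewrite nthc_subst0 nthc_subst1 nthc_subst2 nthc_subst3 in q0 q1 q2 q3 q4 q5 q6 q7.
have indE i x : x < k -> i < Z -> V 13 i x 0 -> x = ind_of i.
  by move=> xk iZ /(ind_ofP iZ xk).
have constE e j : j < L -> W 11 (enc_const e) -> V 11 (enc_const e) 0 j ->
    j = tau (emb (cval e)).
  by move=> jL We /(const_rep jL We).
have eq_consts e f i j : i < L -> j < L -> W 11 (enc_const e) -> W 11 (enc_const f) ->
    V 11 (enc_const e) 0 i -> V 11 (enc_const f) 0 j ->
    (emb (cval e) = emb (cval f) <-> i = j).
  move=> iL jL We Wf /(rho_const iL We) <- /(rho_const jL Wf) <-.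
  by split=> [/rho_inj|->//]; apply.
case: a lQ mq Wa q0 q1 q2 q3 q4 q5 q6 q7 => /=.
- move=> R w1 w2 _ _ H q0 _ _ _ _ _ _ _; arg H 0 W1.
  have [|||x [xk [y [yk [i [iZ [j [jZ [Hw [Hw' [Vi [Vj HV]]]]]]]]]]]] :=
    q0 (enc_arole R) _ (enc_wterm w1) _ (enc_wterm w2) _ erefl; [by bounds H..|].
  have [g [-> /enc_ground_ind ->]] := wval_subst us Hw.
  have [g' [-> /enc_ground_ind ->]] := wval_subst us Hw'.
  exists (GARole R i j); split=> //=; apply: bE.
  by rewrite semR // -(indE i x) // -(indE j y).
- move=> P w u _ _ H _ q1 _ _ _ _ _ _; arg H 0 W1; arg H 2 W2.
  have [|||x [xk [j [jL [i [iZ [c [cZ [Hw [Hu [Vi [Vj HV]]]]]]]]]]]] :=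
    q1 (enc_crole P) _ (enc_wterm w) _ (enc_uterm u) _ erefl; [by bounds H..|].
  have [g [-> /enc_ground_ind ->]] := wval_subst us Hw.
  have [g' [eu /enc_ground_const[e [ge ce]]]] := uval_subst us Hu; subst g' c.
  have We := usubst_const W2 eu; rewrite eu.
  exists (GACRole P i e); split=> //=; apply: bE.
  by rewrite semP // -(indE i x) // -(constE e j).
- move=> C w _ _ H _ _ q2 _ _ _ _ _; arg H 0 W1.
  have [||x [xk [i [iZ [Hw [Vi HV]]]]]] :=
    q2 (enc_concept C) _ (enc_wterm w) _ erefl; [by bounds H..|].
  have [g [-> /enc_ground_ind ->]] := wval_subst us Hw.
  exists (GAConcept C i); split=> //=; apply: bE.
  by rewrite semC // -(indE i x).
- move=> r w1 w2 _ _ H _ _ _ q3 _ _ _ _.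
  have [|||x [xk [y [yk [i [iZ [j [jZ [N [_ [Hr [Hw [Hw' [Vi [Vj HV]]]]]]]]]]]]]]] :=
    q3 r _ (enc_wterm w1) _ (enc_wterm w2) _ erefl; [by bounds H..|].
  have [g [-> /enc_ground_ind ->]] := wval_subst us Hw.
  have [g' [-> /enc_ground_ind ->]] := wval_subst us Hw'.
  have [n [/lookupP-/(_ ur) -> nN]] := (memc_map _ _ _ _).1 Hr.
  exists (GARole (RName n) i j); split=> //=; apply: bE; rewrite -HV -nN.
  rewrite (indE i x) // (indE j y) //.
  (* The universal role satisfies the disjunct [N = 0]; a proper name has a positive code and falls
     under the other one. *)
  by case: n {nN} => [|n] /=; split; auto; case.
- move=> p w u _ _ H _ _ _ _ q4 _ _ _; arg H 2 W2.
  have [|||x [xk [j [jL [i [iZ [c [cZ [N [_ [Hp [Hw [Hu [Vi [Vj HV]]]]]]]]]]]]]]] :=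
    q4 p _ (enc_wterm w) _ (enc_uterm u) _ erefl; [by bounds H..|].
  have [g [-> /enc_ground_ind ->]] := wval_subst us Hw.
  have [g' [eu /enc_ground_const[e [ge ce]]]] := uval_subst us Hu; subst g' c.
  have We := usubst_const W2 eu; rewrite eu.
  have [n [/lookupP-/(_ up) -> nN]] := (memc_map _ _ _ _).1 Hp.
  exists (GACRole (PName n) i e); split=> //=; apply: bE.
  by rewrite -(indE i x) // -(constE e j) // -HV -nN.
- move=> c w _ _ H _ _ _ _ _ q5 _ _.
  have [||x [xk [i [iZ [N [_ [Hc [Hw [Vi HV]]]]]]]]] :=
    q5 c _ (enc_wterm w) _ erefl; [by bounds H..|].
  have [g [-> /enc_ground_ind ->]] := wval_subst us Hw.
  have [n [/lookupP-/(_ uc) -> nN]] := (memc_map _ _ _ _).1 Hc.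
  exists (GAConcept (CName n) i); split=> //=; apply: bE.
  by rewrite -(indE i x) // -HV -nN.
- move=> w1 w2 _ _ H _ _ _ _ _ _ q6 _.
  case: (q6 (enc_wterm w1) _ (enc_wterm w2) _ erefl); [by bounds H..| |].
    case=> x [xk [y [yk [i [iZ [j [jZ [Hw [Hw' [Vi [Vj HV]]]]]]]]]]].
    have [g [-> /enc_ground_ind ->]] := wval_subst us Hw.
    have [g' [-> /enc_ground_ind ->]] := wval_subst us Hw'.
    exists (GAEqInd D i j); split=> //=; apply: bE.
    by rewrite -HV (indE i x) // (indE j y) //; split=> [->|/ord_inj].
  case=> x [xk [y [yk [i [iZ [j [jZ [Hw [Hw' [Vi [Vj HV]]]]]]]]]]].
  have [g [e1 /enc_ground_const[e [ge ce]]]] := wval_subst us Hw; subst g i.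
  have [g' [e2 /enc_ground_const[f [gf cf]]]] := wval_subst us Hw'; subst g' j.
  have We := wsubst_const e1; have Wf := wsubst_const e2.
  rewrite e1 e2; exists (GAEqConst e f); split=> //=; apply: bE.
  by rewrite (eq_consts e f x y).
- move=> w1 w2 _ _ H _ _ _ _ _ _ _ q7; arg H 0 W1; arg H 1 W2.
  case: (q7 (enc_uterm w1) _ (enc_uterm w2) _ erefl); [by bounds H..| |].
    case=> x [xk [y [yk [i [iZ [j [jZ [Hw [Hw' [Vi [Vj HV]]]]]]]]]]].
    have [g [-> /enc_ground_ind ->]] := uval_subst us Hw.
    have [g' [-> /enc_ground_ind ->]] := uval_subst us Hw'.
    exists (GAEqInd D i j); split=> //=; apply: bE.
    by rewrite -HV (indE i x) // (indE j y) //; split=> [->|/ord_inj].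
  case=> x [xk [y [yk [i [iZ [j [jZ [Hw [Hw' [Vi [Vj HV]]]]]]]]]]].
  have [g [e1 /enc_ground_const[e [ge ce]]]] := uval_subst us Hw; subst g i.
  have [g' [e2 /enc_ground_const[f [gf cf]]]] := uval_subst us Hw'; subst g' j.
  have We := usubst_const W1 e1; have Wf := usubst_const W2 e2.
  rewrite e1 e2; exists (GAEqConst e f); split=> //=; apply: bE.
  by rewrite (eq_consts e f x y).
Qed.

End Model.

Lemma coded_model_sound : exists I : interp D, models I K /\ query_sat I Q sg.
Proof.
have [rho [tau [t1 t2 t3 t4 [t5 t6]]]] := representatives.
exists (the_model tau); split; last exact: (query_sound t1 t2 t3 t4 t5).
split=> s sK.
- exact: (rbox_sound t1 t2 t3 t4 t5 t6 (occ_rbox Q sg sK)).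
- exact: (tbox_sound t1 t2 t3 t4 t5 t6 (occ_tbox Q sg sK)).
- exact: (abox_sound t1 t2 t3 t4 t5 (occ_abox Q sg sK)).
Qed.

End Soundness.

(** * From interpretations to coded models *)

Section Representatives.
Variables (X : eqType) (f : X -> nat) (n : nat).

Lemma fiber_representatives t : exists s : seq X,
  [/\ uniq s, all (fun v => f v == t) s, size s <= n
    & (forall v, f v = t -> v \in s) \/ size s = n].
Proof.
elim: n => [|m [s [us fs sz H]]]; first by exists [::]; split=> //; right.
have [al|na] := pselect (forall v, f v = t -> v \in s).
  by exists s; split=> //; [apply: leqW|left].
have {}na : exists v, f v = t /\ v \notin s.
  apply: contrapT => N; apply: na => v fv; apply: contrapT => /negP vs.
  by apply: N; exists v.
have [v [fv vs]] := na; exists (v :: s); split=> //=; rewrite ?vs ?fv ?eqxx //.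
case: H => [/(_ v fv)|->]; first by rewrite (negPf vs).
by right.
Qed.

(** The choices made in the fibres over the numbers below [T] are concatenated; an element can be
    left out only when its fibre already contributes [n] elements. *)
Lemma representatives_upto T : exists s : seq X,
  [/\ uniq s, size s <= T * n, all (fun v => f v < T) s
    & forall v, f v < T -> v \in s \/ n <= count (fun w => f w == f v) s].
Proof.
elim: T => [|T [s [us sz fs H]]]; first by exists [::].
have [s' [us' fs' sz' H']] := fiber_representatives T.
exists (s' ++ s); split.
- rewrite cat_uniq us us' andbT /=; apply/hasPn => v vs.
  apply/negP => /(allP fs') /eqP fv.
  by have := allP fs v vs; rewrite fv ltnn.
- by rewrite size_cat mulSn leq_add.
- rewrite all_cat; apply/andP; split; apply/allP => v.
    by move/(allP fs')/eqP ->.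
  by move/(allP fs)/leqW.
- move=> v; rewrite ltnS leq_eqVlt mem_cat count_cat => /predU1P[fv|/H[->|le]].
  + case: H' => [/(_ v fv) ->|sz'n]; first by left.
    right; rewrite -{1}sz'n fv; move: fs'; rewrite all_count => /eqP ->.
    exact: leq_addr.
  + by left; rewrite orbT.
  + by right; rewrite (leq_trans le) ?leq_addl.
Qed.

End Representatives.

Lemma cnt_count (X : Type) (x0 : X) (s : seq X) (p : pred X) (P : nat -> Prop) :
  (forall i, i < size s -> p (nth x0 s i) -> P i) -> count p s <= cnt (size s) P.
Proof.
move=> pP; rewrite -sum1_count (big_nth x0) big_mkord big_mkcond /cnt.
by apply: leq_sum => i _; case: ifP => // /pP-/(_ (ltn_ord i)); case: asboolP.
Qed.

Lemma ltn_radix a x M N : a < M -> x < N -> a * N + x < M * N.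
Proof. by nia. Qed.

Section Completeness.
Variables (D : datatype_map) (X : Type) (x0 : X) (emb : dval D -> X).
Variable orac : nat -> Prop.
Hypothesis oracP : forall c, orac (enc_dconj c) <-> satisfiable_in emb c.
Variables (K : kb D) (Q : query D) (sg : subst D).
Hypothesis usg : [/\ uniq (unzip1 (s_i sg)), uniq (unzip1 (s_c sg)),
  uniq (unzip1 (s_ar sg)) & uniq (unzip1 (s_cr sg))].
Variable I : interp D.
Hypothesis (IK : models I K) (IQ : query_sat I Q sg).
Variable g : X -> DeltaD I.
Hypothesis (g_inj : injective g) (g_emb : forall v, g (emb v) = demb I v).

Let kk := enc_kb K.
Let qq := enc_query Q.
Let ss := enc_subst sg.
Let Z := (kk + qq + ss).+1.
Let W := occ Z kk qq ss.

(** A data range only compares a value with points of the data types, so cutting the data domain of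
    [I] down to the image of [g] preserves its truth, complements included. *)
Lemma drange_sem_emb r v : drange_sem (@demb D I) r (g v) <-> drange_sem emb r v.
Proof.
elim: r => [es|d psi|r IH] /=; last by rewrite IH.
- split=> -[e ein]; first by rewrite -g_emb => /g_inj ->; exists e.
  by move=> ->; exists e.
- split=> -[x]; first by rewrite -g_emb => /g_inj ->; exists x.
  by move=> ->; exists x.
Qed.

(** Names may denote the same element, hence [undup]; [{classic _}] supplies the equality test on an
    arbitrary domain. *)
Definition elts : seq {classic (Delta I)} := 
  undup [seq (Iind I a : {classic (Delta I)}) | a <- iota 0 Z].
Let k := size elts.
Definition elt (x : nat) : Delta I := nth (Iind I 0 : {classic (Delta I)}) elts x.

Lemma elts_size : 0 < k <= Z.
Proof.
rewrite /k; apply/andP; split; last by rewrite (leq_trans (size_undup _)) // size_map size_iota.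
have : (Iind I 0 : {classic (Delta I)}) \in elts.
  by rewrite mem_undup; apply: (map_f (Iind I : nat -> {classic (Delta I)})); rewrite mem_iota.
by case: elts.
Qed.

Lemma elt_lt x : x < k -> x < Z.
Proof. by have /andP[_ kZ] := elts_size; move/leq_trans; apply. Qed.

Lemma elt_inj x y : x < k -> y < k -> elt x = elt y -> x = y.
Proof.
move=> xk yk e; apply/eqP.
by rewrite -(nth_uniq (Iind I 0 : {classic (Delta I)}) xk yk (undup_uniq _)); apply/eqP.
Qed.

Lemma elt_ind a : a < Z -> exists x, x < k /\ elt x = Iind I a.
Proof.
move=> aZ; have : (Iind I a : {classic (Delta I)}) \in elts.
  by rewrite mem_undup; apply: (map_f (Iind I : nat -> {classic (Delta I)})); rewrite mem_iota.
by case/(nthP (Iind I 0 : {classic (Delta I)})) => x xk e; exists x.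
Qed.

(** In the substructure the intermediate points must be named too. This is stronger than
    [chain_sem], which is enough because chains stand only on the left of inclusions. *)
Fixpoint named_chain (R : arole D) (l : seq (arole D)) (x y : nat) : Prop :=
  match l with
  | [::] => arole_sem R (elt x) (elt y)
  | R' :: l' => exists z, z < k /\ (arole_sem R (elt x) (elt z) /\ named_chain R' l' z y)
  end.

Lemma named_chain_sem R l x y : named_chain R l x y -> chain_sem R l (elt x) (elt y).
Proof.
elim: l R x => //= R' l IH R x [z [_ [Rz /IH]]].
by exists (elt z).
Qed.

(* Everything the input can say about a data value. *)
Definition data_truth (so c x : nat) (v : X) : Prop :=
  match so with
  | 8 => exists P, enc_crole P = c /\ crole_sem P (elt x) (g v)
  | 9 => exists t, enc_dterm t = c /\ dterm_sem t (g v)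
  | 10 => exists r, enc_drange r = c /\ drange_sem emb r v
  | 11 => exists e, enc_const e = c /\ v = emb (cval e)
  | _ => False
  end.

Definition same_data (v w : X) : Prop :=
  forall so c x, so < 16 -> c < Z -> x < Z ->
    (data_truth so c x v <-> data_truth so c x w).

(** With the truths about a value as digits of a number, types become the fibres of a function of
    bounded range, to which [representatives_upto] applies. *)
Lemma data_types : exists ty : X -> nat, forall v,
  ty v < 2 ^ (16 * Z * Z) /\
  forall so c x, so < 16 -> c < Z -> x < Z ->
    (bit (ty v) ((so * Z + c) * Z + x) <-> data_truth so c x v).
Proof.
have H v : exists m, m < 2 ^ (16 * Z * Z) /\
  forall so c x, so < 16 -> c < Z -> x < Z ->
    (bit m ((so * Z + c) * Z + x) <-> data_truth so c x v).
  have [m [mZ mP]] := bits_of_pred (16 * Z * Z)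
    (fun i => data_truth (i %/ Z %/ Z) ((i %/ Z) %% Z) (i %% Z) v).
  exists m; split=> // so c x so16 cZ xZ; rewrite mP; last by do ?apply: ltn_radix.
  by rewrite modnMDl (modn_small xZ) !divnMDl ?(divn_small xZ) ?addn0 ?divnMDl
             ?(divn_small cZ) ?addn0 ?modnMDl ?(modn_small cZ).
by have [ty tyP] := choice H; exists ty.
Qed.

Lemma data_representatives : exists S : seq {classic X},
  [/\ uniq S, size S <= dbound Z
    & forall v : {classic X}, v \in S \/
        Z <= count (fun w : {classic X} => `[< same_data w v >]) S].
Proof.
have [ty tyP] := data_types.
have [S [uS sS _ HS]] := @representatives_upto {classic X} ty Z (2 ^ (16 * Z * Z)).
exists S; split=> // v; case: (HS v (tyP v).1) => [|le]; first by left.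
right; apply: leq_trans le _; apply: sub_count => w /eqP tw; apply/asboolP.
move=> so c x so16 cZ xZ; have [_ H] := tyP w; have [_ H'] := tyP v.
by rewrite -H // -H' // tw.
Qed.

(** * Truth values of a given interpretation on representatives *)

Section Values.
Variable S : seq {classic X}.
Hypothesis uS : uniq S.
Hypothesis S_size : size S <= dbound Z.
Hypothesis S_sat : forall v : {classic X}, v \in S \/
  Z <= count (fun w : {classic X} => `[< same_data w v >]) S.

Let L := size S.
Definition dv (j : nat) : X := nth (x0 : {classic X}) S j.

Lemma dv_inj i j : i < L -> j < L -> dv i = dv j -> i = j.
Proof.
by move=> iL jL e; apply/eqP; rewrite -(nth_uniq (x0 : {classic X}) iL jL uS); apply/eqP.
Qed.

(** The range conditions copy those of [fact], so that the coded and the actual truth values agree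
    as functions and the rules transfer by rewriting. *)
Definition truth (so c x y : nat) : Prop :=
  (so < 16 /\ c < Z /\ x < Z /\ y < dbound Z) /\
  match so with
  | 6 => exists C, enc_concept C = c /\ concept_sem C (elt x)
  | 7 => exists R, enc_arole R = c /\ arole_sem R (elt x) (elt y)
  | 12 => exists R l, enc_seq (@enc_arole D) (R :: l) = c /\
            named_chain R l x y
  | 13 => elt x = Iind I c
  | _ => data_truth so c x (dv y)
  end.

Lemma Z_dbound : Z <= dbound Z.
Proof. by rewrite /dbound leq_pmull // expn_gt0. Qed.

Lemma elt_dbound x : x < k -> x < dbound Z.
Proof. by move/elt_lt/leq_trans; apply; apply: Z_dbound. Qed.

Lemma dv_dbound j : j < L -> j < dbound Z.
Proof. by move/leq_trans; apply. Qed.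

Lemma truth_concept C x : enc_concept C < Z -> x < k ->
  (truth 6 (enc_concept C) x 0 <-> concept_sem C (elt x)).
Proof.
move=> cZ xk; split=> [[_ [C' [/enc_concept_inj -> //]]]|H].
split; last by exists C.
by do !split=> //; [apply: elt_lt|apply: leq_trans Z_dbound].
Qed.

Lemma truth_arole R x y : enc_arole R < Z -> x < k -> y < k ->
  (truth 7 (enc_arole R) x y <-> arole_sem R (elt x) (elt y)).
Proof.
move=> cZ xk yk; split=> [[_ [C' [/enc_arole_inj -> //]]]|H].
split; last by exists R.
by do !split=> //; [apply: elt_lt|apply: elt_dbound].
Qed.

Lemma truth_chain R l x y : enc_seq (@enc_arole D) (R :: l) < Z -> x < k -> y < k ->
  (truth 12 (enc_seq (@enc_arole D) (R :: l)) x y <-> named_chain R l x y).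
Proof.
move=> cZ xk yk; split=> [[_ [R' [l' [/(enc_seq_inj (@enc_arole_inj D)) [-> ->] //]]]]|H].
split; last by exists R, l.
by do !split=> //; [apply: elt_lt|apply: elt_dbound].
Qed.

Lemma truth_ind a x : a < Z -> x < k -> (truth 13 a x 0 <-> elt x = Iind I a).
Proof.
move=> aZ xk; split=> [[]//|H]; split=> //.
by do !split=> //; [apply: elt_lt|apply: leq_trans Z_dbound].
Qed.

Lemma truth_crole P x j : enc_crole P < Z -> x < k -> j < L ->
  (truth 8 (enc_crole P) x j <-> crole_sem P (elt x) (g (dv j))).
Proof.
move=> cZ xk jL; split=> [[_ [C' [/enc_crole_inj -> //]]]|H].
split; last by exists P.
by do !split=> //; [apply: elt_lt|apply: dv_dbound].
Qed.

Lemma truth_dterm t j : enc_dterm t < Z -> j < L ->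
  (truth 9 (enc_dterm t) 0 j <-> dterm_sem t (g (dv j))).
Proof.
move=> cZ jL; split=> [[_ [C' [/enc_dterm_inj -> //]]]|H].
by split; [do !split=> //; apply: dv_dbound|exists t].
Qed.

Lemma truth_drange r j : enc_drange r < Z -> j < L ->
  (truth 10 (enc_drange r) 0 j <-> drange_sem emb r (dv j)).
Proof.
move=> cZ jL; split=> [[_ [C' [/enc_drange_inj -> //]]]|H].
by split; [do !split=> //; apply: dv_dbound|exists r].
Qed.

Lemma truth_const e j : enc_const e < Z -> j < L ->
  (truth 11 (enc_const e) 0 j <-> dv j = emb (cval e)).
Proof.
move=> cZ jL; split=> [[_ [C' [/enc_const_inj -> //]]]|H].
by split; [do !split=> //; apply: dv_dbound|exists e].
Qed.

(** The value of an occurring constant is alone in its type. Were it not in [S], then [S] would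
    contain [Z > 0] values of that type, hence this value. *)
Lemma const_value e : enc_const e < Z -> exists j, j < L /\ dv j = emb (cval e).
Proof.
move=> eZ; suff /(nthP (x0 : {classic X}))[j jL jE] : (emb (cval e) : {classic X}) \in S.
  by exists j.
case: (S_sat (emb (cval e))) => // le.
have /hasP[w wS /asboolP H] : 
    has (fun w : {classic X} => `[< same_data w (emb (cval e)) >]) S.
  by rewrite has_count; apply: leq_trans le.
have [_ /(_ (ex_intro _ e (conj erefl erefl)))] := H 11 (enc_const e) 0 isT eZ isT.
by case=> e' [/enc_const_inj -> <-].
Qed.

Lemma valid_concept c : W 6 c -> exists C, @enc_concept D C = c.
Proof. exact: (@occ_valid D K Q sg 6). Qed.
Lemma valid_arole c : W 7 c -> exists R, @enc_arole D R = c.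
Proof. exact: (@occ_valid D K Q sg 7). Qed.
Lemma valid_crole c : W 8 c -> exists P, @enc_crole D P = c.
Proof. exact: (@occ_valid D K Q sg 8). Qed.
Lemma valid_dterm c : W 9 c -> exists t, @enc_dterm D t = c.
Proof. exact: (@occ_valid D K Q sg 9). Qed.
Lemma valid_drange c : W 10 c -> exists r, @enc_drange D r = c.
Proof. exact: (@occ_valid D K Q sg 10). Qed.
Lemma valid_const c : W 11 c -> exists e, @enc_const D e = c.
Proof. exact: (@occ_valid D K Q sg 11). Qed.
Lemma valid_chain c : W 12 c -> exists l, enc_seq (@enc_arole D) l = c.
Proof. exact: (@occ_valid D K Q sg 12). Qed.
Lemma valid_rbox c : W 3 c -> exists s, @enc_rbox D s = c /\ List.In s (rbox K).
Proof. exact: (@occ_valid D K Q sg 3). Qed.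
Lemma valid_tbox c : W 4 c -> exists s, @enc_tbox D s = c /\ List.In s (tbox K).
Proof. exact: (@occ_valid D K Q sg 4). Qed.
Lemma valid_abox c : W 5 c -> exists s, @enc_abox D s = c /\ List.In s (abox K).
Proof. exact: (@occ_valid D K Q sg 5). Qed.

Ltac inv_code eo :=
  apply code_inj in eo; first [injection eo; clear eo;
    repeat match goal with |- _ = _ -> _ => let h := fresh in intro h end; subst
  | clear eo].

Ltac inv H vld :=
  let o := fresh "o" in let eo := fresh "eo" in let lt := fresh "lt" in
  pose proof (occ_lt H) as lt;
  destruct (vld _ H) as [o eo];
  destruct o; try (exfalso; apply code_inj in eo; discriminate eo);
  rewrite -eo in H lt *; inv_code eo.

Ltac tr := rewrite ?truth_concept ?truth_arole ?truth_crole ?truth_dterm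
  ?truth_drange ?truth_const ?truth_ind //=.

Lemma concept_complete : concept_rules Z k L W truth.
Proof.
rewrite /concept_rules; repeat refine (conj _ _).
- by move=> H x xk; inv H valid_concept; tr.
- by move=> H x xk; inv H valid_concept; tr.
- by move=> c cZ H x xk; inv H valid_concept; tr.
- by move=> c cZ d dZ H x xk; inv H valid_concept; tr.
- by move=> c cZ d dZ H x xk; inv H valid_concept; tr.
- by move=> a aZ H x xk; inv H valid_concept; tr.
- by move=> r rZ H x xk; inv H valid_concept; tr.
- move=> r rZ a aZ H x xk; inv H valid_concept; tr.
  split=> [Rx|[y [yk]]]; last by tr => -[<-].
  have [y [yk ey]] := elt_ind aZ; exists y; split=> //; tr; by rewrite ey.
- move=> p pZ e eZ H x xk; inv H valid_concept; tr.
  split=> [Px|[j [jL]]]; last by tr => -[e1]; rewrite e1 g_emb.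
  by have [j [jL ej]] := const_value eZ; exists j; split=> //; tr; rewrite ej g_emb.
Qed.

Lemma arole_complete : arole_rules Z k W truth.
Proof.
rewrite /arole_rules; repeat refine (conj _ _).
- move=> H x xk y yk; inv H valid_arole; tr.
  by match goal with n : arname |- _ => destruct n end.
- by move=> r rZ H x xk y yk; inv H valid_arole; tr.
- by move=> r rZ H x xk y yk; inv H valid_arole; tr.
- by move=> r rZ r' r'Z H x xk y yk; inv H valid_arole; tr.
- by move=> r rZ r' r'Z H x xk y yk; inv H valid_arole; tr.
- by move=> r rZ c cZ H x xk y yk; inv H valid_arole; tr.
- by move=> r rZ c cZ H x xk y yk; inv H valid_arole; tr.
- move=> r rZ c cZ d dZ H x xk y yk; inv H valid_arole; tr.
  by split=> [[]|[? []]].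
- move=> c cZ H x xk y yk; inv H valid_arole; tr.
  by split=> -[e Cx]; split=> //; [apply: elt_inj|rewrite e].
- by move=> c cZ d dZ H x xk y yk; inv H valid_arole; tr.
Qed.

Lemma crole_complete : crole_rules Z k L W truth.
Proof.
rewrite /crole_rules; repeat refine (conj _ _).
- by move=> p pZ H x xk j jL; inv H valid_crole; tr.
- by move=> p pZ p' p'Z H x xk j jL; inv H valid_crole; tr.
- by move=> p pZ p' p'Z H x xk j jL; inv H valid_crole; tr.
- by move=> p pZ c cZ H x xk j jL; inv H valid_crole; tr.
- by move=> p pZ t tZ H x xk j jL; inv H valid_crole; tr.
- move=> p pZ c cZ t tZ H x xk j jL; inv H valid_crole; tr.
  by split=> [[]|[? []]].
Qed.

Lemma dterm_complete : dterm_rules Z L W truth.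
Proof.
rewrite /dterm_rules; repeat refine (conj _ _).
- by move=> r rZ H j jL; inv H valid_dterm; tr; rewrite drange_sem_emb.
- by move=> t tZ H j jL; inv H valid_dterm; tr.
- by move=> t tZ u uZ H j jL; inv H valid_dterm; tr.
- by move=> t tZ u uZ H j jL; inv H valid_dterm; tr.
- move=> e eZ H j jL; inv H valid_dterm; tr.
  by rewrite -g_emb; split=> [/g_inj|->].
Qed.

Lemma chain_complete : chain_rules Z k W truth.
Proof.
split.
- move=> r rZ H x xk y yk; have lt := occ_lt H.
  have [l el] := valid_chain H; have [R [l' [lE rE e0]]] := enc_seq_eq_cons el; subst l r.
  have l0 : l' = [::].
    case: l' {el} e0 => // R' l'; rewrite enc_seq_cons => e.
    by have := ltn_ccons1 (enc_arole R') (enc_seq (@enc_arole D) l'); rewrite -e.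
  by subst l'; rewrite -el in lt *; rewrite truth_chain //; tr.
- move=> r rZ r' r'Z t tZ H x xk y yk; have lt := occ_lt H.
  have [l el] := valid_chain H; have [R [l' [lE rE el']]] := enc_seq_eq_cons el; subst l r.
  have [R' [l'' [lE rE' te]]] := enc_seq_eq_cons (esym el'); subst l' r' t.
  have lt' : enc_seq (@enc_arole D) (R' :: l'') < Z.
    by apply: ltn_trans lt; rewrite -enc_seq_cons; apply: ltn_ccons2.
  rewrite -el in lt *; rewrite truth_chain //= -!enc_seq_cons.
  split=> -[z [zk [Rz Hz]]]; exists z; split=> //; move: Rz Hz; tr; rewrite truth_chain //.
Qed.

Lemma ind_complete : ind_rules Z k truth.
Proof.
move=> a aZ; have [x [xk ex]] := elt_ind aZ; exists x; split=> //; split; first by tr.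
by move=> y yk; tr => ey; apply: elt_inj => //; rewrite ex.
Qed.

Lemma cnt_elt n (P : nat -> Prop) (A : Delta I -> Prop) :
  (forall y, y < k -> P y -> A (elt y)) -> n <= cnt k P -> at_least n A.
Proof.
move=> PA /cnt_at_least; apply: (at_least_map (f := fun y : 'I_k => elt y)).
  by move=> y z /elt_inj e; apply: ord_inj; apply: e.
by move=> y; apply: PA.
Qed.

Lemma cnt_dv n (P : nat -> Prop) (A : DeltaD I -> Prop) :
  (forall j, j < L -> P j -> A (g (dv j))) -> n <= cnt L P -> at_least n A.
Proof.
move=> PA /cnt_at_least; apply: (at_least_map (f := fun y : 'I_L => g (dv y))).
  by move=> y z /g_inj/dv_inj e; apply: ord_inj; apply: e.
by move=> y; apply: PA.
Qed.

Ltac inv_stmt H vld sat :=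
  let o := fresh "o" in let eo := fresh "eo" in let oK := fresh "oK" in
  destruct (vld _ H) as [o [eo oK]];
  apply sat in oK;
  destruct o; try (exfalso; apply code_inj in eo; discriminate eo);
  inv_code eo; simpl in oK.

Lemma rbox_complete : rbox_rules Z k L W truth.
Proof.
have [sat _ _] := IK; rewrite /rbox_rules; repeat refine (conj _ _).
- by move=> r rZ r' r'Z H x xk y yk; inv_stmt H valid_rbox sat; tr; apply: oK.
- by move=> r rZ r' r'Z H x xk y yk; inv_stmt H valid_rbox sat; tr; apply: oK.
- move=> r rZ l lZ r' r'Z H x xk y yk.
  have lt := occ_lt (occ_chain H).
  inv_stmt H valid_rbox sat; tr; rewrite -enc_seq_cons truth_chain // => /named_chain_sem.
  exact: oK.
- by move=> r rZ H x xk y yk; inv_stmt H valid_rbox sat; tr; apply: oK.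
- by move=> r rZ H x xk y yk; inv_stmt H valid_rbox sat; tr; apply: oK.
- by move=> r rZ H x xk; inv_stmt H valid_rbox sat; tr; apply: oK.
- by move=> r rZ H x xk; inv_stmt H valid_rbox sat; tr; apply: oK.
- by move=> r rZ r' r'Z H x xk y yk; inv_stmt H valid_rbox sat; tr; apply: oK.
- by move=> r rZ H x xk y yk z zk; inv_stmt H valid_rbox sat; tr; apply: oK.
- move=> r rZ H x xk y yk z zk; inv_stmt H valid_rbox sat; tr => Ry Rz.
  by apply: elt_inj => //; apply: oK Ry Rz.
- by move=> r rZ c cZ d dZ H x xk y yk; inv_stmt H valid_rbox sat; tr; apply: oK.
- by move=> p pZ p' p'Z H x xk j jL; inv_stmt H valid_rbox sat; tr; apply: oK.
- by move=> p pZ p' p'Z H x xk j jL; inv_stmt H valid_rbox sat; tr; apply: oK.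
- by move=> p pZ p' p'Z H x xk j jL; inv_stmt H valid_rbox sat; tr; apply: oK.
- move=> p pZ H x xk; inv_stmt H valid_rbox sat => le.
  match goal with P : crole D |- _ =>
    have : at_least 2 (fun v => crole_sem P (elt x) v) by apply: cnt_dv le => j jL; tr
  end.
  case=> f finj fP; have /finj // : f ord0 = f (lift ord0 ord0) by apply: oK (fP _) (fP _).
Qed.

Lemma tbox_complete : tbox_rules Z k L W truth.
Proof.
have [_ sat _] := IK; rewrite /tbox_rules; repeat refine (conj _ _).
- by move=> c cZ d dZ H x xk; inv_stmt H valid_tbox sat; tr; apply: oK.
- by move=> c cZ d dZ H x xk; inv_stmt H valid_tbox sat; tr; apply: oK.
- move=> c cZ r rZ d dZ H x xk; inv_stmt H valid_tbox sat; tr => Cx y yk; tr; exact: oK.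
- move=> r rZ c cZ d dZ H x xk; inv_stmt H valid_tbox sat => -[y [yk]]; tr => -[Ry Cy].
  by apply: oK; exists (elt y).
- move=> n nZ r rZ c cZ d dZ H x xk; inv_stmt H valid_tbox sat => le; tr.
  by apply: oK; apply: cnt_elt le => y yk; tr.
- move=> c cZ n nZ r rZ d dZ H x xk; inv_stmt H valid_tbox sat; tr => Cx le.
  by case: (oK _ Cx); apply: cnt_elt le => y yk; tr.
- by move=> t tZ u uZ H j jL; inv_stmt H valid_tbox sat; tr; apply: oK.
- by move=> t tZ u uZ H j jL; inv_stmt H valid_tbox sat; tr; apply: oK.
- move=> c cZ p pZ t tZ H x xk; inv_stmt H valid_tbox sat; tr => Cx j jL; tr; exact: oK.
- move=> p pZ t tZ c cZ H x xk; inv_stmt H valid_tbox sat => -[j [jL]]; tr => -[Pj tj].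
  by apply: oK; exists (g (dv j)).
- move=> n nZ p pZ t tZ c cZ H x xk; inv_stmt H valid_tbox sat => le; tr.
  by apply: oK; apply: cnt_dv le => j jL; tr.
- move=> c cZ n nZ p pZ t tZ H x xk; inv_stmt H valid_tbox sat; tr => Cx le.
  by case: (oK _ Cx); apply: cnt_dv le => j jL; tr.
Qed.

Lemma abox_complete : abox_rules Z k L W truth.
Proof.
have [_ _ sat] := IK; rewrite /abox_rules; repeat refine (conj _ _).
- by move=> a aZ c cZ H x xk; inv_stmt H valid_abox sat; tr => ->.
- by move=> a aZ b bZ r rZ H x xk y yk; inv_stmt H valid_abox sat; tr => -> ->.
- move=> a aZ b bZ H x xk y yk; inv_stmt H valid_abox sat; tr => ex ey.
  by apply: elt_inj => //; rewrite ex ey.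
- move=> a aZ b bZ H x xk y yk; inv_stmt H valid_abox sat; tr => ex ey xy.
  by apply: oK; rewrite -ex -ey xy.
- by move=> e eZ t tZ H j jL; inv_stmt H valid_abox sat; tr => ->; rewrite g_emb.
- by move=> a aZ e eZ p pZ H x xk j jL; inv_stmt H valid_abox sat; tr => -> ->; rewrite g_emb.
Qed.

Lemma same_data_type i j : i < L -> j < L -> same_data (dv i) (dv j) ->
  same_type Z truth i j.
Proof.
move=> iL jL H so; rewrite !inE => soE c cZ x xZ.
have so16 : so < 16 by case/or4P: soE => /eqP->.
have {}H := H so c x so16 cZ xZ.
have iD := dv_dbound iL; have jD := dv_dbound jL.
by case/or4P: soE H => /eqP -> H; split=> -[_ /H]; split.
Qed.

(** The solution granted by the oracle reproduces the types of the members of [S] but not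
    necessarily the members themselves. Counting bridges the gap: it contains one more value with
    the prescribed ranges and constants than [S] does, so some such value lies outside [S]. *)
Lemma new_value u v :
  orac (config Z W L.+1
          (fun r j => (j < L /\ truth 10 r 0 j) \/ (j = L /\ bit u r))
          (fun e j => (j < L /\ truth 11 e 0 j) \/ (j = L /\ bit v e))) ->
  exists w : {classic X}, w \notin S /\
    ((forall r, W 10 (enc_drange r) -> (drange_sem emb r w <-> bit u (enc_drange r))) /\
     (forall e, W 11 (enc_const e) -> ((w : X) = emb (cval e) <-> bit v (enc_const e)))).
Proof.
move/(config_spec oracP valid_drange valid_const (@occ_lt D K Q sg)) => [rho [Hr [He Hn]]].
(* [mt] is the prescription, [J] the indices of [S] that meet it, and [R] the values of the solution
   at [J] and at the new index [L]. *)
pose mt (w : {classic X}) : Prop :=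
  (forall r, W 10 (enc_drange r) -> (drange_sem emb r w <-> bit u (enc_drange r))) /\
  (forall e, W 11 (enc_const e) -> ((w : X) = emb (cval e) <-> bit v (enc_const e))).
pose J := [seq j <- iota 0 L | `[< mt (dv j) >]].
have JL j : j \in L :: J -> j <= L.
  by rewrite inE mem_filter mem_iota => /predU1P[->//|/and3P[_ _ /ltnW]].
pose R := [seq (rho j : {classic X}) | j <- L :: J].
have uR : uniq R.
  rewrite map_inj_in_uniq /=.
    rewrite filter_uniq ?iota_uniq // andbT mem_filter mem_iota add0n ltnn.
    by rewrite !andbF.
  move=> i j iJ jJ e; case: (ltngtP i j) => // ij.
    by case: (Hn i j ij (JL j jJ)).
  by case: (Hn j i ij (JL i iJ)).
have mR w : w \in R -> mt w.
  case/mapP=> j jJ ->; have jL := JL j jJ.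
  split=> [r Wr|e We]; rewrite ?Hr ?He //.
    move: jJ; rewrite inE => /predU1P[->|].
      by split=> [[[]|[]//]|]; [rewrite ltnn|right].
    rewrite mem_filter mem_iota => /andP[/asboolP[mj _] /andP[_ lt]].
    rewrite truth_drange ?(occ_lt Wr) // mj //.
    by split=> [[[]//|[e]]|]; [move: lt; rewrite e ltnn|left].
  move: jJ; rewrite inE => /predU1P[->|].
    by split=> [[[]|[]//]|]; [rewrite ltnn|right].
  rewrite mem_filter mem_iota => /andP[/asboolP[_ mj] /andP[_ lt]].
  rewrite truth_const ?(occ_lt We) // mj //.
  by split=> [[[]//|[e1]]|]; [move: lt; rewrite e1 ltnn|left].
apply: contrapT => N.
have RS : {subset R <= [seq w <- S | `[< mt w >]]}.
  move=> w wR; rewrite mem_filter; apply/andP; split; first exact/asboolP/mR.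
  by apply: contrapT => /negP wS; apply: N; exists w; split=> //; apply: mR.
have := uniq_leq_size uR RS; rewrite size_map /= !size_filter.
rewrite -[X in _ < count _ X](mkseq_nth (x0 : {classic X})) count_map.
by rewrite (eq_count (a2 := fun j => `[< mt (dv j) >])) // ltnn.
Qed.

(** If a further value with the given ranges and constants exists, [new_value] finds one outside
    [S]; its full type, concrete roles included, then has [Z] representatives, and any of them can
    be imitated. *)
Lemma data_complete : data_rules Z L W truth orac.
Proof.
have cspec := config_spec oracP valid_drange valid_const (@occ_lt D K Q sg).
split.
  apply/cspec; exists dv; split; [|split].
  - by move=> j jL r Wr; rewrite truth_drange ?(occ_lt Wr).
  - by move=> j jL e We; rewrite truth_const ?(occ_lt We).
  - by move=> i j ij jL /(dv_inj (ltn_trans ij jL) jL) e; rewrite e ltnn in ij.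
move=> u uZ v vZ; apply: contrapT => /not_orP[N1 /contrapT/new_value[w [wS [mr me]]]]; apply: N1.
case: (S_sat w) => [|le]; first by rewrite (negPf wS).
have /hasP[w' w'S /asboolP ww'] : has (fun w' : {classic X} => `[< same_data w' w >]) S.
  by rewrite has_count; apply: leq_trans le.
have [i iL iE] := nthP (x0 : {classic X}) w'S.
have {ww' iE w'S} iw : same_data (dv i) w by rewrite /dv iE.
exists i; split=> //; split; [|split].
- move=> c cZ Wc; have [r er] := valid_drange Wc; subst c.
  rewrite truth_drange // -mr //; have [H1 H2] := iw 10 (enc_drange r) 0 isT cZ isT.
  split=> H.
    by have [r' [/enc_drange_inj ->]] := H1 (ex_intro _ r (conj erefl H)).
  by have [r' [/enc_drange_inj ->]] := H2 (ex_intro _ r (conj erefl H)).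
- move=> c cZ Wc; have [e ee] := valid_const Wc; subst c.
  rewrite truth_const // -me //; have [H1 H2] := iw 11 (enc_const e) 0 isT cZ isT.
  split=> H.
    by have [e' [/enc_const_inj ->]] := H1 (ex_intro _ e (conj erefl H)).
  by have [e' [/enc_const_inj ->]] := H2 (ex_intro _ e (conj erefl H)).
- apply: leq_trans le _; apply: (cnt_count (x0 := (x0 : {classic X}))) => j jL /asboolP jw.
  apply: same_data_type => // so c x so16 cZ xZ.
  by rewrite iw // -jw.
Qed.

Lemma subst_lt T (enc : T -> nat) (s : seq (nat * T)) x v i :
  nthc ss i = enc_map enc s -> List.In (x, v) s -> code [:: x; enc v] < Z.
Proof.
move=> e xv; apply: ltn_trans (nthc_subst_lt K Q sg i); apply: memc_lt.
by rewrite -/ss e; apply/memc_map; exists v.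
Qed.

Lemma lookup_ground_lt x gr : lookup (s_i sg) x = Some gr -> enc_ground gr < Z.
Proof.
case: usg => us _ _ _ /(lookupP _ _ us) /(subst_lt (nthc_subst0 sg)).
by apply: ltn_trans; apply: code_lt; rewrite !inE eqxx orbT.
Qed.

Lemma ground_ind_lt i : enc_ground (GInd i : ground D) < Z -> i < Z.
Proof. by apply: ltn_trans; apply: code_lt; rewrite !inE eqxx orbT. Qed.

Lemma ground_const_lt (e : const D) : enc_ground (GConst e) < Z -> enc_const e < Z.
Proof. by apply: ltn_trans; apply: code_lt; rewrite !inE eqxx orbT. Qed.

Lemma wsubst_ind_lt w i : enc_wterm w < Z -> wsubst sg w = Some (GInd i) -> i < Z.
Proof.
case: w => [x _ /lookup_ground_lt/ground_ind_lt//|a lt [<-]].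
by apply: ltn_trans lt; apply: code_lt; rewrite !inE eqxx orbT.
Qed.

Lemma wsubst_const_lt w e : wsubst sg w = Some (GConst e) -> enc_const e < Z.
Proof. by case: w => // x /lookup_ground_lt/ground_const_lt. Qed.

Lemma usubst_ind_lt (u : uterm D) i : usubst sg u = Some (GInd i) -> i < Z.
Proof. by case: u => // x /lookup_ground_lt/ground_ind_lt. Qed.

Lemma usubst_const_lt u e : enc_uterm u < Z -> usubst sg u = Some (GConst e) ->
  enc_const e < Z.
Proof.
case: u => [x _ /lookup_ground_lt/ground_const_lt//|a lt [<-]].
by apply: ltn_trans lt; apply: code_lt; rewrite !inE eqxx orbT.
Qed.

(** A name chosen for a concept or role variable may occur nowhere else. Its truth values are stored
    all the same, because its term has tag 0 and thus a code no larger than the entry of the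
    substitution. *)
Lemma name_code_lt x n : code [:: x; n] < Z -> code [:: 0; n] < Z.
Proof.
by apply: leq_ltn_trans; rewrite !code_cons /ccons leq_mul2r leq_exp2l // orbT.
Qed.

Lemma query_complete : query_rules Z k L truth qq ss.
Proof.
have [us uc ur up] := usg.
move=> b bZ a aZ; rewrite /memc CodeSeq.codeK => mq.
have [l [lQ eb ea]] : exists l : bool * qatom D, [/\ List.In l Q, b = l.1 & enc_qatom l.2 = a].
  elim: (Q) mq => //= l Q' IH; rewrite inE => /predU1P[/code_inj[-> ->]|/IH[l' [? ? ?]]].
    by exists l; split=> //; left.
  by exists l'; split=> //; right.
have [ga [sa gb]] := IQ lQ.
have bE (P : Prop) : (P <-> gatom_sat I ga) -> (P <-> b = 1).
  by move=> ->; rewrite gb eb; case: (l.1); split.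
case: l {lQ mq gb eb} ea sa => b' qa /= ea sa.
rewrite /ss nthc_subst0 nthc_subst1 nthc_subst2 nthc_subst3.
have ind_at i : i < Z -> exists x, x < k /\ elt x = Iind I i by apply: elt_ind.
subst a; repeat refine (conj _ _).
- move=> r rZ w wZ w' w'Z e; destruct qa; try (by move/code_inj: e).
  inv_code e; simpl in sa.
  move: sa; rewrite /mk_role; case e1: (wsubst sg w0) => [[i|?]|] //.
  case e2: (wsubst sg w1) => [[j|?]|] // [ga']; subst ga.
  have iZ := wsubst_ind_lt wZ e1; have jZ := wsubst_ind_lt w'Z e2.
  have [x [xk ex]] := ind_at i iZ; have [y [yk ey]] := ind_at j jZ.
  exists x; split=> //; exists y; split=> //; exists i; split=> //; exists j; split=> //.
  split; first exact: (subst_wval us wZ e1).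
  split; first exact: (subst_wval us w'Z e2).
  by do 2![split; first by tr]; apply: bE; tr; rewrite ex ey.
- move=> p pZ w wZ u uZ e; destruct qa; try (by move/code_inj: e).
  inv_code e; simpl in sa.
  move: sa; rewrite /mk_crole; case e1: (wsubst sg w0) => [[i|?]|] //.
  case e2: (usubst sg _) => [[?|f]|] // [ga']; subst ga.
  have iZ := wsubst_ind_lt wZ e1; have fZ := usubst_const_lt uZ e2.
  have [x [xk ex]] := ind_at i iZ; have [j [jL ej]] := const_value fZ.
  exists x; split=> //; exists j; split=> //; exists i; split=> //.
  exists (enc_const f); split=> //.
  split; first exact: (subst_wval us wZ e1).
  split; first exact: (subst_uval us uZ e2).
  by do 2![split; first by tr]; apply: bE; tr; rewrite ex ej g_emb.
- move=> c cZ w wZ e; destruct qa; try (by move/code_inj: e).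
  inv_code e; simpl in sa.
  move: sa; rewrite /mk_concept; case e1: (wsubst sg w0) => [[i|?]|] // [ga']; subst ga.
  have iZ := wsubst_ind_lt wZ e1; have [x [xk ex]] := ind_at i iZ.
  exists x; split=> //; exists i; split=> //.
  split; first exact: (subst_wval us wZ e1).
  by split; [tr|apply: bE; tr; rewrite ex].
- move=> r rZ w wZ w' w'Z e; destruct qa; try (by move/code_inj: e).
  inv_code e; simpl in sa.
  move: sa; rewrite /mk_role; case er: (lookup (s_ar sg) r) => [N|] //=.
  case e1: (wsubst sg w0) => [[i|?]|] //.
  case e2: (wsubst sg w1) => [[j|?]|] // [ga']; subst ga.
  have iZ := wsubst_ind_lt wZ e1; have jZ := wsubst_ind_lt w'Z e2.
  have [x [xk ex]] := ind_at i iZ; have [y [yk ey]] := ind_at j jZ.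
  move/(lookupP _ _ ur): er => rN; have lt := subst_lt (nthc_subst2 sg) rN.
  exists x; split=> //; exists y; split=> //; exists i; split=> //; exists j; split=> //.
  exists (enc_arname N); split.
    by apply: ltn_trans lt; apply: code_lt; rewrite !inE eqxx orbT.
  split; first by apply/memc_map; exists N.
  split; first exact: (subst_wval us wZ e1).
  split; first exact: (subst_wval us w'Z e2).
  do 2![split; first by tr]; apply: bE => /=.
  have NZ : enc_arole (RName N : arole D) < Z := name_code_lt lt.
  have := @truth_arole (RName N) x y NZ xk yk; rewrite /= ex ey.
  by case: (N) => [|n] /= ->; split; auto; case.
- move=> p pZ w wZ u uZ e; destruct qa; try (by move/code_inj: e).
  inv_code e; simpl in sa.
  move: sa; rewrite /mk_crole; case er: (lookup (s_cr sg) p) => [N|] //=.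
  case e1: (wsubst sg w0) => [[i|?]|] //.
  case e2: (usubst sg _) => [[?|f]|] // [ga']; subst ga.
  have iZ := wsubst_ind_lt wZ e1; have fZ := usubst_const_lt uZ e2.
  have [x [xk ex]] := ind_at i iZ; have [j [jL ej]] := const_value fZ.
  move/(lookupP _ _ up): er => rN; have lt := subst_lt (nthc_subst3 sg) rN.
  exists x; split=> //; exists j; split=> //; exists i; split=> //.
  exists (enc_const f); split=> //; exists N; split.
    by apply: ltn_trans lt; apply: code_lt; rewrite !inE eqxx orbT.
  split; first by apply/memc_map; exists N.
  split; first exact: (subst_wval us wZ e1).
  split; first exact: (subst_uval us uZ e2).
  do 2![split; first by tr]; apply: bE => /=.
  have := @truth_crole (PName N) x j (name_code_lt lt) xk jL.
  by rewrite /= ex ej g_emb.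
- move=> c cZ w wZ e; destruct qa; try (by move/code_inj: e).
  inv_code e; simpl in sa.
  move: sa; rewrite /mk_concept; case er: (lookup (s_c sg) c) => [N|] //=.
  case e1: (wsubst sg w0) => [[i|?]|] // [ga']; subst ga.
  have iZ := wsubst_ind_lt wZ e1; have [x [xk ex]] := ind_at i iZ.
  move/(lookupP _ _ uc): er => rN; have lt := subst_lt (nthc_subst1 sg) rN.
  exists x; split=> //; exists i; split=> //; exists N; split.
    by apply: ltn_trans lt; apply: code_lt; rewrite !inE eqxx orbT.
  split; first by apply/memc_map; exists N.
  split; first exact: (subst_wval us wZ e1).
  split; [by tr|apply: bE => /=].
  by have := @truth_concept (CName N) x (name_code_lt lt) xk; rewrite /= ex.
- move=> w wZ w' w'Z e; destruct qa; try (by move/code_inj: e).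
  inv_code e; simpl in sa.
  move: sa; rewrite /mk_eq; case e1: (wsubst sg w0) => [[i|e]|] //;
    case e2: (wsubst sg w1) => [[j|f]|] // [ga']; subst ga; [left|right].
    have iZ := wsubst_ind_lt wZ e1; have jZ := wsubst_ind_lt w'Z e2.
    have [x [xk ex]] := ind_at i iZ; have [y [yk ey]] := ind_at j jZ.
    exists x; split=> //; exists y; split=> //; exists i; split=> //; exists j; split=> //.
    split; first exact: (subst_wval us wZ e1).
    split; first exact: (subst_wval us w'Z e2).
    do 2![split; first by tr]; apply: bE; rewrite /= -ex -ey.
    by split=> [->|/elt_inj] //; apply.
  have eZ := wsubst_const_lt e1; have fZ := wsubst_const_lt e2.
  have [x [xL ex]] := const_value eZ; have [y [yL ey]] := const_value fZ.
  exists x; split=> //; exists y; split=> //; exists (enc_const e); split=> //.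
  exists (enc_const f); split=> //.
  split; first exact: (subst_wval us wZ e1).
  split; first exact: (subst_wval us w'Z e2).
  do 2![split; first by tr]; apply: bE; rewrite /= -!g_emb -ex -ey.
  by split=> [->|/g_inj/dv_inj] //; apply.
- move=> w wZ w' w'Z e; destruct qa; try (by move/code_inj: e).
  inv_code e; simpl in sa.
  move: sa; rewrite /mk_eq; case e1: (usubst sg u) => [[i|e]|] //;
    case e2: (usubst sg u0) => [[j|f]|] // [ga']; subst ga; [left|right].
    have iZ := usubst_ind_lt e1; have jZ := usubst_ind_lt e2.
    have [x [xk ex]] := ind_at i iZ; have [y [yk ey]] := ind_at j jZ.
    exists x; split=> //; exists y; split=> //; exists i; split=> //; exists j; split=> //.
    split; first exact: (subst_uval us wZ e1).
    split; first exact: (subst_uval us w'Z e2).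
    do 2![split; first by tr]; apply: bE; rewrite /= -ex -ey.
    by split=> [->|/elt_inj] //; apply.
  have eZ := usubst_const_lt wZ e1; have fZ := usubst_const_lt w'Z e2.
  have [x [xL ex]] := const_value eZ; have [y [yL ey]] := const_value fZ.
  exists x; split=> //; exists y; split=> //; exists (enc_const e); split=> //.
  exists (enc_const f); split=> //.
  split; first exact: (subst_uval us wZ e1).
  split; first exact: (subst_uval us w'Z e2).
  do 2![split; first by tr]; apply: bE; rewrite /= -!g_emb -ex -ey.
  by split=> [->|/g_inj/dv_inj] //; apply.
Qed.

End Values.

Lemma coded_model_complete : exists k L m,
  [/\ k < Z.+1, 0 < k, L < (dbound Z).+1, m < 2 ^ (16 * Z * Z * dbound Z)
    & coded_model orac Z k L m kk qq ss].
Proof.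
have [S [uS sS HS]] := data_representatives.
have /andP[k0 kZ] := elts_size.
pose B := dbound Z.
have [m [mZ mP]] := bits_of_pred (16 * Z * Z * B)
  (fun i => truth S (i %/ B %/ Z %/ Z) (i %/ B %/ Z %% Z) (i %/ B %% Z) (i %% B)).
have B0 : 0 < B by rewrite /B /dbound muln_gt0 expn_gt0.
have factE : fact Z m = truth S.
  apply/funext => so; apply/funext => c; apply/funext => x; apply/funext => y.
  apply/propext; rewrite /fact -/B.
  have in_range : so < 16 -> c < Z -> x < Z -> y < B ->
      (bit m (((so * Z + c) * Z + x) * B + y) <-> truth S so c x y).
    move=> so16 cZ xZ yB; rewrite mP; last by do ?apply: ltn_radix.
    by rewrite modnMDl (modn_small yB) !divnMDl // (divn_small yB) addn0
      modnMDl (modn_small xZ) !divnMDl // (divn_small xZ) addn0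
      modnMDl (modn_small cZ) !divnMDl // (divn_small cZ) addn0.
  split=> [[[so16 [cZ [xZ yB]]] /in_range]|H]; first exact.
  by case: (H) => -[so16 [cZ [xZ yB]]] _; split=> //; apply/in_range.
exists k, (size S), m; split=> //; rewrite /coded_model factE.
split; [|split; [|split]].
- split; [exact: concept_complete|split; [exact: arole_complete|split]].
    exact: crole_complete.
  by split; [exact: dterm_complete|exact: chain_complete].
- split; [exact: ind_complete|split; [exact: rbox_complete|split]].
    exact: tbox_complete.
  exact: abox_complete.
- exact: query_complete.
- exact: data_complete.
Qed.

End Completeness.

(** * Domains of substitutions *)

Lemma mem_unzip1 T (s : seq (nat * T)) x :
  x \in unzip1 s <-> exists v, List.In (x, v) s.
Proof.
elim: s => [|[y v] s IH] /=; first by split=> // -[].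
rewrite inE; split.
  by case/predU1P=> [->|/IH[w ws]]; [exists v; left|exists w; right].
case=> w [[-> _]|ws]; first by rewrite eqxx.
by apply/orP; right; apply/IH; exists w.
Qed.

Lemma size_code l : size l <= code l.
Proof. by elim: l => //= h l IH; apply: leq_ltn_trans IH (ltn_ccons2 _ _). Qed.

(** The bounds in [dom_rule] lose nothing: keys, coded values and positions of entries are all below
    [Z] because the coded list is. *)
Lemma dom_ruleP T (enc : T -> nat) (s : seq (nat * T)) Z (P : nat -> Prop) vs :
  enc_map enc s < Z -> (forall x, x \in vs -> x < Z) ->
  (forall x, x < Z -> (P x <-> x \in vs)) ->
  (dom_rule Z (enc_map enc s) P <-> has_domain s vs).
Proof.
move=> sZ vsZ PE.
have entZ x a : memc (code [:: x; a]) (enc_map enc s) -> x < Z /\ a < Z.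
  move/memc_lt => lt; have {}lt := ltn_trans lt sZ.
  by split; apply: ltn_trans lt; apply: code_lt; rewrite !inE eqxx ?orbT.
have domE x : x \in unzip1 s <-> exists a, a < Z /\ memc (code [:: x; a]) (enc_map enc s).
  rewrite mem_unzip1; split=> [[v vs']|[a [_ /memc_map[v [vs' _]]]]]; last by exists v.
  have m : memc (code [:: x; enc v]) (enc_map enc s) by apply/memc_map; exists v.
  by exists (enc v); split=> //; case: (entZ _ _ m).
have keyZ x : x \in unzip1 s -> x < Z by case/domE=> a [_ /entZ[]].
have uniqE : uniq (unzip1 s) <-> forall i, i < Z -> forall j, j < Z -> forall x, x < Z ->
   forall a, a < Z -> forall b, b < Z ->
     nthc (enc_map enc s) i = code [:: x; a] -> nthc (enc_map enc s) j = code [:: x; b] ->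
     i = j.
  have szZ : size s < Z.
    by apply: leq_ltn_trans sZ; rewrite -(size_map (fun p => code [:: p.1; enc p.2])) size_code.
  rewrite /nthc CodeSeq.codeK.
  have nthE i x a : nth 0 [seq code [:: p.1; enc p.2] | p <- s] i = code [:: x; a] ->
      i < size s /\ nth 0 (unzip1 s) i = x.
    have [li|li] := ltnP i (size s); last first.
      (* Beyond the end of the list the entry is 0, which is not the code of a pair. *)
      by rewrite nth_default ?size_map // => e; have := code_lt (mem_head x [:: a]); rewrite -e.
    case: (s) li => // p s' li; rewrite !(nth_map p) // => /code_inj[-> _] //.
  split=> [us i _ j _ x _ a _ b _ /nthE[li ei] /nthE[lj ej]|H].
    by apply/eqP; rewrite -(nth_uniq 0 _ _ us) ?size_map // ei ej.
  apply/(uniqP 0) => i j; rewrite !inE !size_map => li lj e.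
  have nthZ k : k < size s -> exists a, a < Z /\
      nth 0 [seq code [:: p.1; enc p.2] | p <- s] k = code [:: nth 0 (unzip1 s) k; a].
    move=> lk; have [a ea] : exists a, nth 0 [seq code [:: p.1; enc p.2] | p <- s] k =
        code [:: nth 0 (unzip1 s) k; a].
      by case: (s) lk => // p s' lk; rewrite !(nth_map p) //; eexists.
    exists a; split=> //; apply: leq_ltn_trans sZ.
    have := nthc_le (enc_map enc s) k; rewrite /nthc CodeSeq.codeK ea; apply: leq_trans.
    by rewrite ltnW // code_lt // !inE eqxx orbT.
  have [a [aZ ea]] := nthZ i li; have [b [bZ eb]] := nthZ j lj.
  rewrite -e in eb; apply: (H i _ j _ _ _ a aZ b bZ ea eb); try exact: ltn_trans szZ.
  by apply: keyZ; apply: mem_nth; rewrite size_map.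
rewrite /dom_rule /has_domain -uniqE; split=> -[us H]; split=> // x.
  apply/idP/idP => [xs|xv].
    by apply/PE; [apply: keyZ|apply/H; [apply: keyZ|apply/domE]].
  by apply/domE/H; [apply: vsZ|apply/PE => //; apply: vsZ].
by move=> xZ; rewrite PE // -H domE.
Qed.

Section QueryVariables.
Variables (D : datatype_map) (Q : query D) (Z : nat).
Hypothesis QZ : enc_query Q < Z.

Lemma mem_query_vars (vs : qatom D -> seq nat) x :
  x \in query_vars vs Q <-> exists l, List.In l Q /\ x \in vs l.2.
Proof.
rewrite /query_vars; elim: (Q) => [|l Q' IH] /=; first by split=> // -[l []].
rewrite mem_cat; split.
  by case/orP=> [xl|/IH[l' [? ?]]]; [exists l|exists l']; auto.
case=> l' [[<-|lQ] xl]; first by rewrite xl.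
by apply/orP; right; apply/IH; exists l'.
Qed.

Lemma memc_query b a : memc (code [:: b; a]) (enc_query Q) <->
  exists l : bool * qatom D, [/\ List.In l Q, b = l.1 & a = enc_qatom l.2].
Proof.
rewrite /memc CodeSeq.codeK; elim: (Q) => [|l Q' IH] /=; first by split=> // -[l []].
rewrite inE; split.
  case/predU1P=> [/code_inj[-> ->]|/IH[l' [? ? ?]]]; last by exists l'; split; auto.
  by exists l; split; auto.
case=> l' [[<-|lQ] eb ea]; first by rewrite eb ea eqxx.
by apply/orP; right; apply/IH; exists l'.
Qed.

Lemma literal_lt b a : memc (code [:: b; a]) (enc_query Q) -> b < Z /\ a < Z.
Proof.
move/memc_lt => lt; have {}lt := ltn_trans lt QZ.
by split; apply: ltn_trans lt; apply: code_lt; rewrite !inE eqxx ?orbT.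
Qed.

Lemma wvarsP w x : enc_wterm w = code [:: 0; x] <-> x \in wvars w.
Proof.
case: w => y /=; last by split=> // /code_inj.
by rewrite inE; split=> [/code_inj[->]|/eqP->].
Qed.

Lemma uvarsP (u : uterm D) x : enc_uterm u = code [:: 0; x] <-> x \in uvars u.
Proof.
case: u => y /=; last by split=> // /code_inj.
by rewrite inE; split=> [/code_inj[->]|/eqP->].
Qed.

Lemma atom_positionsP tag l x : code (tag :: l) < Z ->
  ((exists p, p \in term_positions /\
      exists c, c < Z /\ (code (tag :: l) = ccons p.1 c /\ nthc c p.2 = code [:: 0; x])) <->
   exists i, (tag, i) \in term_positions /\ nth 0 l i = code [:: 0; x]).
Proof.
move=> lt; split.
  case=> -[t i] [pE [c [_ [/=]]]]; rewrite code_cons => /ccons_inj[-> <-].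
  by rewrite nthc_code; exists i.
case=> i [pE ei]; exists (tag, i); split=> //; exists (code l).
by rewrite nthc_code; split=> //; apply: ltn_trans lt; apply: ltn_ccons2.
Qed.

Lemma ivarP x : ivar Z (enc_query Q) x <-> x \in query_vars (@atom_ivars D) Q.
Proof.
have atomP (a : qatom D) : enc_qatom a < Z ->
  ((exists p, p \in term_positions /\
    exists c, c < Z /\ (enc_qatom a = ccons p.1 c /\ nthc c p.2 = code [:: 0; x])) <->
   x \in atom_ivars a).
  case: a => > lt; rewrite [enc_qatom _]/= atom_positionsP // /= ?mem_cat; split.
  all: try (by case=> [[|[|[|i]]]] [] //= _; rewrite ?wvarsP ?uvarsP => ->; rewrite ?orbT).
  1,4: by case/orP=> /wvarsP; [exists 1|exists 2].
  1,3: by case/orP=> [/wvarsP|/uvarsP]; [exists 1|exists 2].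
  1,2: by move/wvarsP; exists 1.
  1: by case/orP=> /wvarsP; [exists 0|exists 1].
  by case/orP=> /uvarsP; [exists 0|exists 1].
rewrite mem_query_vars; split.
  case=> b [_ [a [aZ [/memc_query[l [lQ _ ea]] H]]]]; subst a.
  by exists l; split=> //; apply/atomP.
case=> l [lQ xl].
have m : memc (code [:: l.1 : nat; enc_qatom l.2]) (enc_query Q) by apply/memc_query; exists l.
have [bZ aZ] := literal_lt m.
by exists (l.1 : nat); split=> //; exists (enc_qatom l.2); split=> //; split=> //; apply/atomP.
Qed.

Lemma hvarP tag (vs : qatom D -> seq nat) x :
  (forall a, x \in vs a <-> exists l, enc_qatom a = code [:: tag, x & l]) ->
  hvar tag Z (enc_query Q) x <-> x \in query_vars vs Q.
Proof.
move=> H; rewrite mem_query_vars; split.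
  case=> b [_ [a [aZ [/memc_query[l [lQ _ ea]] [c [cZ [ec cx]]]]]]]; subst a.
  exists l; split=> //; apply/H.
  move: ec; rewrite ccons_decode; move: cx; rewrite /nthc.
  (* An empty argument list would also show 0 as its first entry, but every atom has arguments. *)
  case: (decode c) => [|y l'] /= yx e; last by exists l'; rewrite e yx.
  by case: (l.2) e => > /code_inj.
case=> l [lQ /H[l' e]].
have m : memc (code [:: l.1 : nat; enc_qatom l.2]) (enc_query Q) by apply/memc_query; exists l.
have [bZ aZ] := literal_lt m.
exists (l.1 : nat); split=> //; exists (enc_qatom l.2); split=> //; split=> //.
rewrite e in aZ *; exists (code (x :: l')); rewrite nthc_code; split=> //.
by apply: ltn_trans aZ; apply: ltn_ccons2.
Qed.

Lemma query_var_lt (vs : qatom D -> seq nat) x :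
  (forall a, x \in vs a -> x < enc_qatom a) -> x \in query_vars vs Q -> x < Z.
Proof.
move=> H /mem_query_vars[l [lQ /H lt]]; apply: ltn_trans lt _.
by have /literal_lt[] : memc (code [:: l.1 : nat; enc_qatom l.2]) (enc_query Q)
  by apply/memc_query; exists l.
Qed.

End QueryVariables.

Lemma subst_rulesP D (Q : query D) (sg : subst D) Z :
  enc_query Q < Z -> enc_subst sg < Z ->
  (subst_rules Z (enc_query Q) (enc_subst sg) <-> subst_on sg Q).
Proof.
move=> QZ sZ.
have nZ i : nthc (enc_subst sg) i < Z by apply: leq_ltn_trans sZ; apply: nthc_le.
have ltw w x : x \in wvars w -> x < enc_wterm w.
  by move/wvarsP->; apply: code_lt; rewrite !inE eqxx orbT.
have ltu (u : uterm D) x : x \in uvars u -> x < enc_uterm u.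
  by move/uvarsP->; apply: code_lt; rewrite !inE eqxx orbT.
have d0 : dom_rule Z (nthc (enc_subst sg) 0) (ivar Z (enc_query Q)) <->
    has_domain (s_i sg) (query_vars (@atom_ivars D) Q).
  have := nZ 0; rewrite nthc_subst0 => nZ0; apply: dom_ruleP => // x; last by rewrite ivarP.
  apply: (query_var_lt QZ) => a.
  have pos t l (v : nat) : v \in l -> x < v -> x < code (t :: l).
    by move=> vl /ltn_trans; apply; apply: code_lt; rewrite inE vl orbT.
  by case: a => > /=; rewrite ?mem_cat => xin; move: xin; try case/orP; move=> xin;
    first [apply: pos (ltw _ _ xin) | apply: pos (ltu _ _ xin)]; rewrite !inE eqxx ?orbT.
have d1 : dom_rule Z (nthc (enc_subst sg) 1) (hvar 5 Z (enc_query Q)) <->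
    has_domain (s_c sg) (query_vars (@atom_cvars D) Q).
  have := nZ 1; rewrite nthc_subst1 => nZ1; apply: dom_ruleP => // x.
    apply: (query_var_lt QZ) => -[] //= c w; rewrite inE => /eqP->.
    by apply: code_lt; rewrite !inE eqxx orbT.
  move=> _; apply: hvarP => // a; split.
    by case: a => > //=; rewrite inE => /eqP->; eexists.
  by case=> l; case: a => > /code_inj // [->]; rewrite /= inE eqxx.
have d2 : dom_rule Z (nthc (enc_subst sg) 2) (hvar 3 Z (enc_query Q)) <->
    has_domain (s_ar sg) (query_vars (@atom_arvars D) Q).
  have := nZ 2; rewrite nthc_subst2 => nZ2; apply: dom_ruleP => // x.
    apply: (query_var_lt QZ) => -[] //= c w w'; rewrite inE => /eqP->.
    by apply: code_lt; rewrite !inE eqxx orbT.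
  move=> _; apply: hvarP => // a; split.
    by case: a => > //=; rewrite inE => /eqP->; eexists.
  by case=> l; case: a => > /code_inj // [->]; rewrite /= inE eqxx.
have d3 : dom_rule Z (nthc (enc_subst sg) 3) (hvar 4 Z (enc_query Q)) <->
    has_domain (s_cr sg) (query_vars (@atom_crvars D) Q).
  have := nZ 3; rewrite nthc_subst3 => nZ3; apply: dom_ruleP => // x.
    apply: (query_var_lt QZ) => -[] //= c w u; rewrite inE => /eqP->.
    by apply: code_lt; rewrite !inE eqxx orbT.
  move=> _; apply: hvarP => // a; split.
    by case: a => > //=; rewrite inE => /eqP->; eexists.
  by case=> l; case: a => > /code_inj // [->]; rewrite /= inE eqxx.
by rewrite /subst_rules d0 d1 d2 d3; split=> [[? [? []]]|[]].
Qed.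

Lemma query_satP D (I : interp D) (Q : query D) (sg : subst D) :
  query_sat I Q sg <-> exists G, qsubst sg Q = Some G /\ gquery_sat I G.
Proof.
rewrite /query_sat; elim: Q => [|[b a] Q IH] /=.
  by split=> [_|_ l []]; exists [::]; split=> // l [].
have signed (P : Prop) : (P <-> b) <-> (if b then P else ~ P).
  by case: b; split=> [[H1 H2]|H]; [apply: H2|split|move/H1|split=> // /H].
split.
  move=> H; have [g [-> /signed sg_g]] := H (b, a) (or_introl erefl).
  have [G [-> HG]] : exists G, qsubst sg Q = Some G /\ gquery_sat I G.
    by apply/IH => l lQ; apply: H; right.
  by exists ((b, g) :: G); split=> // l [<-//|]; apply: HG.
case=> G []; case ea: (asubst sg a) => [g|] //; case eQ: (qsubst sg Q) => [G'|] // [<-] HG.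
move=> l [<-|lQ].
  by exists g; split=> //; apply/signed; apply: (HG (b, g)); left.
have /IH H : exists G, qsubst sg Q = Some G /\ gquery_sat I G.
  by exists G'; split=> // l' lG; apply: HG; right.
exact: H.
Qed.

(** * The data domain *)

(** [X] serves as the data domain of the models built. The embedding into the data domain of every
    interpretation is what allows arbitrary models to be restricted to it. *)
Lemma answerP D X (x0 : X) (emb : dval D -> X) (orac : nat -> Prop) :
  injective emb -> (forall c, orac (enc_dconj c) <-> satisfiable_in emb c) ->
  (forall I : interp D, exists2 g : X -> DeltaD I,
     injective g & forall v, g (emb v) = demb I v) ->
  forall (K : kb D) (Q : query D) (sg : subst D),
    answer orac (enc_kb K) (enc_query Q) (enc_subst sg) <-> ho_answer_set K Q sg.
Proof.
move=> emb_inj oracP emb_sub K Q sg; rewrite /answer /answer_bounded.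
rewrite subst_rulesP; try lia.
split=> -[son].
  have us : [/\ uniq (unzip1 (s_i sg)), uniq (unzip1 (s_c sg)),
      uniq (unzip1 (s_ar sg)) & uniq (unzip1 (s_cr sg))]
      by case: son => -[? _] [? _] [? _] [? _].
  case=> -[|k] [kZ [// _ [L [_ [m [_ rules]]]]]].
  have [I [IK /query_satP[G [eG IG]]]] := coded_model_sound x0 emb_inj oracP us kZ rules.
  by split=> //; exists G => //; exists I.
have us : [/\ uniq (unzip1 (s_i sg)), uniq (unzip1 (s_c sg)),
    uniq (unzip1 (s_ar sg)) & uniq (unzip1 (s_cr sg))]
    by case: son => -[? _] [? _] [? _] [? _].
case=> G eG [I IK IG]; have [g g_inj g_emb] := emb_sub I.
have IQ : query_sat I Q sg by apply/query_satP; exists G.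
have [k [L [m [kZ k0 LZ mZ rules]]]] :=
  coded_model_complete x0 oracP us IK IQ g_inj g_emb.
by split=> //; exists k; split=> //; split=> //; exists L; split=> //; exists m.
Qed.

(* Over the one-point data domain, where no constant and no data type exists,
   data ranges are iterated negations of the empty one; [(r, b)] is represented
   by [r * 2 + b] and means that [r] has the truth value [b]. *)
Definition closed_values (c m : nat) : Prop :=
  bit m (code [:: 0; 0] * 2) /\
  forall r, r < c -> code [:: 2; r] < c ->
    (bit m (r * 2) -> bit m (code [:: 2; r] * 2 + 1)) /\
    (bit m (r * 2 + 1) -> bit m (code [:: 2; r] * 2)).

(** Without values no assignment exists, so [effective] only provides an oracle that rejects even
    the empty conjunction; this one replaces it. Over one point inequations fail, and a range is
    true when all closed sets of truth values say so. *)
Definition trivial_orac (c : nat) : Prop :=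
  nthc c 1 = 0 /\
  forall x, x < c -> forall r, r < c -> memc (code [:: x; r]) (nthc c 0) ->
    forall m, m < 2 ^ (c * 2) -> closed_values c m -> bit m (r * 2 + 1).

Lemma edec_trivial_orac : edec (fun s => trivial_orac (s 0)).
Proof. by rewrite /trivial_orac /closed_values; erec_solve fail. Qed.

(** Every closed set contains the true value of each range within the bound, and the true values
    within the bound form a closed set; their intersection is therefore the truth. *)
Lemma trivial_oracP D (emb : dval D -> unit) : (dval D -> False) ->
  forall c : dconj D, trivial_orac (enc_dconj c) <-> satisfiable_in emb c.
Proof.
move=> no c; pose N := enc_dconj c.
have drP r : (exists r', r = DRNot r') \/
    enc_drange r = code [:: 0; 0] /\ ~ drange_sem emb r tt.
  case: r => [[|e es]|d psi|r]; last by left; exists r.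
  - by right; split=> // -[].
  - by case: (no (cval e)).
  - by case: (dint_nonempty d) => x; case: (no (existT _ d x)).
have valP m r : closed_values N m -> enc_drange r < N ->
    bit m (enc_drange r * 2 + `[< drange_sem emb r tt >]).
  case=> m0 m1; elim: r => [es|d psi|r IH] lt.
  - by case: (drP (DRConsts es)) => [[]//|[-> /asboolF ->]]; rewrite addn0.
  - by case: (drP (DRFacet psi)) => [[]//|[-> /asboolF ->]]; rewrite addn0.
  have ltr : enc_drange r < N by apply: ltn_trans lt; apply: code_lt; rewrite !inE eqxx orbT.
  have [H1 H2] := m1 _ ltr lt; have := IH ltr; rewrite [drange_sem _ (DRNot _) _]/= asbool_neg.
  by case: asboolP => _ /=; rewrite !addn0; [apply: H2|apply: H1].
have entry p : List.In p (dc_range c) -> p.1 < N /\ enc_drange p.2 < N.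
  case: p => x r xr.
  have lt : code [:: x; enc_drange r] < N.
    apply: (@ltn_trans (enc_map (@enc_drange D) (dc_range c))).
      by apply: memc_lt; apply/memc_map; exists r.
    by apply: code_lt; rewrite mem_head.
  by split; apply: ltn_trans lt; apply: code_lt; rewrite !inE eqxx ?orbT.
have n0 : nthc N 0 = enc_map (@enc_drange D) (dc_range c) by exact: nthc_code.
have n1 : nthc N 1 = enc_map id (dc_neq c) by exact: nthc_code.
have neq0 : enc_map id (dc_neq c) = 0 <-> dc_neq c = [::].
  case: (dc_neq c) => [|p l]; first by [].
  split=> // e; have := ltn_ccons1 (code [:: p.1; p.2]) (enc_map id l).
  by rewrite -[X in _ < X]/(enc_map id (p :: l)) e.
rewrite /trivial_orac -/N n0 n1 neq0; split.
  case=> neq H; exists (fun=> tt); split=> [[x r] xr|]; last by rewrite neq.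
  have [xN rN] := entry _ xr.
  have [m [mN mP]] := bits_of_pred (N * 2) (fun i => exists r : drange D,
    i = enc_drange r * 2 + `[< drange_sem emb r tt >]).
  have {}mP := bit_lt mN mP.
  have mcl : closed_values N m.
    split.
      apply/mP; split.
        (* A range of the conjunction is either coded by [code [:: 0; 0] = 3] or a negation with a
           larger code, so this bit position lies within the bound. *)
        case: (drP r) => [[r' er]|[<- _]]; last by rewrite ltn_mul2r.
        suff : code [:: 0; 0] < N by rewrite ltn_mul2r.
        apply: leq_ltn_trans rN; rewrite er /=.
        by rewrite (_ : code [:: 0; 0] = 3) // code_cons /ccons; lia.
      exists (DRConsts [::]); rewrite (_ : `[< _ >] = false) ?addn0 //.
      by apply: asboolF => -[].
    move=> s sN sN'; split=> /mP[_ [r' er]]; apply/mP.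
      have [es sem] : s = enc_drange r' /\ `[< drange_sem emb r' tt >] = false.
        by move: er; case: asboolP => _ /= er; split=> //; lia.
      split; first by lia.
      exists (DRNot r'); rewrite -[enc_drange (DRNot r')]/(code [:: 2; enc_drange r']).
      by rewrite -es /= asbool_neg sem.
    have [es sem] : s = enc_drange r' /\ `[< drange_sem emb r' tt >] = true.
      by move: er; case: asboolP => _ /= er; split=> //; lia.
    split; first by lia.
    exists (DRNot r'); rewrite -[enc_drange (DRNot r')]/(code [:: 2; enc_drange r']).
    by rewrite -es /= asbool_neg sem addn0.
  have : bit m (enc_drange r * 2 + 1).
    by apply: (H x xN) => //; apply/memc_map; exists r.
  case/mP=> _ [r' er]; have [es sem] : enc_drange r = enc_drange r' /\ drange_sem emb r' tt.
    by move: er; case: asboolP => s /= er; split=> //; lia.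
  by rewrite (enc_drange_inj es).
case=> rho [Hr Hn]; split.
  by case: (dc_neq c) Hn => // p l /(_ p (or_introl erefl)); case: (rho _); case: (rho _).
move=> x _ r rN /memc_map[r' [xr er]] m mN mcl; subst r.
have := valP m r' mcl rN; have := Hr _ xr => /=; case: (rho x) => sem.
by rewrite asboolT.
Qed.

Theorem theorem1 (D : datatype_map) (hD : effective D) : hocqa_decidable D.
Proof.
have [orac [ro oracP]] : exists orac : nat -> Prop, edec (fun s => orac (s 0)) /\
    forall (K : kb D) (Q : query D) (sg : subst D),
      answer orac (enc_kb K) (enc_query Q) (enc_subst sg) <-> ho_answer_set K Q sg.
  (* The distinction depends on [D] alone: it selects one of two algorithms and need not itself be
     computed. *)
  have [[v0]|no] := pselect (inhabited (dval D)).
    have [f rf fP] := hD; exists (fun c => f [tuple c] = 1); split.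
      apply: edec_eq; last exact: erec_const.
      exists 1, f; split=> // s; congr f; apply: eq_from_tnth => i.
      by rewrite tnth_mktuple (ord1 i).
    apply: (answerP v0 (emb := id)) => //.
      move=> c; have [f1 f0] := fP c; split=> [e|/f1//].
      by apply: contrapT => /f0; rewrite e.
    by move=> I; exists (@demb D I) => //; apply: demb_inj.
  have {}no (v : dval D) : False by apply: no; exists.
  exists trivial_orac; split; first exact: edec_trivial_orac.
  apply: (answerP tt (emb := fun=> tt)); first by move=> v; case: (no v).
    exact: trivial_oracP.
  move=> I; have [w] := DeltaD_nonempty I; exists (fun=> w); last by move=> v; case: (no v).
  by case=> -[].
have [f rf fP] := edec_recursive 3 (edec_answer ro); exists f => // K Q sg.
have [f1 f0] := fP [tuple enc_kb K; enc_query Q; enc_subst sg].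
by split=> H; [apply: f1|apply: f0]; rewrite oracP.
Qed.
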